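(* Let $F\in L^3(E_A)$ be such that $\mathbb{E}[F\mid Z]=0$ and $\mathbb{E}[F^2]=1$, and such that $\Gamma(F,\mathsf{L}^{-1}F)$ is defined. Then $$d_W(F,\mathcal{N}(0,1))\le\sqrt{\frac2\pi}\;\mathbb{E}\big|\Gamma(F,-\mathsf{L}^{-1}F)-1\big|+\frac12\sum_{a\in A}\mathbb{E}\big[\,|\Delta^{\{a\}'}\mathsf{L}^{-1}F|\,(\Delta^{\{a\}'}F)^2\big].$$ Moreover, if $F\in L^4(E_A)$, then one has the further bound $$d_W(F,\mathcal{N}(0,1))\le\sqrt{\frac2\pi}\sqrt{\operatorname{var}\big(\Gamma(F,\mathsf{L}^{-1}F)\big)}+\frac{\sqrt2}{2}\sqrt{-\mathbb{E}[F\,\mathsf{L}F]}\,\sqrt{\sum_{a\in A}\mathbb{E}\big[|\Delta^{\{a\}'}F|^4\big]}.$$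
   Context: Setting. $A$ is an at most countable set, $E_0$ and $(E_a)_{a\in A}$ are Polish spaces and $E_A=\prod_{a\in A}E_a$. On a probability space, $Z$ is an $E_0$-valued random variable and $X=(X_a)_{a\in A}$ is a family of random variables, $X_a$ being $E_a$-valued, which is conditionally independent given $Z$: for each $a$, the conditional law of $X_a$ given $\sigma((X_b)_{b\ne a},Z)$ equals its conditional law given $\sigma(Z)$. For $B\subset A$, $X^{B}=(X_b)_{b\in A\setminus B}$, $\mathcal{G}^B=\sigma(X^B)\vee\sigma(Z)$, $\mathcal{G}^a=\mathcal{G}^{\{a\}}$. $L^p(E_A)$ is the space of real $p$-integrable functionals of $X$; functionals are allowed to depend measurably on $Z$ as well. Operators. $D_aF=F-\mathbb{E}[F\mid\mathcal{G}^a]$. $\mathsf{L}F=-\sum_{a\in A}D_aF$, with domain the $F\in L^2(E_A)$ for which the sum is in $L^2$. Every $F\in L^2(E_A)$ has an orthogonal decomposition $F=\mathbb{E}[F\mid Z]+\sum_{n\ge1}\pi_n(F)$ with $\mathsf{L}\pi_n(F)=-n\pi_n(F)$, where $\pi_n(F)$ is the limit along finite sets $A_m\uparrow A$ of $\sum_{J\subset A_m,|J|=n}(\prod_{b\in J}D_b)(\prod_{c\in A_m\setminus J}\mathbb{E}[\cdot\mid\mathcal{G}^c])F$. For $F$ with $\mathbb{E}[F\mid Z]=0$, $\mathsf{L}^{-1}F=-\sum_{n\ge1}\pi_n(F)/n$; and $-\mathbb{E}[F\mathsf{L}F]=\sum_{n\ge1}n\,\mathbb{E}[\pi_n(F)^2]\in[0,\infty]$.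 For each $a$, $X'_a$ has the conditional law of $X_a$ given $Z$ and is conditionally independent of $X$ given $Z$; $F^{\{a\}'}$ is $F$ with $X_a$ replaced by $X'_a$, and $\Delta^{\{a\}'}F=F-F^{\{a\}'}$. The carré du champ is $$\Gamma(F,G)=\frac12\sum_{a\in A}\mathbb{E}\big[(\Delta^{\{a\}'}F)(\Delta^{\{a\}'}G)\,\big|\,X,Z\big],$$ defined when $\sum_{a}\mathbb{E}|\Delta^{\{a\}'}F\,\Delta^{\{a\}'}G|<\infty$; on functionals depending on finitely many coordinates it equals $\frac12\{\mathsf{L}(FG)-F\mathsf{L}G-G\mathsf{L}F\}$. $d_W(F,\mathcal{N}(0,1))=\sup_h|\mathbb{E}[h(F)]-\mathbb{E}[h(Y)]|$, $Y\sim\mathcal{N}(0,1)$, supremum over $1$-Lipschitz $h:\mathbb{R}\to\mathbb{R}$. *)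

(* Defs.v *)
From mathcomp Require Import all_boot all_order all_algebra finmap.
From mathcomp Require Import all_classical all_reals all_analysis.

Set Implicit Arguments.
Unset Strict Implicit.
Unset Printing Implicit Defensive.

Import Order.TTheory GRing.Theory Num.Theory.
Import numFieldNormedType.Exports.

Local Open Scope classical_set_scope.
Local Open Scope ring_scope.

Section polish.
Variables (R : realType) (T : ptopologicalType).

Definition is_metric (dist : T -> T -> R) : Prop :=
  [/\ forall x y, 0 <= dist x y,
      forall x y, dist x y = 0 <-> x = y,
      forall x y, dist x y = dist y x &
      forall x y z, dist x z <= dist x y + dist y z].

Definition metrizes (dist : T -> T -> R) : Prop :=
  forall (x : T) (U : set T), nbhs x U <->
    exists2 e : R, 0 < e & [set y | dist x y < e] `<=` U.

Definition metric_complete (dist : T -> T -> R) : Prop :=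
  forall u : nat -> T,
    (forall e : R, 0 < e -> exists N, forall m n, (N <= m)%N -> (N <= n)%N ->
       dist (u m) (u n) < e) ->
    exists l : T, u @ \oo --> l.

Definition polish : Prop :=
  (exists2 D : set T, countable D & dense D) /\
  exists dist : T -> T -> R,
    [/\ is_metric dist, metrizes dist & metric_complete dist].

End polish.

Definition borel (T : ptopologicalType) := g_sigma_algebraType (@open T).

Section conditional_expectation.
Context d (Omega : measurableType d) (R : realType) (P : probability Omega R).

(* [G] is meant to be a sub-sigma-algebra of the measurable sets. *)
Definition is_condexp (G : set (set Omega)) (F Y : Omega -> R) : Prop :=
  [/\ forall B : set R, measurable B -> G (Y @^-1` B),
      P.-integrable setT (EFin \o Y) &
      forall B, G B ->
        (\int[P]_(w in B) (Y w)%:E = \int[P]_(w in B) (F w)%:E)%E].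

(* A chosen version; meaningful when [F] is integrable. *)
Definition condexp (G : set (set Omega)) (F : Omega -> R) : Omega -> R :=
  xget (cst 0) [set Y | is_condexp G F Y].

(* The conditional law of [Y1] given [G1] equals that of [Y2] given [G2]. *)
Definition same_cond_law d' (T : measurableType d')
    (G1 : set (set Omega)) (Y1 : Omega -> T)
    (G2 : set (set Omega)) (Y2 : Omega -> T) : Prop :=
  forall B : set T, measurable B ->
    {ae P, forall w, condexp G1 (\1_(Y1 @^-1` B)) w =
                     condexp G2 (\1_(Y2 @^-1` B)) w}.

End conditional_expectation.

Section functionals.
Context d (Omega : measurableType d) (R : realType) (P : probability Omega R).
Context (A : countType) (E : A -> ptopologicalType) (E0 : ptopologicalType).
Variables (X : forall a, {RV P >-> borel (E a)}) (Z : {RV P >-> borel E0}).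

Definition sigmaZ : set (set Omega) :=
  preimage_set_system setT Z measurable.

(* sigma((X_b)_{b \notin B}) \/ sigma(Z); thus [calG set0] is sigma(X, Z). *)
Definition calG (B : set A) : set (set Omega) :=
  <<s \bigcup_(b in ~` B) preimage_set_system setT (X b) measurable
      `|` sigmaZ >>.

Definition cond_independent : Prop :=
  forall a, same_cond_law P (calG [set a]) (X a) sigmaZ (X a).

(* The product of the Borel sigma-algebras on E_A x E_0. *)
Definition coordinate_cylinders : set (set ((forall a, E a) * E0)) :=
  \bigcup_a preimage_set_system setT
      (fun xz : (forall a, E a) * E0 => xz.1 a : borel (E a)) measurable
  `|` preimage_set_system setT
      (fun xz : (forall a, E a) * E0 => xz.2 : borel E0) measurable.

Definition EAZ := g_sigma_algebraType coordinate_cylinders.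

Definition represents (f : EAZ -> R) (F : Omega -> R) : Prop :=
  measurable_fun setT f /\
  {ae P, forall w, F w = f (fun a => X a w, Z w)}.

(* L^p(E_A); as usual its elements are handled through random variables,
   identified when almost surely equal. *)
Definition LpEA (p : R) : set (Omega -> R) :=
  [set F | F \in Lfun P p%:E /\ exists f, represents f F].

Definition D (a : A) (F : Omega -> R) : Omega -> R :=
  F \- condexp P (calG [set a]) F.

(* (\prod_{b in J} D_b) (\prod_{c in B \ J} E[. | G^c]) F; the factors commute
   almost surely, so that the order of the enumerations is immaterial. *)
Definition chaos_proj (B J : {fset A}) (F : Omega -> R) : Omega -> R :=
  foldr D
    (foldr (fun c => condexp P (calG [set c])) F (enum_fset (B `\` J)%fset))
    (enum_fset J).

Definition chaos_partial (n : nat) (B : {fset A}) (F : Omega -> R) :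
    Omega -> R :=
  fun w => \sum_(J <- enum_fset (fpowerset B) | #|` J| == n) chaos_proj B J F w.

Definition exhausting (B : nat -> {fset A}) : Prop :=
  (forall m, (B m `<=` B m.+1)%fset) /\ (forall a, exists m, a \in B m).

Definition L2_cvg (u : nat -> Omega -> R) (Y : Omega -> R) : Prop :=
  ('N[P]_(2%:E) [EFin \o (u m \- Y)%R] @[m --> \oo] --> 0)%E.

Definition is_chaos (n : nat) (F Y : Omega -> R) : Prop :=
  Y \in Lfun P 2%:E /\
  forall B, exhausting B -> L2_cvg (fun m => chaos_partial n (B m) F) Y.

(* pi_n(F) *)
Definition chaos (n : nat) (F : Omega -> R) : Omega -> R :=
  xget (cst 0) [set Y | is_chaos n F Y].

Definition is_Linv (F G : Omega -> R) : Prop :=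
  G \in Lfun P 2%:E /\
  L2_cvg (fun m w => - \sum_(1 <= n < m) chaos n F w / n%:R) G.

Definition Linv (F : Omega -> R) : Omega -> R :=
  xget (cst 0) [set G | is_Linv F G].

(* - E[F L F], as an element of [0, +oo] also when F is not in the domain
   of L. *)
Definition dirichlet_energy (F : Omega -> R) : \bar R :=
  (\sum_(1 <= n <oo) n%:R%:E * 'E_P[chaos n F ^+ 2])%E.

Variable X' : forall a, {RV P >-> borel (E a)}.

(* Only the joint law of X'_a with (X, Z) is constrained, separately for
   each a. *)
Definition cond_copies : Prop :=
  forall a,
    same_cond_law P sigmaZ (X' a) sigmaZ (X a) /\
    same_cond_law P (calG set0) (X' a) sigmaZ (X' a).

Definition functional_of (F : Omega -> R) : EAZ -> R :=
  xget (cst 0) [set f | represents f F].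

(* F^{a'}; it does not depend, up to almost sure equality, on the chosen
   functional representing F, since (X, Z) keeps its law when X_a is replaced
   by X'_a. *)
Definition replace (a : A) (F : Omega -> R) : Omega -> R :=
  fun w => functional_of F (dfwith (fun b => X b w) a (X' a w), Z w).

Definition Delta (a : A) (F : Omega -> R) : Omega -> R :=
  F \- replace a F.

(* Unordered sum of an absolutely summable family. *)
Definition usum (u : A -> R) : R :=
  fine (\esum_(a in [set: A]) (u^\+ a)%:E)%E
  - fine (\esum_(a in [set: A]) (u^\- a)%:E)%E.

Definition Gamma_defined (F G : Omega -> R) : Prop :=
  (\esum_(a in [set: A]) 'E_P[fun w => `|Delta a F w * Delta a G w|%R] < +oo)%E.

Definition Gamma (F G : Omega -> R) : Omega -> R :=
  fun w => 2^-1 * usum (fun a =>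
    condexp P (calG set0) (fun w => Delta a F w * Delta a G w) w).

End functionals.

(* Wasserstein distance between the law of F and N(0, 1). *)
Definition dW_normal d (Omega : measurableType d) (R : realType)
    (P : probability Omega R) (F : Omega -> R) : \bar R :=
  ereal_sup [set `| 'E_P[h \o F] - \int[normal_prob 0 1]_y (h y)%:E |%E
            | h in [set h : R -> R | 1.-lipschitz h]].

(* Main.v *)
(* Stein's equation f'(x) - x f(x) = h(x) - E h(N) has a solution with |f'| <= sqrt(2/pi)
   and f' 2-Lipschitz, so that E h(F) - E h(N) = E[f'(F) - F f(F)].
   By conditional independence the operators Q_a = E[. | G^a] are commuting orthogonal
   projections of L^2 of the law of (X, Z): on the products k(Z) prod_{a in s} 1(X_a in C_a),
   which span a dense subspace, Q_a replaces the indicator of X_a by a function of Z.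
   Expanding prod_a (D_a + Q_a) yields the chaos decomposition, and G = -L^-1 F satisfies
   sum_a D_a G = F unconditionally.  Since X'_a is a conditionally independent copy of X_a,
   E[(Delta_a G)(Delta_a H)] = 2 E[(D_a G) H], hence
     E[F f(F)] = 1/2 sum_a E[(Delta_a G)(Delta_a f(F))],
   and Delta_a f(F) = f'(F) Delta_a F + O((Delta_a F)^2) gives the first bound.
   For the second one, E[Gamma(F, G)] = E[F^2] = 1, and the remainder is bounded by the
   arithmetic-geometric inequality and sum_a E|Delta_a G|^2 <= 2 E[F^2] <= -2 E[F L F]. *)
Require Import Defs.
From HB Require Import structures.
From mathcomp Require Import all_boot all_order all_algebra finmap.
From mathcomp Require Import all_classical all_reals all_analysis.
From mathcomp Require Import measurable_realfun ring lra.

Set Implicit Arguments.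
Unset Strict Implicit.
Unset Printing Implicit Defensive.

Import Order.TTheory GRing.Theory Num.Theory.
Import numFieldNormedType.Exports.

Local Open Scope classical_set_scope.
Local Open Scope ring_scope.

(** * Stein's equation for the normal law *)

Section stein_equation.
Context {R : realType}.
Implicit Types x y : R.

(** For a test function that is merely Lipschitz, [f] has no second derivative; the second-order
    Taylor bound rests instead on [x f(x)] being 1-Lipschitz. The constant sqrt(2/pi) is twice the
    normal density at 0: it bounds 2 E(Y-x)^+ E(x-Y)^+ divided by the density at [x]. The hard point
    is that this quotient is largest at 0, which is read off a third-order linear differential
    equation. The generator is an unbounded infinite sum. What tames it is <D_a x, D_b x> = |D_a D_b
    x|^2 >= 0, which makes the norms of its finite partial sums monotone. Composed with the inverse
    they are uniformly bounded, and convergence then has to be checked only on vectors that depend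
    on finitely many coordinates. Chaoses, inverses and representing functionals are obtained by
    choice and are determined only up to null sets. All identities are therefore proved in one
    Hilbert space and pulled back to [Omega] along two maps with the same law: (X, Z) itself, and
    (X, Z) with one coordinate resampled. *)

Lemma is_derive_MVT (f df : R -> R) a b :
  (forall x, is_derive x 1 f (df x)) -> a < b ->
  exists2 c, a < c < b & f b - f a = df c * (b - a).
Proof.
move=> f' ab; have [|c cab ->] := @MVT R f df a b ab (fun x _ => f' x).
  apply: continuous_subspaceT => x; apply: differentiable_continuous.
  by apply/derivable1_diffP; case: (f' x).
by exists c => //; move: cab; rewrite in_itv.
Qed.

Lemma ge0_is_derive_le (f df : R -> R) a b :
  (forall x, is_derive x 1 f (df x)) -> (forall x, a <= x <= b -> 0 <= df x) ->
  a <= b -> f a <= f b.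
Proof.
move=> f' df0; rewrite le_eqVlt => /predU1P[->//|ab].
have [c /andP[ac cb] E] := is_derive_MVT f' ab.
by rewrite -subr_ge0 E mulr_ge0 ?df0 ?subr_ge0 ?ltW// (ltW ac) ltW.
Qed.

Lemma is_derive_continuous (f df : R -> R) :
  (forall x, is_derive x 1 f (df x)) -> continuous f.
Proof.
move=> f' x; apply: differentiable_continuous.
by apply/derivable1_diffP; case: (f' x).
Qed.

Definition ndens : R -> R := normal_pdf 0 1.

Lemma ndensE x : ndens x = ndens 0 * expR (- (x ^+ 2 / 2)).
Proof.
rewrite /ndens !normal_pdfE ?oner_neq0// /normal_fun !subr0.
rewrite expr0n/= oppr0 mul0r expR0 mulr1 expr1n; congr (_ * expR _).
by rewrite mulNr.
Qed.

Lemma ndens0E : ndens 0 = (Num.sqrt (2 * pi))^-1.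
Proof.
rewrite /ndens normal_pdfE ?oner_neq0// /normal_fun subr0 expr0n/= oppr0 mul0r.
by rewrite expR0 mulr1 /normal_peak expr1n mul1r mulr_natl.
Qed.

Lemma ndens_gt0 x : 0 < ndens x.
Proof.
rewrite ndensE mulr_gt0 ?expR_gt0// ndens0E invr_gt0 sqrtr_gt0.
by rewrite mulr_gt0 ?pi_gt0.
Qed.

Lemma ndens_ge0 x : 0 <= ndens x. Proof. exact: ltW (ndens_gt0 x). Qed.

Lemma ndens_even x : ndens (- x) = ndens x.
Proof. by rewrite ndensE [RHS]ndensE sqrrN. Qed.

Global Instance is_derive_ndens x : is_derive x 1 ndens (- (x * ndens x)).
Proof.
have -> : ndens = (fun x => ndens 0 * expR (- (x ^+ 2 / 2))).
  by apply/funext => y; exact: ndensE.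
apply: is_derive_eq; rewrite /GRing.scale/=.
by rewrite !(expr0n, mulr0, oppr0, mul0r, expR0); lra.
Qed.

Notation mu := (@lebesgue_measure R).

Lemma continuous_ndens : continuous ndens.
Proof. by apply: continuous_normal_pdf; exact: oner_neq0. Qed.

Lemma continuous_id_ndens : continuous (fun t : R => t * ndens t).
Proof. by move=> t; apply: cvgM; [exact: cvg_id|exact: continuous_ndens]. Qed.

Lemma integrable_ndens : mu.-integrable setT (EFin \o ndens).
Proof. exact: integrable_normal_pdf. Qed.

Lemma Rintegral_ndens : \int[mu]_t ndens t = 1.
Proof. by rewrite /Rintegral /ndens integral_normal_pdf. Qed.

Lemma ndens_cvgy : ndens x @[x --> +oo] --> 0.
Proof.
have -> : ndens = (fun x => ndens 0 * expR (- (x ^+ 2 / 2))).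
  by apply/funext => y; exact: ndensE.
rewrite -[X in _ --> X](mulr0 (ndens 0)); apply: cvgM; first exact: cvg_cst.
apply: (@cvg_comp _ _ _ (fun x : R => x ^+ 2 / 2) (fun y => expR (- y)) _ +oo); last exact: cvgr_expR.
apply/cvgryPge => M; near=> x.
have x1 : 1 <= x by near: x; apply: nbhs_pinfty_ge; rewrite num_real.
have xM : 2 * M <= x by near: x; apply: nbhs_pinfty_ge; rewrite num_real.
nra.
Unshelve. all: by end_near. Qed.

Lemma integral_id_ndens_ge x : 0 <= x ->
  (\int[mu]_(t in `[x, +oo[) (t * ndens t)%:E = (ndens x)%:E)%E.
Proof.
move=> x0.
have d (t : R) : is_derive t 1 (fun t => - ndens t) (t * ndens t).
  by apply: is_derive_eq; rewrite opprK.
rewrite (@ge0_continuous_FTC2y _ _ (fun t => - ndens t) x 0).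
- by rewrite -EFinB sub0r opprK.
- by move=> t xt; rewrite mulr_ge0 ?ndens_ge0 ?(le_trans x0).
- by apply: continuous_subspaceT; exact: continuous_id_ndens.
- by rewrite -oppr0; apply: cvgN; exact: ndens_cvgy.
- by move=> t _; case: (d t).
- by apply: cvgN; apply: cvg_at_right_filter; exact: continuous_ndens.
- move=> t _; by rewrite derive1E; have [_ ->] := d t.
Qed.

Lemma integral_id_ndens_le x : x <= 0 ->
  (\int[mu]_(t in `]-oo, x]) (- (t * ndens t))%:E = (ndens x)%:E)%E.
Proof.
move=> x0; rewrite -ndens_even -integral_id_ndens_ge ?oppr_ge0//.
rewrite -{1}(opprK x) (@ge0_integration_by_substitutionNy _ (fun t => - (t * ndens t))).
- by apply: eq_integral => t _ /=; rewrite ndens_even mulNr opprK.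
- by apply: continuous_subspaceT => t; apply: cvgN; exact: continuous_id_ndens.
- move=> t; rewrite in_itv/= opprK => tx.
  by rewrite -mulNr mulr_ge0 ?ndens_ge0// oppr_ge0 (le_trans (ltW tx)).
Qed.

Lemma integrable_id_ndens : mu.-integrable setT (EFin \o (fun t : R => t * ndens t)).
Proof.
have mf : measurable_fun setT (fun t : R => t * ndens t).
  by apply: continuous_measurable_fun; exact: continuous_id_ndens.
apply/integrableP; split; first exact/measurable_EFinP.
have := @ge0_symfun_integralT R (fun t => `|t * ndens t|).
rewrite /= => ->.
- rewrite (_ : [set x : R | 0 <= x] = `[0, +oo[%classic); last first.
    by apply/seteqP; split => t /=; rewrite in_itv/= andbT.
  under eq_integral => t.
    rewrite inE/= in_itv/= andbT => t0.
    rewrite ger0_norm ?mulr_ge0 ?ndens_ge0//.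
    over.
  by rewrite integral_id_ndens_ge// -EFinM ltry.
- by [].
- by move=> t; apply: cvg_norm; exact: continuous_id_ndens.
- by move=> t /=; rewrite ndens_even mulNr normrN.
Qed.

Lemma is_derive_integralNy (f : R -> R) x :
  mu.-integrable setT (EFin \o f) -> continuous f ->
  is_derive x 1 (fun y => \int[mu]_(t in `]-oo, y]) f t) (f x).
Proof.
move=> fi cf.
have [|//|//||d e] := @continuous_FTC1 R f -oo%O x (x + 1).
- by rewrite ltrDl.
- by apply: integrableS fi.
- exact: ltNyr.
- exact: cf.
by apply: DeriveDef; [exact: d|rewrite -derive1E; exact: e].
Qed.

Lemma RintegralNyD (f : R -> R) x : mu.-integrable setT (EFin \o f) ->
  \int[mu]_t f t = \int[mu]_(t in `]-oo, x]) f t + \int[mu]_(t in `]x, +oo[) f t.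
Proof.
move=> fi; have E : [set: R] = `]-oo, x] `|` `]x, +oo[.
  by rewrite -(setUv `]-oo, x]) setCitvl.
rewrite E Rintegral_setU//; first by rewrite -E.
apply/disj_setPS => t [] /=; rewrite !in_itv/= andbT => tx xt.
by have := lt_le_trans xt tx; rewrite ltxx.
Qed.

(** Both sides have the same derivative, so they need to be compared at 0 only; there the integrand
    keeps one sign on the half-line and the improper fundamental theorem applies. *)
Lemma RintegralNy_id_ndens x : \int[mu]_(t in `]-oo, x]) (t * ndens t) = - ndens x.
Proof.
pose k y := \int[mu]_(t in `]-oo, y]) (t * ndens t) + ndens y.
have k' y : is_derive y 1 k 0.
  have h := is_derive_integralNy y integrable_id_ndens continuous_id_ndens.
  by rewrite /k; apply: is_derive_eq; rewrite subrr.
have k0 : k 0 = 0.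
  have : \int[mu]_(t in `]-oo, 0]) (- 1 * (t * ndens t)) = ndens 0.
    under eq_Rintegral do rewrite mulN1r.
    by rewrite /Rintegral integral_id_ndens_le.
  rewrite RintegralZl//; last by apply: integrableS integrable_id_ndens.
  by rewrite mulN1r /k => <-; rewrite subrr.
suff : k x = 0 by move/eqP; rewrite addr_eq0 => /eqP.
rewrite -k0; have [x0|x0|->//] := ltgtP x 0.
- by have [c _] := is_derive_MVT k' x0; rewrite mul0r => /eqP; rewrite subr_eq0 => /eqP.
- by have [c _] := is_derive_MVT k' x0; rewrite mul0r => /eqP; rewrite subr_eq0 => /eqP.
Qed.

Lemma Rintegral_id_ndens : \int[mu]_t (t * ndens t) = 0.
Proof.
rewrite (RintegralNyD 0 integrable_id_ndens) RintegralNy_id_ndens.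
rewrite Rintegral_itv_obnd_cbnd; last exact: integrableS integrable_id_ndens.
by rewrite /Rintegral integral_id_ndens_ge//= addNr.
Qed.

Definition ncdf x : R := \int[mu]_(t in `]-oo, x]) ndens t.

Global Instance is_derive_ncdf x : is_derive x 1 ncdf (ndens x).
Proof. exact: is_derive_integralNy integrable_ndens continuous_ndens. Qed.

Lemma Rintegral_gt_ndens x : \int[mu]_(t in `]x, +oo[) ndens t = 1 - ncdf x.
Proof. by rewrite -Rintegral_ndens (RintegralNyD x integrable_ndens) addrAC subrr add0r. Qed.

Lemma Rintegral_gt_id_ndens x : \int[mu]_(t in `]x, +oo[) (t * ndens t) = ndens x.
Proof.
have := RintegralNyD x integrable_id_ndens.
rewrite Rintegral_id_ndens RintegralNy_id_ndens => /esym/eqP.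
by rewrite addrC subr_eq0 => /eqP.
Qed.

Lemma ncdf_ge0 x : 0 <= ncdf x.
Proof. by apply: Rintegral_ge0 => t _; exact: ndens_ge0. Qed.

Lemma ncdf_le1 x : 0 <= 1 - ncdf x.
Proof.
by rewrite -Rintegral_gt_ndens; apply: Rintegral_ge0 => t _; exact: ndens_ge0.
Qed.

(* The truncated first moments [E (Y - x)^+] and [E (x - Y)^+]. *)
Definition nexc x : R := ndens x - x * (1 - ncdf x).
Definition ndef x : R := ndens x + x * ncdf x.

Lemma ncdfN x : ncdf (- x) = 1 - ncdf x.
Proof.
have n0 : ncdf 0 = 2^-1.
  have /= := @ge0_symfun_integralT R ndens ndens_ge0 continuous_ndens.
  move=> /(_ (fun y => esym (ndens_even y))).
  rewrite (_ : [set x : R | 0 <= x] = `[0, +oo[%classic); last first.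
    by apply/seteqP; split => t /=; rewrite in_itv/= andbT.
  move/(congr1 fine).
  rewrite -[LHS]/(Rintegral mu setT ndens) Rintegral_ndens fineM//; last first.
    apply: integrable_fin_num => //; exact: integrableS integrable_ndens.
  rewrite -[fine (integral _ _ _)]/(Rintegral mu `[0, +oo[%classic ndens).
  rewrite -Rintegral_itv_obnd_cbnd; last exact: integrableS integrable_ndens.
  by rewrite Rintegral_gt_ndens /=; lra.
pose k y := ncdf y + ncdf (- y).
have k' (y : R) : is_derive y 1 k 0.
  have h : is_derive y 1 (fun z => ncdf (- z)) (- ndens y).
    have o : is_derive y 1 (-%R : R -> R) (- 1).
      by have := @is_deriveN _ _ _ id y 1 1 (is_derive_id _ _).
    by rewrite -mulrN1 -(ndens_even y); exact: (@is_derive1_comp _ ncdf -%R).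
  by rewrite /k; apply: is_derive_eq; rewrite subrr.
have k0 : k 0 = 1 by rewrite /k oppr0 n0; lra.
suff : k x = 1 by rewrite /k; lra.
rewrite -k0; have [x0|x0|->//] := ltgtP x 0.
- by have [c _] := is_derive_MVT k' x0; rewrite mul0r => /eqP; rewrite subr_eq0 => /eqP.
- by have [c _] := is_derive_MVT k' x0; rewrite mul0r => /eqP; rewrite subr_eq0 => /eqP.
Qed.

Lemma integrable_shift_ndens (k : R) : mu.-integrable setT (EFin \o (fun t => (t - k) * ndens t)).
Proof.
rewrite (_ : _ \o _ = (fun t => (t * ndens t)%:E - (k * ndens t)%:E)%E); last first.
  by apply/funext => t /=; rewrite mulrBl.
apply: integrableB => //; first exact: integrable_id_ndens.
have := @integrableZl _ _ _ mu setT measurableT k _ integrable_ndens.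
by apply: eq_integrable => // t _; rewrite EFinM.
Qed.

Lemma nexcE x : nexc x = \int[mu]_(t in `]x, +oo[) ((t - x) * ndens t).
Proof.
under eq_Rintegral do rewrite mulrBl.
rewrite RintegralB//; last 2 first.
- exact: integrableS integrable_id_ndens.
- have := @integrableZl _ _ _ mu setT measurableT x _ integrable_ndens.
  by move=> h; apply: integrableS (h).
rewrite RintegralZl//; last exact: integrableS integrable_ndens.
by rewrite Rintegral_gt_id_ndens Rintegral_gt_ndens.
Qed.

Lemma nexc_ge0 x : 0 <= nexc x.
Proof.
rewrite nexcE; apply: Rintegral_ge0 => t /=; rewrite in_itv/= andbT => xt.
by rewrite mulr_ge0 ?ndens_ge0// subr_ge0 ltW.
Qed.

Lemma nexcN x : nexc (- x) = ndef x.
Proof. by rewrite /nexc /ndef ndens_even ncdfN; ring. Qed.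

Lemma ndef_ge0 x : 0 <= ndef x.
Proof. by rewrite -nexcN nexc_ge0. Qed.

Lemma ndefE x : ndef x = \int[mu]_(t in `]-oo, x]) ((x - t) * ndens t).
Proof.
under eq_Rintegral do rewrite mulrBl.
rewrite RintegralB//; last 2 first.
- have := @integrableZl _ _ _ mu setT measurableT x _ integrable_ndens.
  by move=> h; apply: integrableS (h).
- exact: integrableS integrable_id_ndens.
rewrite RintegralZl//; last exact: integrableS integrable_ndens.
by rewrite RintegralNy_id_ndens opprK addrC.
Qed.

Global Instance is_derive_nexc x : is_derive x 1 nexc (- (1 - ncdf x)).
Proof.
rewrite /nexc; apply: is_derive_eq; rewrite /GRing.scale/=; ring.
Qed.

Global Instance is_derive_ndef x : is_derive x 1 ndef (ncdf x).
Proof. rewrite /ndef; apply: is_derive_eq; rewrite /GRing.scale/=; ring. Qed.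

(* Half of the second moment of [(Y - x)^+] is nonincreasing and nonnegative. *)
Lemma mills_ge x : 0 <= (1 + x ^+ 2) * (1 - ncdf x) - x * ndens x.
Proof.
pose m y := (1 + y ^+ 2) * (1 - ncdf y) - y * ndens y.
rewrite -/(m x).
have m' (y : R) : is_derive y 1 (fun z => - m z) (2 * nexc y).
  rewrite /m; apply: is_derive_eq; rewrite /GRing.scale/= /nexc; ring.
have mdec y : x <= y -> m y <= m x.
  move=> xy; rewrite -lerN2; apply: (ge0_is_derive_le m') => // z _.
  by rewrite mulr_ge0 ?nexc_ge0.
rewrite leNgt; apply/negP => mx0.
(* This [y] exceeds both [x] and 2 [ndens 0] / (- m x). Since y^2 [ndens y] is at most 2 [ndens 0],
   the lower bound [- (y * ndens y)] of [m y] lies above [m x], against monotonicity. *)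
pose y := 1 + `|x| + 2 * ndens 0 / (- m x).
have y0 : 0 < y.
  by rewrite /y ltr_pwDl ?ltr_pwDl// divr_ge0 ?mulr_ge0 ?ndens_ge0// oppr_ge0 ltW.
have xy : x <= y.
  apply: (le_trans (ler_norm x)).
  rewrite /y -addrA addrCA lerDl addr_ge0// divr_ge0 ?mulr_ge0 ?ndens_ge0//.
  by rewrite oppr_ge0 ltW.
have := mdec _ xy; apply/negP; rewrite -ltNge.
apply: (@lt_le_trans _ _ (- (y * ndens y))); last first.
  by rewrite /m lerBrDr addNr mulr_ge0 ?ncdf_le1// addr_ge0 ?sqr_ge0.
rewrite ltrNr.
have yE : y * ndens y * y <= 2 * ndens 0.
  rewrite ndensE expRN.
  have e1 : y ^+ 2 / 2 <= expR (y ^+ 2 / 2).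
    by apply: le_trans (expR_ge1Dx _); rewrite lerDr.
  rewrite mulrAC mulrACA -mulrA (mulrC (ndens 0)) mulrA ler_wpM2r ?ndens_ge0//.
  by rewrite mulrA ler_pdivrMr ?expR_gt0//; move: e1; rewrite expr2; lra.
rewrite -(ltr_pM2r y0); apply: (le_lt_trans yE).
rewrite [ltRHS]mulrC -ltr_pdivrMr ?oppr_gt0//.
by have := normr_ge0 x; rewrite /y; lra.
Qed.

Lemma mills_le x : 0 <= (1 + x ^+ 2) * ncdf x + x * ndens x.
Proof.
have := mills_ge (- x); rewrite ncdfN ndens_even sqrrN.
by rewrite (_ : 1 - (1 - ncdf x) = ncdf x) ?mulNr ?opprK//; ring.
Qed.

Global Instance is_derive_ndensV x : is_derive x 1 (fun y => (ndens y)^-1) (x / ndens x).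
Proof.
have n0 : ndens x != 0 by rewrite gt_eqF ?ndens_gt0.
have [d e] := is_deriveV n0 (is_derive_ndens x).
by apply: DeriveDef => //; rewrite e /GRing.scale/=; field.
Qed.

(** * The product of the two truncated first moments *)

Section first_moment_product.

(** [q] and [q1] are the first and second derivatives of the quotient [p] below, whose maximum is
    wanted. *)
Let q x : R :=
  (ncdf x * nexc x - (1 - ncdf x) * ndef x + x * (nexc x * ndef x)) / ndens x.
Let q1 x : R :=
  (ndens x * (nexc x + ndef x) - 2 * (ncdf x * (1 - ncdf x))
   + 2 * x * (ncdf x * nexc x - (1 - ncdf x) * ndef x)
   + (1 + x ^+ 2) * (nexc x * ndef x)) / ndens x.
Let p x : R := nexc x * ndef x / ndens x.

Let p' x : is_derive x 1 p (q x).
Proof.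
have n0 : ndens x != 0 by rewrite gt_eqF ?ndens_gt0.
rewrite /p; apply: is_derive_eq; rewrite /q /GRing.scale/=.
by field.
Qed.

Let q' x : is_derive x 1 q (q1 x).
Proof.
have n0 : ndens x != 0 by rewrite gt_eqF ?ndens_gt0.
rewrite /q; apply: is_derive_eq; rewrite /q1 /GRing.scale/=.
by field.
Qed.

(* [p] is, up to a factor, the product of two solutions of [y'' = (x^2/4 + 3/2) y]. *)
Let q1' x : is_derive x 1 q1 ((x ^+ 2 + 6) * q x + x * p x).
Proof.
have n0 : ndens x != 0 by rewrite gt_eqF ?ndens_gt0.
rewrite /q1; apply: is_derive_eq; rewrite /q /p /GRing.scale/= /nexc /ndef.
by field.
Qed.

(** Any bound on the half-line would do, as it only has to contradict linear growth. The
    second-moment inequality [mills_ge] gives [nexc x] <= [ndens x] / (1 + x^2), while [ndef x] is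
    [nexc x + x]. *)
Let p_le x : 0 <= x -> p x <= ndens 0 + 1.
Proof.
move=> x0; rewrite /p.
have m0 := mills_ge x; have n0 := ndens_gt0 x; have u0 := nexc_ge0 x.
have nx : ndens x <= ndens 0.
  by rewrite ndensE ler_piMr ?ndens_ge0// -[leRHS]expR0 ler_expR oppr_le0 divr_ge0 ?sqr_ge0.
have vE : ndef x = nexc x + x by rewrite /ndef /nexc; ring.
have ub : nexc x * (1 + x ^+ 2) <= ndens x.
  have -> : nexc x * (1 + x ^+ 2) = ndens x - x * ((1 + x ^+ 2) * (1 - ncdf x) - x * ndens x).
    by rewrite /nexc; ring.
  by rewrite lerBlDr lerDl mulr_ge0.
have un : nexc x <= ndens x.
  by apply: le_trans ub; rewrite ler_peMr// lerDl sqr_ge0.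
rewrite ler_pdivrMr// vE mulrDr [leRHS]mulrDl mul1r lerD//.
  by rewrite ler_pM// (le_trans un).
apply: le_trans ub; rewrite ler_wpM2l//.
by have := sqr_ge0 (x - 2^-1); rewrite sqrrB expr2; lra.
Qed.

Let q0 : q 0 = 0.
Proof.
by have := ncdfN 0; rewrite oppr0 /q /nexc /ndef => h; rewrite -h !mul0r !addr0 subr0 subrr mul0r.
Qed.

(** A positive value of [q] at [x] would persist to the right of [x], so that [p] would grow at
    least linearly, against [p_le]. *)
Let q_le0 x : 0 <= x -> q x <= 0.
Proof.
rewrite le_eqVlt => /predU1P[<-|w0]; first by rewrite q0.
rewrite leNgt; apply/negP => qw.
(* A positive interior maximum of [q] would be a strict local minimum, since [q'' > 0] there. *)
have mono b : x < b -> q x <= q b.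
  move=> xb.
  have cq : {within `[0, b], continuous q}.
    by apply: continuous_subspaceT; exact: is_derive_continuous q'.
  have [c cb qc] := EVT_max (ltW (lt_trans w0 xb)) cq.
  have xc : q x <= q c by apply: qc; rewrite in_itv/= !ltW.
  have qc0 : 0 < q c by exact: lt_le_trans xc.
  have [/andP[c0 cb']] : 0 <= c <= b /\ True by move: cb; rewrite in_itv.
  have {c0}c0 : 0 < c.
    rewrite lt_neqAle c0 andbT; apply/eqP => c0'.
    by move: qc0; rewrite -c0' q0 ltxx.
  move: cb'; rewrite le_eqVlt => /predU1P[<-//|cb'].
  exfalso.
  have d1 : q1 c = 0.
    have h : is_derive c 1 q 0.
      apply: (@derive1_at_max R q 0 b c); first exact: ltW (lt_trans w0 xb).
      - by move=> t _; case: (q' t).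
      - by rewrite in_itv/= c0.
      - by move=> t; rewrite in_itv/= => /andP[t0 tb]; apply: qc; rewrite in_itv/= !ltW.
    by have [_ <-] := h; have [_ ->] := q' c.
  pose r y := (y ^+ 2 + 6) * q y + y * p y.
  have cr : continuous r.
    move=> y; apply: cvgD; apply: cvgM; rewrite -/p -/q.
    + apply: cvgD; last exact: cvg_cst.
      exact: sqr_continuous.
    + exact: is_derive_continuous q' y.
    + exact: cvg_id.
    + exact: is_derive_continuous p' y.
  have p0 y : 0 <= p y by rewrite /p divr_ge0 ?mulr_ge0 ?nexc_ge0 ?ndef_ge0 ?ndens_ge0.
  have rc : 0 < r c.
    have rc1 : 0 < (c ^+ 2 + 6) * q c by rewrite mulr_gt0// ltr_wpDl ?sqr_ge0.
    by apply: ltr_pwDl => //; rewrite mulr_ge0 ?p0// ltW.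
  have [e /= e0 re] : \forall y \near c, 0 < r y by exact: (cvgr_gt _ (cr c)).
  (* [d] stays inside [0, b] and inside the neighbourhood of [c] where the second derivative [r] of
     [q] is positive. As [q1] vanishes at [c], [q] increases strictly from [c] to [d], which
     contradicts the maximality of [q c]. *)
  pose d := Num.min (c + e / 2) b.
  have cd : c < d by rewrite /d lt_min cb' ltrDl divr_gt0.
  have rpos y : c <= y -> y <= d -> 0 < r y.
    move=> cy yd; apply: re => /=; rewrite distrC ger0_norm ?subr_ge0//.
    have : d <= c + e / 2 by rewrite /d ge_min lexx.
    lra.
  have q1pos y : c < y -> y <= d -> 0 < q1 y.
    move=> cy yd; have [z /andP[cz zy]] := is_derive_MVT q1' cy.
    rewrite d1 subr0 => ->; rewrite mulr_gt0 ?subr_gt0//.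
    by apply: rpos; rewrite ?(ltW cz)// (le_trans (ltW zy)).
  have [z /andP[cz zd] E] := is_derive_MVT q' cd.
  have : q d <= q c.
    by apply: qc; rewrite in_itv/= (ltW (lt_trans c0 cd)) /d ge_min lexx orbT.
  by rewrite -subr_le0 E leNgt mulr_gt0 ?subr_gt0// q1pos// ltW.
(* With slope at least [q x] on the way, [p] gains [ndens 0 + 2] between [x] and [b], one more than
   [p_le] allows. *)
pose b := x + (ndens 0 + 2) / q x.
have xb : x < b by rewrite ltrDl divr_gt0// addr_gt0 ?ndens_gt0.
have [z /andP[xz zb] E] := is_derive_MVT p' xb.
have := p_le (ltW (lt_trans w0 xb)); apply/negP; rewrite -ltNge.
have px : 0 <= p x by rewrite /p divr_ge0 ?mulr_ge0 ?nexc_ge0 ?ndef_ge0 ?ndens_ge0.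
have : q x * (b - x) <= q z * (b - x) by rewrite ler_wpM2r ?mono// subr_ge0 ltW.
rewrite -E /b addrAC subrr add0r mulrC divfK ?gt_eqF//; lra.
Qed.

(** This is the source of sqrt(2/pi). The reflection [x -> - x] exchanges the two factors, and for
    [x >= 0] the quotient by the density is nonincreasing with value [ndens 0] at the origin. *)
Lemma nexc_ndef_le x : nexc x * ndef x <= ndens 0 * ndens x.
Proof.
wlog x0 : x / 0 <= x.
  move=> H; have [|x0] := leP 0 x; first exact: H.
  have := H (- x); rewrite oppr_ge0 => /(_ (ltW x0)).
  by rewrite nexcN -(nexcN (- x)) opprK ndens_even mulrC.
have -> : nexc x * ndef x = p x * ndens x.
  by rewrite /p divfK// gt_eqF ?ndens_gt0.
rewrite ler_wpM2r ?ndens_ge0//.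
have -> : ndens 0 = p 0.
  rewrite /p /nexc /ndef !mul0r subr0 addr0 mulfK//.
  by rewrite gt_eqF ?ndens_gt0.
rewrite -lerN2; apply: (@ge0_is_derive_le (fun y => - p y) (fun y => - q y)) => //.
  by move=> y; exact: is_deriveN (p' y).
by move=> y /andP[y0 _]; rewrite oppr_ge0 q_le0.
Qed.

End first_moment_product.

(** The Radon-Nikodym derivative of the normal law is an abstract choice; it agrees almost
    everywhere with [ndens] because both have the same integrals over measurable sets. The change of
    variables is applied to nonnegative integrands, hence the separate treatment of positive and
    negative parts. *)
Lemma integral_normal_prob (f : R -> R) : measurable_fun setT f ->
  mu.-integrable setT (EFin \o (fun t => f t * ndens t)) ->
  (\int[normal_prob 0 1]_y (f y)%:E)%E = (\int[mu]_t (f t * ndens t))%:E.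
Proof.
move=> mf fi.
have dom := @normal_prob_dominates R 0 1.
pose g := Radon_Nikodym_SigmaFinite.f (normal_prob 0 1) mu.
have mn : measurable_fun setT (EFin \o ndens).
  by apply/measurable_EFinP; exact: measurable_normal_pdf.
have gE : ae_eq mu setT g (EFin \o ndens).
  apply: integral_ae_eq => //=.
  - exact: Radon_Nikodym_SigmaFinite.f_integrable.
  - by move=> B _ mB; rewrite -Radon_Nikodym_SigmaFinite.f_integral.
have mg : measurable_fun setT g.
  by apply: (measurable_int mu); exact: Radon_Nikodym_SigmaFinite.f_integrable.
have ge0E (k : R -> \bar R) : (forall x, 0 <= k x)%E -> measurable_fun setT k ->
    (\int[normal_prob 0 1]_y k y = \int[mu]_t (k t * (ndens t)%:E))%E.
  move=> k0 mk; rewrite -(Radon_Nikodym_SigmaFinite.change_of_variables dom k0 measurableT mk).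
  apply: ae_eq_integral => //.
  - exact: emeasurable_funM.
  - exact: emeasurable_funM.
  - exact: ae_eqe_mul2l.
rewrite /Rintegral fineK; last exact: integrable_fin_num.
rewrite [LHS]integralE [RHS]integralE; congr (_ - _)%E.
- rewrite ge0E//; last first.
    by apply: measurable_funepos; exact/measurable_EFinP.
  apply: eq_integral => t _; rewrite !funeposE -EFin_max -EFinM -EFin_max.
  by rewrite maxr_pMl ?ndens_ge0// mul0r.
- rewrite ge0E//; last first.
    by apply: measurable_funeneg; exact/measurable_EFinP.
  apply: eq_integral => t _; rewrite !funenegE -EFin_max -EFinM -EFin_max.
  by rewrite maxr_pMl ?ndens_ge0// mul0r mulNr.
Qed.

(** * The Stein solution for a Lipschitz test function *)

Section solution.
Variable h : R -> R.
Hypothesis hL : forall x y, `|h x - h y| <= `|x - y|.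

Let hD : continuous h.
Proof.
move=> x; apply/cvgrPdist_le => e e0; apply/nbhs_normP; exists e => //= y /ltW.
exact: le_trans.
Qed.

Lemma lipschitz_continuous : continuous h. Proof. exact: hD. Qed.

Lemma lipschitz_integrable_ndens : mu.-integrable setT (EFin \o (fun t => h t * ndens t)).
Proof.
apply: (@le_integrable _ _ _ mu setT measurableT _
  (fun t => (`|h 0| * ndens t)%:E + `| (t * ndens t)%:E |)%E).
- apply/measurable_EFinP/measurable_funM; last exact: measurable_normal_pdf.
  exact: continuous_measurable_fun.
- move=> t _ /=; rewrite lee_fin normrM [leRHS]ger0_norm; last first.
    by rewrite addr_ge0// mulr_ge0// ndens_ge0.
  rewrite normrM (ger0_norm (ndens_ge0 t)) -mulrDl ler_wpM2r ?ndens_ge0//.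
  rewrite -[h t](subrK (h 0)) (le_trans (ler_normD _ _))// addrC lerD2l.
  by rewrite (le_trans (hL _ _))// subr0.
- apply: integrableD => //.
    exact: (@integrableZl _ _ _ mu setT measurableT `|h 0| _ integrable_ndens).
  exact: integrable_abse integrable_id_ndens.
Qed.

Let c := \int[mu]_t (h t * ndens t).
Let I x := \int[mu]_(t in `]-oo, x]) (h t * ndens t).
Let f x := (I x - c * ncdf x) / ndens x.
Let f' x := h x - c + x * f x.

(** [A x] and [B x] are the integrals of h(t) - h(x) against the density to the left and to the
    right of [x]. The Lipschitz condition enters only through |A x| <= [ndef x] and |B x| <=
    [nexc x]; the bounds on the solution then become relations between truncated moments. *)
Let A x := I x - h x * ncdf x.
Let B x := c - I x - h x * (1 - ncdf x).

Let I' x : is_derive x 1 I (h x * ndens x).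
Proof.
apply: (is_derive_integralNy x lipschitz_integrable_ndens) => y.
by apply: cvgM; [exact: hD|exact: continuous_ndens].
Qed.

Let hi D : measurable D -> mu.-integrable D (EFin \o (fun t => h t * ndens t)).
Proof. by move=> mD; apply: integrableS lipschitz_integrable_ndens. Qed.

Let ki (k : R) D : measurable D -> mu.-integrable D (EFin \o (fun t => k * ndens t)).
Proof.
move=> mD; apply: (@integrableS _ _ _ _ setT) => //.
exact: (@integrableZl _ _ _ mu setT measurableT k _ integrable_ndens).
Qed.

Let bound D (w : R -> R) x : measurable D ->
  mu.-integrable D (EFin \o (fun t => w t * ndens t)) ->
  (forall t, D t -> `|t - x| <= w t) ->
  `|\int[mu]_(t in D) (h t * ndens t) - \int[mu]_(t in D) (h x * ndens t)|
    <= \int[mu]_(t in D) (w t * ndens t).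
Proof.
move=> mD iw wle; rewrite -RintegralB//; [|exact: hi|exact: ki].
have i : mu.-integrable D (EFin \o (fun t => h t * ndens t - h x * ndens t)).
  rewrite (_ : _ \o _ = (fun t => (h t * ndens t)%:E - (h x * ndens t)%:E)%E)//.
  by apply: integrableB => //; [exact: hi|exact: ki].
apply: (le_trans (le_normr_Rintegral mD i)).
apply: le_Rintegral => //; first exact: integrable_abse i.
move=> t Dt; rewrite -mulrBl normrM (ger0_norm (ndens_ge0 t)).
by rewrite ler_wpM2r ?ndens_ge0// (le_trans (hL _ _))// wle.
Qed.

Let A_le x : `|A x| <= ndef x.
Proof.
have := @bound `]-oo, x]%classic (fun t => x - t) x.
rewrite RintegralZl//; last exact: integrableS integrable_ndens.
rewrite -/(I x) -/(ncdf x) -/(A x) -ndefE; apply => //.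
- apply: (@integrableS _ _ _ _ setT) => //.
  have := integrableN (integrable_shift_ndens x).
  by apply: eq_integrable => // t _ /=; rewrite -mulNr opprB.
- by move=> t /=; rewrite in_itv/= => tx; rewrite distrC ger0_norm ?subr_ge0.
Qed.

Let B_le x : `|B x| <= nexc x.
Proof.
have := @bound `]x, +oo[%classic (fun t => t - x) x.
rewrite RintegralZl//; last exact: integrableS integrable_ndens.
rewrite Rintegral_gt_ndens -nexcE.
have -> : \int[mu]_(t in `]x, +oo[) (h t * ndens t) = c - I x.
  by rewrite /c (RintegralNyD x lipschitz_integrable_ndens) -/(I x) addrAC subrr add0r.
apply => //.
- apply: (@integrableS _ _ _ _ setT) => //; exact: integrable_shift_ndens.
- by move=> t /=; rewrite in_itv/= andbT => tx; rewrite ger0_norm ?subr_ge0// ltW.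
Qed.

Let cE x : c = A x + B x + h x.
Proof. by rewrite /A /B; ring. Qed.

Let fE x : f x = (A x * (1 - ncdf x) - B x * ncdf x) / ndens x.
Proof. by congr (_ / _); rewrite /A /B; ring. Qed.

Let f'E x : f' x = - (A x * nexc x + B x * ndef x) / ndens x.
Proof.
have n0 : ndens x != 0 by rewrite gt_eqF ?ndens_gt0.
rewrite /f' fE {1}(cE x) /nexc /ndef; field; exact: n0.
Qed.

Let f_deriv x : is_derive x 1 f (f' x).
Proof.
have n0 : ndens x != 0 by rewrite gt_eqF ?ndens_gt0.
have dI := I' x.
rewrite /f; apply: is_derive_eq; rewrite /f' /f /GRing.scale/=; field; exact: n0.
Qed.

Let div_le (a b k : R) (x : R) : `|a| <= k * ndens x -> `|a / ndens x| <= k.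
Proof. by rewrite normrM normfV (ger0_norm (ndens_ge0 x)) ler_pdivrMr ?ndens_gt0. Qed.

Let comb_le x (a b : R) : 0 <= a -> 0 <= b ->
  `|A x * a - B x * b| <= ndef x * a + nexc x * b.
Proof.
move=> a0 b0; rewrite (le_trans (ler_normB _ _))// !normrM (ger0_norm a0) (ger0_norm b0).
by rewrite lerD// ler_wpM2r.
Qed.

(** After the triangle inequality the numerator [ndef x * (1 - ncdf x) + nexc x * ncdf x] is exactly
    the density. *)
Let f_le x : `|f x| <= 1.
Proof.
rewrite fE; apply: (@div_le _ 0); rewrite (le_trans (comb_le _ _ _)) ?ncdf_le1 ?ncdf_ge0//.
by rewrite /ndef /nexc le_eqVlt; apply/orP; left; apply/eqP; ring.
Qed.

(** Bounding [A] and [B] leaves 2 [nexc x] [ndef x] / [ndens x], which is at most 2 [ndens 0] =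
    sqrt(2/pi). *)
Let f'_le x : `|f' x| <= Num.sqrt (2 / pi).
Proof.
rewrite f'E; apply: (@div_le _ 0); rewrite normrN.
apply: (@le_trans _ _ (2 * (nexc x * ndef x))).
  rewrite (le_trans (ler_normD _ _))// !normrM.
  rewrite (ger0_norm (nexc_ge0 x)) (ger0_norm (ndef_ge0 x)).
  rewrite mulr_natl mulr2n lerD//.
    by rewrite mulrC ler_wpM2l ?nexc_ge0.
  by rewrite ler_wpM2r ?ndef_ge0.
apply: (@le_trans _ _ (2 * (ndens 0 * ndens x))).
  by rewrite ler_wpM2l// nexc_ndef_le.
rewrite mulrA ler_wpM2r ?ndens_ge0// ndens0E.
have pi0 : (pi : R) != 0 by rewrite gt_eqF ?pi_gt0.
rewrite (_ : 2 / pi = 2 ^+ 2 * (2 * pi)^-1); last first.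
  by move: (pi : R) pi0 => r r0; field; exact: r0.
rewrite [leRHS]sqrtrM ?sqr_ge0// sqrtr_sqr ger0_norm// sqrtrV//.
by rewrite mulr_ge0 ?pi_ge0.
Qed.

(** The derivative f + z f' is again a combination of [A z] and [B z], now weighted by the truncated
    second moments, which are nonnegative by [mills_ge] and [mills_le]; the triangle bound once more
    sums to the density. Hence f' = h - c + x f is 2-Lipschitz although [h] need not be
    differentiable. *)
Let xf_lip x y : `|y * f y - x * f x| <= `|y - x|.
Proof.
have d (z : R) : is_derive z 1 (fun z => z * f z) (f z + z * f' z).
  by have df := f_deriv z; apply: is_derive_eq; rewrite /GRing.scale/=; ring.
have b z : `|f z + z * f' z| <= 1.
  have n0 : ndens z != 0 by rewrite gt_eqF ?ndens_gt0.
  rewrite f'E fE.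
  rewrite (_ : _ + _ = (A z * ((1 + z ^+ 2) * (1 - ncdf z) - z * ndens z) -
    B z * ((1 + z ^+ 2) * ncdf z + z * ndens z)) / ndens z); last first.
    rewrite /nexc /ndef; field; exact: n0.
  apply: (@div_le _ 0); rewrite (le_trans (comb_le _ _ _)) ?mills_ge ?mills_le//.
  by rewrite /ndef /nexc le_eqVlt; apply/orP; left; apply/eqP; ring.
wlog xy : x y / x < y.
  move=> H; have [xy|yx|->] := ltgtP x y; first exact: H.
    by rewrite distrC [leRHS]distrC H.
  by rewrite !subrr normr0.
have [z _ ->] := is_derive_MVT d xy.
by rewrite normrM ler_piMl.
Qed.

(** The quadratic plus or minus the Taylor remainder is monotone on each side of [x]: its derivative
    is 2(z - x) plus or minus f'(z) - f'(x), and f' is 2-Lipschitz. The sign is carried by the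
    parameter [e] of modulus 1. *)
Let f_taylor x y : `|f y - f x - f' x * (y - x)| <= (y - x) ^+ 2.
Proof.
have f'L u v : `|f' v - f' u| <= 2 * `|v - u|.
  rewrite /f' (_ : _ - _ = (h v - h u) + (v * f v - u * f u)); last by ring.
  rewrite (le_trans (ler_normD _ _))// mulr_natl mulr2n lerD//.
have [xy|yx|->] := ltgtP x y; last by rewrite !subrr mulr0 subr0 normr0 expr0n.
- have d (e z : R) : is_derive z 1 (fun z => (z - x) ^+ 2 + e * (f z - f x - f' x * (z - x)))
      (2 * (z - x) + e * (f' z - f' x)).
    by have df := f_deriv z; apply: is_derive_eq; rewrite /GRing.scale/=; ring.
  have g e : `|e| = 1 -> 0 <= (y - x) ^+ 2 + e * (f y - f x - f' x * (y - x)).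
    move=> e1; have := @ge0_is_derive_le _ _ x y (d e).
    rewrite !subrr expr0n/= mulr0 subr0 mulr0 addr0; apply; last exact: ltW.
    move=> z /andP[xz _]; have := f'L x z.
    rewrite (ger0_norm (_ : 0 <= z - x)) ?subr_ge0// => k.
    have := ler_norm (- (e * (f' z - f' x))); rewrite normrN normrM e1 mul1r; lra.
  have := g 1 (normr1 _); have := g (- 1) (etrans (normrN _) (normr1 _)).
  by rewrite ler_norml mul1r mulN1r => ? ?; apply/andP; split; lra.
- have d (e z : R) : is_derive z 1 (fun z => - ((z - x) ^+ 2 + e * (f z - f x - f' x * (z - x))))
      (- (2 * (z - x) + e * (f' z - f' x))).
    by have df := f_deriv z; apply: is_derive_eq; rewrite /GRing.scale/=; ring.
  have g e : `|e| = 1 -> 0 <= (y - x) ^+ 2 + e * (f y - f x - f' x * (y - x)).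
    move=> e1; rewrite -oppr_le0.
    have := @ge0_is_derive_le _ _ y x (d e).
    rewrite !subrr expr0n/= mulr0 subr0 mulr0 addr0 oppr0; apply; last exact: ltW.
    move=> z /andP[_ zx]; have := f'L x z.
    rewrite (ler0_norm (_ : z - x <= 0)) ?subr_le0// mulrN => k.
    have := ler_norm (e * (f' z - f' x)); rewrite normrM e1 mul1r; lra.
  have := g 1 (normr1 _); have := g (- 1) (etrans (normrN _) (normr1 _)).
  by rewrite ler_norml mul1r mulN1r => ? ?; apply/andP; split; lra.
Qed.

Lemma stein_solution : exists g g' : R -> R,
  [/\ forall x, is_derive x 1 g (g' x),
      forall x, g' x - x * g x = h x - c,
      (forall x, `|g x| <= 1) /\ (forall x, `|g' x| <= Num.sqrt (2 / pi)) &
      forall x y, `|g y - g x - g' x * (y - x)| <= (y - x) ^+ 2].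
Proof.
exists f, f'; split => //; first by move=> x; rewrite /f' addrK.
Qed.

End solution.

End stein_equation.

(** * Commuting orthogonal projections *)

Section inner_product.
Context {R : realType} {V : lmodType R}.
Variable ip : V -> V -> R.

Definition inner_product : Prop :=
  [/\ forall x y, ip x y = ip y x,
      forall k x y z, ip (k *: x + y) z = k * ip x z + ip y z,
      forall x, 0 <= ip x x & forall x, ip x x = 0 -> x = 0].

Definition nrm x : R := Num.sqrt (ip x x).

Definition nrm_cvg (u : nat -> V) (l : V) : Prop :=
  forall e, 0 < e -> exists N, forall n, (N <= n)%N -> nrm (u n - l) <= e.

Definition nrm_complete : Prop :=
  forall u : nat -> V,
    (forall e, 0 < e -> exists N, forall m n, (N <= m)%N -> (N <= n)%N ->
       nrm (u m - u n) <= e) ->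
    exists l, nrm_cvg u l.

Hypothesis ipP : inner_product.

Lemma ipC x y : ip x y = ip y x. Proof. by case: ipP. Qed.

Lemma ipPl k x y z : ip (k *: x + y) z = k * ip x z + ip y z.
Proof. by case: ipP. Qed.

Lemma ip_ge0 x : 0 <= ip x x. Proof. by case: ipP. Qed.

Lemma ipDl x y z : ip (x + y) z = ip x z + ip y z.
Proof. by rewrite -[x]scale1r ipPl scale1r mul1r. Qed.

Lemma ip0l z : ip 0 z = 0.
Proof. by have := ipDl 0 0 z; rewrite addr0; lra. Qed.

Lemma ipZl k x z : ip (k *: x) z = k * ip x z.
Proof. by rewrite -[k *: x]addr0 ipPl ip0l addr0. Qed.

Lemma ipNl x z : ip (- x) z = - ip x z.
Proof. by rewrite -scaleN1r ipZl mulN1r. Qed.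

Lemma ipBl x y z : ip (x - y) z = ip x z - ip y z.
Proof. by rewrite ipDl ipNl. Qed.

Lemma ipDr x y z : ip z (x + y) = ip z x + ip z y.
Proof. by rewrite ipC ipDl !(ipC z). Qed.

Lemma ip0r z : ip z 0 = 0. Proof. by rewrite ipC ip0l. Qed.

Lemma ipZr k x z : ip z (k *: x) = k * ip z x.
Proof. by rewrite ipC ipZl ipC. Qed.

Lemma ipBr x y z : ip z (x - y) = ip z x - ip z y.
Proof. by rewrite ipC ipBl !(ipC z). Qed.

Lemma ip_suml I r (P : pred I) (F : I -> V) z :
  ip (\sum_(i <- r | P i) F i) z = \sum_(i <- r | P i) ip (F i) z.
Proof.
by elim/big_rec2: _ => [|i y x _ IH]; rewrite ?ip0l// ipDl IH.
Qed.

Lemma ip_sumr I r (P : pred I) (F : I -> V) z :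
  ip z (\sum_(i <- r | P i) F i) = \sum_(i <- r | P i) ip z (F i).
Proof. by rewrite ipC ip_suml; apply: eq_bigr => i _; rewrite ipC. Qed.

Lemma nrm_ge0 x : 0 <= nrm x. Proof. exact: sqrtr_ge0. Qed.

Lemma sqr_nrm x : nrm x ^+ 2 = ip x x. Proof. by rewrite sqr_sqrtr ?ip_ge0. Qed.

Lemma nrm0 : nrm 0 = 0. Proof. by rewrite /nrm ip0l sqrtr0. Qed.

Lemma nrm_eq0 x : nrm x = 0 -> x = 0.
Proof. by case: ipP => _ _ _ H n0; apply: H; rewrite -sqr_nrm n0 expr0n. Qed.

Lemma nrmN x : nrm (- x) = nrm x.
Proof. by rewrite /nrm ipNl ipC ipNl opprK. Qed.

Lemma nrmB x y : nrm (x - y) = nrm (y - x).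
Proof. by rewrite -nrmN opprB. Qed.

Lemma le_nrm x y : ip x x <= ip y y -> nrm x <= nrm y.
Proof. by move=> xy; rewrite ler_sqrt ?ip_ge0. Qed.

Lemma cauchy_schwarz x y : `|ip x y| <= nrm x * nrm y.
Proof.
rewrite -ler_sqr ?nnegrE ?mulr_ge0 ?nrm_ge0// exprMn !sqr_nrm real_normK ?num_real//.
have [y0|y0] := eqVneq (ip y y) 0.
  have -> : y = 0 by case: ipP => _ _ _; apply.
  by rewrite !ip0r expr0n mulr0.
have ygt0 : 0 < ip y y by rewrite lt_neqAle eq_sym y0 ip_ge0.
have := ip_ge0 (ip y y *: x - ip x y *: y).
rewrite ipBl !ipBr !ipZl !ipZr (ipC y x) => h.
have : 0 <= ip y y * (ip x x * ip y y - ip x y ^+ 2) by rewrite expr2; nra.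
by rewrite pmulr_rge0// subr_ge0.
Qed.

Lemma le_nrmD x y : nrm (x + y) <= nrm x + nrm y.
Proof.
rewrite -ler_sqr ?nnegrE ?addr_ge0 ?nrm_ge0// sqr_nrm sqrrD !sqr_nrm.
rewrite ipDl !ipDr (ipC y x).
have := cauchy_schwarz x y; rewrite ler_norml => /andP[_]; lra.
Qed.

Lemma le_nrmB3 x y z : nrm (x - z) <= nrm (x - y) + nrm (y - z).
Proof. by rewrite -[x - z](subrKA y) le_nrmD. Qed.

Lemma nrmZ k x : nrm (k *: x) = `|k| * nrm x.
Proof. by rewrite /nrm ipZl ipZr mulrA -expr2 sqrtrM ?sqr_ge0// sqrtr_sqr. Qed.

Lemma le_nrm_sum I r (P : pred I) (F : I -> V) :
  nrm (\sum_(i <- r | P i) F i) <= \sum_(i <- r | P i) nrm (F i).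
Proof.
elim/big_rec2: _ => [|i y x _ IH]; first by rewrite nrm0.
by rewrite (le_trans (le_nrmD _ _))// lerD2l.
Qed.

Lemma nrm_cvg_unique u l l' : nrm_cvg u l -> nrm_cvg u l' -> l = l'.
Proof.
move=> ul ul'; apply/eqP; rewrite -subr_eq0; apply/eqP/nrm_eq0/eqP.
rewrite eq_le nrm_ge0 andbT; apply/ler_addgt0Pr => e e0; rewrite add0r.
have e2 : 0 < e / 2 by rewrite divr_gt0.
have [N HN] := ul _ e2; have [N' HN'] := ul' _ e2.
rewrite (le_trans (le_nrmB3 _ (u (maxn N N')) _))// [leRHS]splitr nrmB.
by rewrite lerD ?HN ?HN' ?leq_maxl ?leq_maxr.
Qed.

End inner_product.

Section commuting_projections.
Context {R : realType} {V : lmodType R} {A : choiceType}.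
Variables (ip : V -> V -> R) (Q : A -> V -> V).
Hypothesis ipP : inner_product ip.
Hypothesis complete : nrm_complete ip.
Hypothesis Qlin : forall a k x y, Q a (k *: x + y) = k *: Q a x + Q a y.
Hypothesis Qsym : forall a x y, ip (Q a x) y = ip x (Q a y).
Hypothesis Qid : forall a x, Q a (Q a x) = Q a x.
Hypothesis Qcomm : forall a b x, Q a (Q b x) = Q b (Q a x).

Variable D : A -> V -> V.
Hypothesis DE : forall a x, D a x = x - Q a x.

(** [Q a] stands for conditioning on everything except coordinate [a], so being fixed by [Q a] means
    not depending on that coordinate. *)
Definition supported (s : {fset A}) (x : V) := forall a, a \notin s -> Q a x = x.

Hypothesis Qdense : forall x e, 0 < e ->
  exists y s, supported s y /\ nrm ip (x - y) <= e.

Lemma QD a x y : Q a (x + y) = Q a x + Q a y.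
Proof. by rewrite -[x]scale1r Qlin !scale1r. Qed.

Lemma Q0 a : Q a 0 = 0.
Proof. by have /eqP := QD a 0 0; rewrite addr0 -subr_eq0 opprD addrA subrr sub0r oppr_eq0 => /eqP. Qed.

Lemma QZ a k x : Q a (k *: x) = k *: Q a x.
Proof. by rewrite -[k *: x]addr0 Qlin Q0 addr0. Qed.

Lemma QN a x : Q a (- x) = - Q a x.
Proof. by rewrite -scaleN1r QZ scaleN1r. Qed.

Lemma QB a x y : Q a (x - y) = Q a x - Q a y. Proof. by rewrite QD QN. Qed.

Lemma DD a x y : D a (x + y) = D a x + D a y.
Proof. by rewrite !DE QD opprD addrACA. Qed.

Lemma D0 a : D a 0 = 0. Proof. by rewrite !DE Q0 subr0. Qed.

Lemma DZ a k x : D a (k *: x) = k *: D a x.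
Proof. by rewrite !DE QZ scalerBr. Qed.

Lemma DB a x y : D a (x - y) = D a x - D a y.
Proof. by rewrite DD -scaleN1r DZ scaleN1r. Qed.

Lemma Qsum a I r (P : pred I) (F : I -> V) :
  Q a (\sum_(i <- r | P i) F i) = \sum_(i <- r | P i) Q a (F i).
Proof. by elim/big_rec2: _ => [|i y z _ <-]; rewrite ?Q0 ?QD. Qed.

Lemma Dsum a I r (P : pred I) (F : I -> V) :
  D a (\sum_(i <- r | P i) F i) = \sum_(i <- r | P i) D a (F i).
Proof. by elim/big_rec2: _ => [|i y z _ <-]; rewrite ?D0 ?DD. Qed.

Lemma QDcomm a b x : Q a (D b x) = D b (Q a x).
Proof. by rewrite !DE QB Qcomm. Qed.

Lemma DDcomm a b x : D a (D b x) = D b (D a x).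
Proof. by rewrite DE QDcomm -DB -DE. Qed.

Lemma Dsym a x y : ip (D a x) y = ip x (D a y).
Proof. by rewrite !DE (ipBl ipP) (ipBr ipP) Qsym. Qed.

Lemma QDid a x : Q a (D a x) = 0. Proof. by rewrite !DE QB Qid subrr. Qed.

Lemma DQid a x : D a (Q a x) = 0. Proof. by rewrite !DE Qid subrr. Qed.

Lemma DDid a x : D a (D a x) = D a x. Proof. by rewrite [LHS]DE QDid subr0. Qed.

Lemma QDK a x : D a x + Q a x = x. Proof. by rewrite !DE subrK. Qed.

(* Components of order [n] of the product of the decompositions [1 = D a + Q a], [a] in [s]. *)
Fixpoint hoeff (s : seq A) (n : nat) (x : V) : V :=
  if s is a :: s' then
    (if n is n'.+1 then D a (hoeff s' n' x) else 0) + Q a (hoeff s' n x)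
  else if n is 0 then x else 0.

Lemma hoeffD s n x y : hoeff s n (x + y) = hoeff s n x + hoeff s n y.
Proof.
elim: s n x y => [[|n]|a s IH [|n]] x y //=; rewrite ?addr0//.
  by rewrite !add0r IH QD.
by rewrite !IH QD DD addrACA.
Qed.

Lemma hoeffZ s n k x : hoeff s n (k *: x) = k *: hoeff s n x.
Proof.
elim: s n => [[|n]|a s IH [|n]] //=; rewrite ?scaler0//.
  by rewrite !add0r IH QZ.
by rewrite [RHS]scalerDr !IH QZ DZ.
Qed.

Lemma hoeffB s n x y : hoeff s n (x - y) = hoeff s n x - hoeff s n y.
Proof. by rewrite hoeffD -scaleN1r hoeffZ scaleN1r. Qed.

Lemma hoeff0 s n : hoeff s n 0 = 0.
Proof. by rewrite -[X in hoeff _ _ X](scale0r (0 : V)) hoeffZ scale0r. Qed.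

Lemma hoeffQ s n a x : hoeff s n (Q a x) = Q a (hoeff s n x).
Proof.
elim: s n => [[|n]|b s IH [|n]] //=; rewrite ?Q0//.
  by rewrite !add0r IH Qcomm.
by rewrite !IH QD Qcomm -QDcomm.
Qed.

Lemma hoeffDa s n a x : hoeff s n (D a x) = D a (hoeff s n x).
Proof. by rewrite !DE hoeffB hoeffQ. Qed.

Lemma hoeff_sym s n x y : ip (hoeff s n x) y = ip x (hoeff s n y).
Proof.
elim: s n x y => [[|n]|a s IH [|n]] x y //=.
- by rewrite (ip0l ipP) (ip0r ipP).
- by rewrite !add0r Qsym IH hoeffQ.
- by rewrite (ipDl ipP) (ipDr ipP) Dsym Qsym !IH hoeffDa hoeffQ.
Qed.

(** Two products of operators [D a] and [Q a] over [s] annihilate each other as soon as they differ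
    in one factor, since [D a] and [Q a] are complementary projections. With self-adjointness this
    makes the components of different orders orthogonal. *)
Lemma hoeff_idem s m n x :
  hoeff s m (hoeff s n x) = if m == n then hoeff s n x else 0.
Proof.
elim: s m n x => [[|m] [|n]|a s IH m n] x //=; first by case: eqP.
have DQ0 u : D a (Q a u) = 0 by exact: DQid.
case: m n => [|m] [|n]/=; rewrite ?add0r.
- by rewrite hoeffQ Qid IH.
- by rewrite hoeffD hoeffDa hoeffQ QD Qid QDid add0r IH/= Q0.
- by rewrite !hoeffQ DQ0 Qid add0r IH/= Q0.
- rewrite !hoeffD !hoeffDa !hoeffQ !QD !DD DDid QDid DQid Qid addr0 add0r !IH eqSS.
  by case: eqP; rewrite ?D0 ?Q0 ?addr0.
Qed.

Lemma hoeff_gt s n x : (size s < n)%N -> hoeff s n x = 0.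
Proof.
elim: s n => [[|n]|a s IH [|n]] //=; rewrite ltnS => sn.
by rewrite !IH ?D0 ?Q0 ?addr0// ltnW.
Qed.

Lemma hoeff_sum s M x : (size s < M)%N -> \sum_(n < M) hoeff s n x = x.
Proof.
elim: s M x => [[|M]|a s IH [|M]] x //= sM.
  by rewrite big_ord_recl big1//= addr0.
rewrite big_split/= -Qsum IH; last by rewrite ltnS ltnW.
by rewrite big_ord_recl/= add0r -Dsum IH// QDK.
Qed.

Definition partialL (s : seq A) (x : V) : V := \sum_(a <- s) D a x.

Lemma partialLD s x y : partialL s (x + y) = partialL s x + partialL s y.
Proof. by rewrite /partialL -big_split; apply: eq_bigr => a _; rewrite DD. Qed.

Lemma partialLZ s k x : partialL s (k *: x) = k *: partialL s x.
Proof. by rewrite /partialL scaler_sumr; apply: eq_bigr => a _; rewrite DZ. Qed.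

Lemma partialLB s x y : partialL s (x - y) = partialL s x - partialL s y.
Proof. by rewrite partialLD -scaleN1r partialLZ scaleN1r. Qed.

(** A product with exactly [n] factors of type [D] is fixed by the corresponding [n] operators [D a]
    and killed by the others: up to sign, the eigenvalue equation of the generator restricted to
    [s]. *)
Lemma hoeff_partialL s n x : partialL s (hoeff s n x) = n%:R *: hoeff s n x.
Proof.
rewrite /partialL; elim: s n x => [[|n]|a s IH n] x; rewrite ?big_nil ?scale0r ?scaler0//.
rewrite big_cons.
have -> : \sum_(b <- s) D b (hoeff (a :: s) n x) =
    (if n is n'.+1 then D a (n'%:R *: hoeff s n' x) else 0) + Q a (n%:R *: hoeff s n x).
  rewrite -IH Qsum; case: n => [|n]/=.
    by rewrite [RHS]add0r; apply: eq_bigr => b _; rewrite add0r QDcomm.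
  rewrite -IH Dsum -big_split; apply: eq_bigr => b _ /=.
  by rewrite DD QDcomm DDcomm.
case: n => [|n] /=; first by rewrite !add0r DQid add0r !scale0r Q0.
rewrite DD DDid DQid addr0 DZ QZ scalerDr addrA; congr (_ + _).
by rewrite -[X in X + _]scale1r -scalerDl -natr1 addrC.
Qed.

Lemma hoeff_fix a s n x : Q a x = x -> hoeff (a :: s) n x = hoeff s n x.
Proof.
move=> Qx; have Dx : D a x = 0 by rewrite !DE Qx subrr.
case: n => [|n]/=; first by rewrite add0r -hoeffQ Qx.
by rewrite -hoeffDa Dx hoeff0 add0r -hoeffQ Qx.
Qed.

(** Enumerations of finite sets do not respect inclusions, so the components must be shown
    independent of the order of the list before sets of different size can be compared. *)
Lemma hoeff_perm s t n x : perm_eq s t -> hoeff s n x = hoeff t n x.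
Proof.
have H a s1 s2 k : hoeff (s1 ++ a :: s2) k x = hoeff (a :: s1 ++ s2) k x.
  elim: s1 k => [//|b s1 IH] k; rewrite cat_cons.
  case: k => [|[|k]]; rewrite [LHS]/= !IH /= ?add0r.
  - by rewrite Qcomm.
  - by rewrite !QD !QDcomm addrCA Qcomm.
  - by rewrite !QD !DD !QDcomm (DDcomm b a) (Qcomm b a) -!addrA; congr (_ + _); rewrite addrCA.
elim: s t n => [|a s IH] t n st.
  by move: st; rewrite perm_sym => /perm_nilP ->.
have : a \in t by rewrite -(perm_mem st) mem_head.
move=> at_; case/splitPr: at_ st => t1 t2 st; rewrite H.
have {}st : perm_eq s (t1 ++ t2).
  by rewrite -(perm_cons a) (perm_trans st)// perm_sym -cat1s -(cat1s a) perm_catCA.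
by rewrite /=; case: n => [|n]; rewrite !(IH _ _ st).
Qed.

Local Notation nrm := (nrm ip).
Local Notation nrm_cvg := (nrm_cvg ip).

Definition fhoeff (s : {fset A}) (n : nat) (x : V) : V := hoeff (enum_fset s) n x.

(** A coordinate outside [s0] contributes D a y = 0 and Q a y = y. The net of components is thus
    eventually constant on supported vectors. *)
Lemma fhoeff_supported s0 s n y : supported s0 y -> (s0 `<=` s)%fset ->
  fhoeff s n y = fhoeff s0 n y.
Proof.
move=> y0 s0s.
have p : perm_eq (enum_fset s) (enum_fset (s `\` s0)%fset ++ enum_fset s0).
  apply: uniq_perm; rewrite ?fset_uniq// ?cat_uniq ?fset_uniq ?andbT//=.
    by apply/hasPn => a /= as0; apply/negP; rewrite in_fsetD [a \in s0]as0.
  move=> a; rewrite mem_cat.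
  change ((a \in s) = (a \in (s `\` s0)%fset) || (a \in s0)); rewrite in_fsetD.
  by have [as0|//] := boolP (a \in s0); rewrite ?orbF// (fsubsetP s0s).
rewrite /fhoeff (hoeff_perm _ _ p).
have : {in enum_fset (s `\` s0)%fset, forall a, a \notin s0}.
  move=> a; change (a \in (s `\` s0)%fset -> a \notin s0).
  by rewrite in_fsetD => /andP[].
elim: (enum_fset _) => [//|a t IH] H; rewrite cat_cons hoeff_fix ?IH//.
  by move=> b bt; apply: H; rewrite inE bt orbT.
by apply: y0; apply: H; rewrite mem_head.
Qed.

(** A functional calculus for the finite generator: the component of order [n] is multiplied by
    [c n]. The weights 1 give back the identity once [M] exceeds the size of [s], the weights 1/n
    the inverse. *)
Definition comb (M : nat) (c : nat -> R) (s : {fset A}) (x : V) : V :=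
  \sum_(n < M) c n *: fhoeff s n x.

Lemma fhoeffB s n x y : fhoeff s n (x - y) = fhoeff s n x - fhoeff s n y.
Proof. exact: hoeffB. Qed.

Lemma combB M c s x y : comb M c s (x - y) = comb M c s x - comb M c s y.
Proof.
rewrite /comb -sumrB; apply: eq_bigr => n _.
by rewrite fhoeffB scalerBr.
Qed.

Lemma hoeff_ortho s m n x y : ip (fhoeff s m x) (fhoeff s n y) =
  if m == n then ip (fhoeff s n x) (fhoeff s n y) else 0.
Proof.
rewrite {1}/fhoeff hoeff_sym hoeff_idem; case: ifP => _; last by rewrite (ip0r ipP).
by rewrite /fhoeff hoeff_sym hoeff_idem eqxx.
Qed.

Lemma ip_comb M c s x :
  ip (comb M c s x) (comb M c s x) = \sum_(n < M) c n ^+ 2 * ip (fhoeff s n x) (fhoeff s n x).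
Proof.
rewrite /comb (ip_suml ipP); apply: eq_bigr => i _.
rewrite (ip_sumr ipP) (bigD1 i)//= big1 => [|j ji].
  by rewrite addr0 (ipZl ipP) (ipZr ipP) mulrA.
rewrite (ipZl ipP) (ipZr ipP) hoeff_ortho ifF ?mulr0//.
by apply/negbTE; rewrite eq_sym; apply: contra ji => /eqP/val_inj ->.
Qed.

Lemma fhoeff_sum s M x : (#|` s| < M)%N -> \sum_(n < M) fhoeff s n x = x.
Proof. exact: hoeff_sum. Qed.

Lemma comb_big s M c x : (#|` s| < M)%N -> comb M c s x = comb (#|` s|).+1 c s x.
Proof.
move=> sM; rewrite /comb -!(big_mkord xpredT (fun n => c n *: fhoeff s n x)).
rewrite (big_cat_nat _ sM)//= [X in _ + X](_ : _ = 0) ?addr0//.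
rewrite big_nat big1// => i /andP[si _].
by rewrite /fhoeff hoeff_gt ?scaler0.
Qed.

Lemma nrm_comb M c s x : (forall n, `|c n| <= 1) -> nrm (comb M c s x) <= nrm x.
Proof.
move=> c1; apply: (le_nrm ipP); rewrite ip_comb.
(* Writing [x] itself as a combination with weights 1, long enough to contain all orders below [M],
   reduces the claim to a comparison of weighted sums of squares. *)
have xE : x = comb (maxn M (#|` s|).+1) (fun=> 1) s x.
  rewrite /comb -[LHS](@fhoeff_sum s (maxn M (#|` s|).+1)) ?leq_maxr//.
  by apply: eq_bigr => n _; rewrite scale1r.
rewrite [in leRHS]xE ip_comb.
rewrite -[leRHS](big_mkord xpredT (fun n => _ * ip (fhoeff s n x) (fhoeff s n x))).
rewrite [leRHS](big_cat_nat (leq0n M) (leq_maxl _ _))/=.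
apply: ler_wpDr.
  by apply: sumr_ge0 => n _; rewrite mulr_ge0 ?sqr_ge0 ?(ip_ge0 ipP).
rewrite big_mkord; apply: ler_sum => n _; rewrite ler_wpM2r ?(ip_ge0 ipP)// expr1n.
by rewrite -[leLHS]ger0_norm ?sqr_ge0// normrX exprn_ile1.
Qed.

Lemma nrm_fhoeff s n x : nrm (fhoeff s n x) <= nrm x.
Proof.
have := @nrm_comb n.+1 (fun m => (m == n)%:R) s x.
rewrite /comb (bigD1 ord_max)//= big1 => [|i ni].
  rewrite eqxx scale1r addr0; apply => m; case: eqP; rewrite ?normr1 ?normr0//.
case: eqP => [e|]; last by rewrite scale0r.
by move: ni; rewrite -val_eqE/= e eqxx.
Qed.

(** * Limits over finite sets of coordinates *)

Definition net_cvg (T : {fset A} -> V) (l : V) : Prop :=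
  forall e, 0 < e -> exists s0, forall s, (s0 `<=` s)%fset -> nrm (T s - l) <= e.

Lemma net_cvgP (T : {fset A} -> V) l s e : net_cvg T l -> 0 < e ->
  exists2 s', (s `<=` s')%fset & nrm (T s' - l) <= e.
Proof.
move=> Tl e0; have [s0 H] := Tl e e0; exists (s `|` s0)%fset; first exact: fsubsetUl.
by apply: H; exact: fsubsetUr.
Qed.

Lemma net_cvgD T l T' l' : net_cvg T l -> net_cvg T' l' ->
  net_cvg (fun s => T s + T' s) (l + l').
Proof.
move=> Tl Tl' e e0; have e2 : 0 < e / 2 by rewrite divr_gt0.
have [s0 H] := Tl _ e2; have [s1 H'] := Tl' _ e2.
exists (s0 `|` s1)%fset => s; rewrite fsubUset => /andP[a b].
by rewrite opprD addrACA (le_trans (le_nrmD ipP _ _))// [leRHS]splitr lerD ?H ?H'.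
Qed.

Lemma net_cvgZ k T l : net_cvg T l -> net_cvg (fun s => k *: T s) (k *: l).
Proof.
move=> Tl e e0; have k0 : 0 < `|k| + 1 by rewrite ltr_wpDl.
have [s0 H] := Tl _ (divr_gt0 e0 k0); exists s0 => s ss.
rewrite -scalerBr (nrmZ ipP) (le_trans (ler_wpM2l (normr_ge0 _) (H _ ss)))//.
by rewrite mulrCA ler_piMr ?(ltW e0)// ler_pdivrMr// mul1r lerDl.
Qed.

Lemma net_cvg_cst l : net_cvg (fun=> l) l.
Proof. by move=> e e0; exists fset0 => s _; rewrite subrr (nrm0 ipP) ltW. Qed.

(** Contractions that are eventually constant on a dense set converge everywhere. The limit is that
    of the stable components [u k] of approximants of [x] at distance at most 1/(k+1). *)
Lemma fhoeff_net n x : exists l, net_cvg (fun s => fhoeff s n x) l.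
Proof.
have appr k : exists ys : V * {fset A},
    supported ys.2 ys.1 /\ nrm (x - ys.1) <= (k.+1%:R : R)^-1.
  by have [|y [s ?]] := @Qdense x (k.+1%:R)^-1; [rewrite invr_gt0|exists (y, s)].
have [ys ysP] := choice appr.
pose u k := fhoeff (ys k).2 n (ys k).1.
have uT k s : ((ys k).2 `<=` s)%fset -> nrm (fhoeff s n x - u k) <= (k.+1%:R : R)^-1.
  move=> ss; rewrite /u -(fhoeff_supported n (ysP k).1 ss) -fhoeffB.
  by rewrite (le_trans (nrm_fhoeff _ _ _))// (ysP k).2.
have inv_le (e : R) : 0 < e -> exists N, forall k, (N <= k)%N -> (k.+1%:R : R)^-1 <= e.
  move=> e0; exists (Num.bound (e^-1)) => k Nk.
  rewrite invf_ple ?posrE// ltW// (lt_le_trans (archi_boundP _)) ?invr_ge0 ?ltW//.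
  by rewrite ltr_nat ltnS.
have [e e0|l ul] := @complete u.
  have [N HN] := inv_le _ (divr_gt0 e0 (@ltr0Sn R 1)).
  exists N => i j Ni Nj.
  pose s := ((ys i).2 `|` (ys j).2)%fset.
  rewrite (le_trans (le_nrmB3 ipP _ (fhoeff s n x) _))// [leRHS]splitr (nrmB ipP) lerD//.
    by rewrite (le_trans (uT _ _ _)) ?HN// fsubsetUl.
  by rewrite (le_trans (uT _ _ _)) ?HN// fsubsetUr.
exists l => e e0; have e2 : 0 < e / 2 by rewrite divr_gt0.
have [N HN] := inv_le _ e2; have [N' HN'] := ul _ e2.
exists (ys (maxn N N')).2 => s /uT h.
rewrite (le_trans (le_nrmB3 ipP _ (u (maxn N N')) _))// [leRHS]splitr lerD//.
  by rewrite (le_trans h) ?HN ?leq_maxl.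
by rewrite HN' ?leq_maxr.
Qed.

Definition proj n x : V := xget 0 [set l | net_cvg (fun s => fhoeff s n x) l].

Lemma proj_cvg n x : net_cvg (fun s => fhoeff s n x) (proj n x).
Proof.
have [l xl] := fhoeff_net n x.
exact: (@xgetPex _ 0 [set l | net_cvg (fun s => fhoeff s n x) l] (ex_intro _ l xl)).
Qed.

Definition pcomb (M : nat) (c : nat -> R) (x : V) : V := \sum_(n < M) c n *: proj n x.

Lemma pcomb_cvg M c x : net_cvg (fun s => comb M c s x) (pcomb M c x).
Proof.
rewrite /comb /pcomb; elim: M => [|M IH].
  by rewrite big_ord0; under eq_fun do rewrite big_ord0; exact: net_cvg_cst.
rewrite big_ord_recr/=; under eq_fun do rewrite big_ord_recr/=.
by apply: net_cvgD => //; apply: net_cvgZ; exact: proj_cvg.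
Qed.

Lemma pcomb_approx M c x y s : (forall n, `|c n| <= 1) -> supported s y ->
  nrm (pcomb M c x - comb M c s y) <= nrm (x - y).
Proof.
move=> c1 sy; apply/ler_addgt0Pr => e e0.
have [s' ss' h] := net_cvgP s (pcomb_cvg M c x) e0.
rewrite (le_trans (le_nrmB3 ipP _ (comb M c s' x) _))// addrC lerD//; last by rewrite (nrmB ipP).
have -> : comb M c s y = comb M c s' y.
  by apply: eq_bigr => n _; rewrite (fhoeff_supported n sy ss').
by rewrite -combB nrm_comb.
Qed.

(** The comparison with a supported [y] is uniform in the truncation [M], because orders above the
    size of [s] do not occur in [y]. It yields both the Cauchy property and the second clause,
    through which the limit is later handled. *)
Lemma pcomb_lim c x : (forall n, `|c n| <= 1) ->
  exists2 l, nrm_cvg (fun M => pcomb M c x) l &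
    forall y s, supported s y -> nrm (l - comb (#|` s|).+1 c s y) <= nrm (x - y).
Proof.
move=> c1; have [e e0|l ul] := @complete (fun M => pcomb M c x).
  have [y [s [sy xy]]] := Qdense x (divr_gt0 e0 (@ltr0Sn R 1)).
  exists (#|` s|).+1 => i j si sj.
  rewrite (le_trans (le_nrmB3 ipP _ (comb i c s y) _))// [leRHS]splitr lerD//.
    by rewrite (le_trans (pcomb_approx _ _ c1 sy)).
  by rewrite comb_big// -(comb_big c y sj) (nrmB ipP) (le_trans (pcomb_approx _ _ c1 sy)).
exists l => // y s sy; apply/ler_addgt0Pr => e e0.
have [N HN] := ul _ e0.
rewrite (le_trans (le_nrmB3 ipP _ (pcomb (maxn N (#|` s|).+1) c x) _))// addrC lerD//.
  by rewrite -(comb_big c y (leq_maxr N _)) pcomb_approx.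
by rewrite (nrmB ipP) HN ?leq_maxl.
Qed.

Lemma proj_sum x : nrm_cvg (fun M => \sum_(n < M) proj n x) x.
Proof.
have [|l ul lP] := @pcomb_lim (fun=> 1) x; first by move=> n; rewrite normr1.
suff lx : l = x.
  by rewrite lx in ul; move=> e /ul[N HN]; exists N => n /HN; rewrite /pcomb; under eq_bigr do rewrite scale1r.
apply/eqP; rewrite -subr_eq0; apply/eqP/(nrm_eq0 ipP)/eqP.
rewrite eq_le (nrm_ge0 ip) andbT; apply/ler_addgt0Pr => e e0; rewrite add0r.
have [y [s [sy xy]]] := Qdense x (divr_gt0 e0 (@ltr0Sn R 1)).
have := lP _ _ sy; rewrite /comb; under eq_bigr do rewrite scale1r.
rewrite fhoeff_sum// => h.
by rewrite (le_trans (le_nrmB3 ipP _ y _))// [leRHS]splitr lerD// ?(le_trans h)// (nrmB ipP).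
Qed.

Lemma proj_ortho x m n : m != n -> ip (proj m x) (proj n x) = 0.
Proof.
move=> mn; apply/eqP; rewrite -normr_eq0 eq_le normr_ge0 andbT.
apply/ler_addgt0Pr => e e0; rewrite add0r.
(* Over one large [s] the components are exactly orthogonal. Replacing the two limits by them costs
   (e/K) |proj n x| + |x| (e/K); the final 1 only keeps [K] positive. *)
set K := nrm (proj n x) + nrm x + 1.
have K0 : 0 < K by rewrite ltr_wpDl// addr_ge0 ?(nrm_ge0 ip).
have eK : 0 < e / K by rewrite divr_gt0.
have [s0 h0] := proj_cvg m x eK.
have [s /h0 hm hn] := net_cvgP s0 (proj_cvg n x) eK.
have -> : ip (proj m x) (proj n x) =
    - ip (fhoeff s m x - proj m x) (proj n x) - ip (fhoeff s m x) (fhoeff s n x - proj n x).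
  rewrite (ipBl ipP) (ipBr ipP) hoeff_ortho (negbTE mn); ring.
rewrite (le_trans (ler_normB _ _))// normrN.
have -> : e = (e / K) * nrm (proj n x) + nrm x * (e / K) + e / K.
  transitivity (e / K * K); first by rewrite divfK ?gt_eqF.
  by rewrite {2}/K; ring.
rewrite -[leLHS]addr0 lerD ?(ltW eK)// lerD//.
  by rewrite (le_trans (cauchy_schwarz ipP _ _))// ler_wpM2r ?(nrm_ge0 ip).
by rewrite (le_trans (cauchy_schwarz ipP _ _))// ler_pM ?(nrm_ge0 ip) ?nrm_fhoeff.
Qed.

Definition projs (M : nat) x : V := \sum_(1 <= n < M) proj n x.

Lemma projs_cvg x : proj 0 x = 0 -> nrm_cvg (projs^~ x) x.
Proof.
move=> x0 e /(proj_sum x)[N HN]; exists N.+1 => [[//|M]] NM.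
have := HN M.+1 (ltnW NM).
by rewrite -(big_mkord xpredT (fun n => proj n x)) big_ltn// x0 add0r.
Qed.

(** A spectral gap inequality: without a component of order 0, all orders are at least 1, so the
    weights [n] can only increase the squared norm. Finite sums and an error term are used because
    the full series may diverge. *)
Lemma energy_ge x e : proj 0 x = 0 -> 0 < e ->
  exists M, nrm x <= Num.sqrt (\sum_(1 <= n < M) n%:R * ip (proj n x) (proj n x)) + e.
Proof.
move=> x0 e0; have [M HM] := projs_cvg x0 e0; exists M.
have := HM M (leqnn M); rewrite (nrmB ipP) => h.
rewrite -[x in leLHS](subrK (projs M x)) (le_trans (le_nrmD ipP _ _))// addrC lerD//.
rewrite /nrm ler_sqrt; last first.
  by apply: sumr_ge0 => n _; rewrite mulr_ge0 ?(ip_ge0 ipP).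
rewrite /projs (ip_suml ipP) big_nat [leRHS]big_nat; apply: ler_sum => n /andP[n0 nM].
rewrite (ip_sumr ipP) (bigD1_seq n) ?mem_index_iota ?n0 ?nM ?iota_uniq//=.
rewrite big1 ?addr0 => [|j jn]; last by rewrite proj_ortho// eq_sym.
by rewrite ler_peMl ?(ip_ge0 ipP)// ler1n.
Qed.

(** * The inverse of the generator *)

Definition is_linv x g : Prop :=
  nrm_cvg (fun M => \sum_(1 <= n < M) (n%:R)^-1 *: proj n x) g.

(** The convention that the inverse of 0 is 0 drops the component of order 0. The weights are
    positive, so [g] in [is_linv x g] is minus the inverse of the generator at [x]. *)
Let cinv (n : nat) : R := n%:R^-1.

Let cinv_le n : `|cinv n| <= 1.
Proof.
case: n => [|n]; first by rewrite /cinv invr0 normr0.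
by rewrite /cinv ger0_norm// invf_le1// ler1n.
Qed.

Lemma linv_exists x : exists g, is_linv x g /\
  forall y s, supported s y -> nrm (g - comb (#|` s|).+1 cinv s y) <= nrm (x - y).
Proof.
have [g xg H] := pcomb_lim x cinv_le; exists g; split => // e /xg[N HN].
exists N.+1 => [[//|M]] NM; have := HN M.+1 (ltnW NM).
rewrite /pcomb -(big_mkord xpredT (fun n => cinv n *: proj n x)) big_ltn//.
by rewrite {1}/cinv invr0 scale0r add0r.
Qed.

Lemma linv_approx x g y s : is_linv x g -> supported s y ->
  nrm (g - comb (#|` s|).+1 cinv s y) <= nrm (x - y).
Proof.
move=> xg; have [g' [xg' H]] := linv_exists x.
by rewrite (nrm_cvg_unique ipP xg xg'); exact: H.
Qed.

Lemma nrm_linv x g : is_linv x g -> nrm g <= nrm x.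
Proof.
move=> xg; have s0 : supported fset0 0 by move=> a _; exact: Q0.
have := linv_approx xg s0; rewrite !subr0 /comb big1 ?subr0// => n _.
by rewrite /fhoeff hoeff0 scaler0.
Qed.

(** On orders [n >= 1] the eigenvalue [n] cancels the weight 1/n; only the component of order 0 is
    lost. *)
Lemma partialL_comb s M y : (#|` s| < M)%N ->
  partialL (enum_fset s) (comb M cinv s y) = y - fhoeff s 0 y.
Proof.
move=> sM; rewrite -[X in _ = X - _](@fhoeff_sum s M y sM) /comb.
case: M sM => [//|M] sM; rewrite !big_ord_recl /cinv invr0 scale0r add0r addrAC subrr add0r.
have -> : partialL (enum_fset s) (\sum_(i < M) (lift ord0 i)%:R^-1 *: fhoeff s (lift ord0 i) y) =
    \sum_(i < M) partialL (enum_fset s) ((lift ord0 i)%:R^-1 *: fhoeff s (lift ord0 i) y).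
  rewrite /partialL exchange_big/=; apply: eq_bigr => a _.
  by rewrite Dsum.
apply: eq_bigr => i _; rewrite partialLZ /fhoeff hoeff_partialL scalerA mulVf ?scale1r//.
by rewrite pnatr_eq0.
Qed.

(** Self-adjointness, idempotence and commutation rewrite the inner product as the squared norm of
    [D a (D b x)]. *)
Lemma ip_DD a b x : 0 <= ip (D a x) (D b x).
Proof.
have -> : ip (D a x) (D b x) = ip (D a (D b x)) (D a (D b x)).
  by rewrite [RHS]Dsym DDid DDcomm -[RHS]Dsym DDid (ipC ipP).
exact: (ip_ge0 ipP).
Qed.

(** Additional coordinates contribute only nonnegative inner products. An estimate over a large set
    therefore controls the partial sums over all its subsets. *)
Lemma partialL_mono s s' x : (s `<=` s')%fset ->
  nrm (partialL (enum_fset s) x) <= nrm (partialL (enum_fset s') x).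
Proof.
move=> ss'.
have -> : partialL (enum_fset s') x =
    partialL (enum_fset s) x + partialL (enum_fset (s' `\` s)%fset) x.
  rewrite /partialL -big_cat/=; apply: perm_big; apply: uniq_perm.
  - exact: fset_uniq.
  - rewrite cat_uniq !fset_uniq andbT/=; apply/hasPn => a.
    change (a \in (s' `\` s)%fset -> a \notin s).
    by rewrite in_fsetD => /andP[].
  - move=> a; rewrite mem_cat.
    change ((a \in s') = (a \in s) || (a \in (s' `\` s)%fset)); rewrite in_fsetD.
    by have [/(fsubsetP ss') ->|] := boolP (a \in s).
apply: (le_nrm ipP); rewrite (ipDl ipP) !(ipDr ipP).
have p0 (t t' : {fset A}) : 0 <= ip (partialL (enum_fset t) x) (partialL (enum_fset t') x).
  rewrite (ip_suml ipP) sumr_ge0// => a _; rewrite (ip_sumr ipP) sumr_ge0// => b _.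
  exact: ip_DD.
by rewrite -addrA lerDl !addr_ge0.
Qed.

Lemma nrm_partialL s x : nrm (partialL (enum_fset s) x) <= (#|` s|)%:R * nrm x.
Proof.
rewrite (le_trans (le_nrm_sum ipP _ _ _))//.
apply: (@le_trans _ _ (\sum_(a <- enum_fset s) nrm x)).
  apply: ler_sum => a _; apply: (le_nrm ipP).
  rewrite -{3 4}(QDK a x) (ipDl ipP) !(ipDr ipP).
  have -> : ip (D a x) (Q a x) = 0 by rewrite Dsym DQid (ip0r ipP).
  have -> : ip (Q a x) (D a x) = 0 by rewrite Qsym QDid (ip0r ipP).
  by rewrite addr0 add0r lerDl (ip_ge0 ipP).
by rewrite big_const_seq count_predT iter_addr_0 mulr_natl.
Qed.

Lemma comb_supported s0 s y : supported s0 y -> (s0 `<=` s)%fset ->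
  comb (#|` s0|).+1 cinv s0 y = comb (#|` s|).+1 cinv s y.
Proof.
move=> sy ss; rewrite -(@comb_big s0 (#|` s|).+1); last first.
  by rewrite ltnS fsubset_leq_card.
by apply: eq_bigr => n _; rewrite (fhoeff_supported n sy ss).
Qed.

(* [L_s] is bounded by [L_s'] for [s <= s'], and [L_s' (L^-1 w)] is [w] up to sign when
   [w] is centered with support in [s']; this bounds [L_s L^-1] uniformly in [s]. *)
Lemma partialL_linv_bound s x g y s0 : is_linv x g -> supported s0 y ->
  nrm (partialL (enum_fset s) (g - comb (#|` s0|).+1 cinv s0 y)) <= 2 * nrm (x - y).
Proof.
move=> xg sy; apply/ler_addgt0Pr => e e0.
(* [y'] is chosen after [s]: the crude operator bound costs #|s| e/k for replacing [g] by the
   combination built on [y'], and passing from [y'] to [y] costs 2 e/k besides the main term, [e] in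
   all. *)
set k := (#|` s|)%:R + 2 : R.
have k0 : 0 < k by rewrite ltr_wpDl.
have [y' [s' [sy' xy']]] := Qdense x (divr_gt0 e0 k0).
have [t [st s0t s't]] : exists t : {fset A}, [/\ (s `<=` t)%fset, (s0 `<=` t)%fset & (s' `<=` t)%fset].
  exists (s `|` (s0 `|` s'))%fset; split; first exact: fsubsetUl.
    by rewrite fsubsetU// fsubsetUl orbT.
  by rewrite fsubsetU// fsubsetUr orbT.
rewrite (comb_supported sy s0t) -(subrKA (comb (#|` t|).+1 cinv t y')) partialLD.
rewrite (le_trans (le_nrmD ipP _ _))//.
have h1 : nrm (partialL (enum_fset s) (g - comb (#|` t|).+1 cinv t y')) <= (#|` s|)%:R * (e / k).
  rewrite (le_trans (nrm_partialL _ _))// ler_wpM2l//.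
  by rewrite -(comb_supported sy' s't) (le_trans (linv_approx xg sy')).
have h2 : nrm (partialL (enum_fset s) (comb (#|` t|).+1 cinv t y' - comb (#|` t|).+1 cinv t y))
    <= 2 * nrm (y' - y).
  rewrite (le_trans (partialL_mono _ st))// -combB partialL_comb//.
  rewrite (le_trans (le_nrmD ipP _ _))// (nrmN ipP) mulr_natl mulr2n lerD2l.
  exact: nrm_fhoeff.
have h3 : nrm (y' - y) <= e / k + nrm (x - y).
  by rewrite (le_trans (le_nrmB3 ipP _ x _))// (nrmB ipP) lerD2r.
have -> : e = (#|` s|)%:R * (e / k) + 2 * (e / k).
  by rewrite -mulrDl -/k mulrC divfK ?gt_eqF.
lra.
Qed.

(** On a supported approximant [y] the partial sum returns [y] minus its component of order 0, and
    that component is no larger than [x - y] because [x] has none. The total error is 2 + 1 + 1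
    times the norm of [x - y], whence the choice e/4. *)
Lemma partialL_linv x g : proj 0 x = 0 -> is_linv x g ->
  net_cvg (fun s => partialL (enum_fset s) g) x.
Proof.
move=> x0 xg e e0.
have e4 : 0 < e / 4 by rewrite divr_gt0.
have [y [s [sy xy]]] := Qdense x e4.
exists s => t st.
have h := partialL_linv_bound t xg sy.
have E : partialL (enum_fset t) (comb (#|` s|).+1 cinv s y) = y - fhoeff t 0 y.
  by rewrite (comb_supported sy st) partialL_comb.
move: h; rewrite partialLB E => h.
have h0 : nrm (fhoeff t 0 y) <= nrm (x - y).
  rewrite (fhoeff_supported 0 sy st).
  have := @pcomb_approx 1 (fun=> 1) x y s _ sy.
  rewrite /pcomb /comb !big_ord_recl !big_ord0 x0 scaler0 !addr0 scale1r sub0r (nrmN ipP).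
  by apply=> _; rewrite normr1.
set u := partialL (enum_fset t) g in h *.
have -> : u - x = (u - (y - fhoeff t 0 y)) + ((y - x) - fhoeff t 0 y).
  by rewrite (addrAC y) subrKA.
rewrite (le_trans (le_nrmD ipP _ _))//.
have := le_nrmD ipP (y - x) (- fhoeff t 0 y); rewrite (nrmN ipP) (nrmB ipP y x).
lra.
Qed.

(** The sum equals the inner product of the partial sum of the D a g with [g]. By monotonicity the
    norm of that partial sum is at most its limit |x|, and |g| <= |x|. *)
Lemma sum_D_linv s x g : proj 0 x = 0 -> is_linv x g ->
  \sum_(a <- enum_fset s) ip (D a g) (D a g) <= nrm x ^+ 2.
Proof.
move=> x0 xg; apply/ler_addgt0Pr => e e0.
have K0 : 0 < nrm g + 1 by rewrite ltr_wpDl ?(nrm_ge0 ip).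
have [t st h] := net_cvgP s (partialL_linv x0 xg) (divr_gt0 e0 K0).
have -> : \sum_(a <- enum_fset s) ip (D a g) (D a g) = ip (partialL (enum_fset s) g) g.
  by rewrite (ip_suml ipP); apply: eq_bigr => a _; rewrite -Dsym DDid.
rewrite (le_trans (ler_norm _))// (le_trans (cauchy_schwarz ipP _ _))//.
rewrite (le_trans (ler_wpM2r (nrm_ge0 ip _) (partialL_mono g st)))//.
have h1 : nrm (partialL (enum_fset t) g) <= nrm x + e / (nrm g + 1).
  rewrite -[partialL _ g](subrK x) (le_trans (le_nrmD ipP _ _))//; lra.
rewrite (le_trans (ler_wpM2r (nrm_ge0 ip _) h1))// mulrDl lerD//.
  by rewrite expr2 ler_wpM2l ?(nrm_ge0 ip) ?nrm_linv.
by rewrite mulrAC ler_pdivrMr// ler_wpM2l ?(ltW e0)// lerDl.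
Qed.

(** * Components of a given order as sums over subsets *)

Lemma foldr_perm (f : A -> V -> V) x s t :
  (forall a b y, f a (f b y) = f b (f a y)) -> perm_eq s t ->
  foldr f x s = foldr f x t.
Proof.
move=> fC.
have H a s1 s2 : foldr f x (s1 ++ a :: s2) = f a (foldr f x (s1 ++ s2)).
  by elim: s1 => //= b s1 ->; rewrite fC.
elim: s t => [|a s IH] t st.
  by move: st; rewrite perm_sym => /perm_nilP ->.
have : a \in t by rewrite -(perm_mem st) mem_head.
move=> at_; case/splitPr: at_ st => t1 t2 st; rewrite H /= (IH (t1 ++ t2))//.
by rewrite -(perm_cons a) (perm_trans st)// perm_sym -cat1s -(cat1s a) perm_catCA.
Qed.

Lemma perm_fset1U (a : A) (B : {fset A}) : a \notin B ->
  perm_eq (enum_fset (a |` B)%fset) (a :: enum_fset B).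
Proof.
move=> aB; apply: uniq_perm; rewrite ?fset_uniq//=.
  by rewrite fset_uniq andbT.
by move=> b; rewrite [RHS]inE; exact: in_fset1U.
Qed.

Definition subset_proj (B J : {fset A}) (x : V) : V :=
  foldr D (foldr Q x (enum_fset (B `\` J)%fset)) (enum_fset J).

(** Induction on [B]: the subsets of the enlarged set either contain the new element [a], and then
    [D a] factors out and the order drops by one, or they do not, and [Q a] factors out. *)
Lemma sum_subset_proj (B : {fset A}) n x :
  \sum_(J <- enum_fset (fpowerset B) | #|` J| == n) subset_proj B J x = fhoeff B n x.
Proof.
rewrite /fhoeff; elim/fset1U_rect: B n => [|a B aB IH] n.
  rewrite fpowerset0 big_mkcond big_seq_fset1 cardfs0 /subset_proj fset0D.
  by case: n.
rewrite (hoeff_perm _ _ (perm_fset1U aB)).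
have aP J : J \in enum_fset (fpowerset B) -> a \notin J.
  change (J \in fpowerset B -> a \notin J).
  by move=> JB; apply: contra aB; move: JB; rewrite fpowersetE => /fsubsetP; apply.
have p : perm_eq (enum_fset (fpowerset (a |` B)%fset))
    ([seq (a |` J)%fset | J <- enum_fset (fpowerset B)] ++ enum_fset (fpowerset B)).
  apply: uniq_perm; rewrite ?fset_uniq//.
    rewrite cat_uniq fset_uniq andbT; apply/andP; split.
      rewrite map_inj_in_uniq ?fset_uniq// => J J'.
      move=> /aP aJ /aP aJ' e.
      by rewrite -(fsetU1K aJ) e fsetU1K.
    apply/hasPn => J JB; apply/mapP => -[J' _ JE].
    by have := aP J JB; rewrite JE fset1U1.
  move=> J; rewrite mem_cat.
  change ((J \in fpowerset (a |` B)%fset) =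
    (J \in [seq (a |` J0)%fset | J0 <- enum_fset (fpowerset B)]) || (J \in fpowerset B)).
  rewrite !fpowersetE; apply/idP/orP => [JB|[/mapP[J' J'B ->]|JB]].
  - have [aJ|aJ] := boolP (a \in J); [left|right].
      apply/mapP; exists (J `\ a)%fset; last by rewrite fsetD1K.
      change ((J `\ a)%fset \in fpowerset B); rewrite fpowersetE.
      by rewrite fsubDset.
    by rewrite -(mem_fsetD1 aJ) fsubDset.
  - have {}J'B : J' \in fpowerset B by [].
    by rewrite fsetUS// -fpowersetE.
  - by rewrite fsubsetU// JB orbT.
rewrite (perm_big _ p)/= big_cat big_map /=; congr (_ + _).
  case: n => [|n].
    rewrite big_seq_cond big1// => J /andP[JB].
    by rewrite cardfsU1 (aP _ JB).
  rewrite -IH Dsum big_seq_cond [RHS]big_seq_cond; apply: eq_big => [J|J].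
    have [JB/=|//] := boolP (J \in enum_fset (fpowerset B)).
    by rewrite cardfsU1 (aP _ JB).
  move=> /andP[/aP aJ _].
  rewrite /subset_proj (foldr_perm _ DDcomm (perm_fset1U aJ))/=.
  suff -> : ((a |` B) `\` (a |` J) = B `\` J)%fset by [].
  apply/fsetP => b; rewrite !inE negb_or; have [->|//] := eqVneq b a.
  by rewrite (negbTE aB) andbF.
rewrite -IH Qsum big_seq_cond [RHS]big_seq_cond; apply: eq_bigr => J /andP[/aP aJ _].
rewrite /subset_proj.
have -> : ((a |` B) `\` J = a |` (B `\` J))%fset.
  by apply/fsetP => b; rewrite !inE; have [->|] := eqVneq b a; rewrite ?aJ.
have aBJ : a \notin (B `\` J)%fset by rewrite inE (negbTE aB) andbF.
rewrite (foldr_perm _ Qcomm (perm_fset1U aBJ))/=.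
by elim: (enum_fset J) => //= b s ->; rewrite QDcomm.
Qed.

End commuting_projections.

(** * Square integrable functions and conditional expectations *)

Section square_integrable.
Context d (T : measurableType d) (R : realType) (P : probability T R).
Implicit Types f g : T -> R.

Definition L1 f : Prop := P.-integrable setT (EFin \o f).
Definition Ex f : R := \int[P]_w f w.
Definition L2 f : Prop := measurable_fun setT f /\ L1 (fun w => f w ^+ 2).

Lemma L1_meas f : L1 f -> measurable_fun setT f.
Proof. by move=> /integrableP[/measurable_EFinP]. Qed.

Lemma L1D f g : L1 f -> L1 g -> L1 (fun w => f w + g w).
Proof. by move=> lf lg; have := integrableD measurableT lf lg; exact: eq_integrable. Qed.

Lemma L1Z k f : L1 f -> L1 (fun w => k * f w).
Proof. by move=> lf; have := integrableZl measurableT k lf; exact: eq_integrable. Qed.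

Lemma L1N f : L1 f -> L1 (fun w => - f w).
Proof. by move=> /(L1Z (- 1)); apply: eq_integrable => // w _; rewrite /= mulN1r. Qed.

Lemma L1B f g : L1 f -> L1 g -> L1 (fun w => f w - g w).
Proof. by move=> lf /L1N; exact: L1D. Qed.

Lemma L1_norm f : L1 f -> L1 (fun w => `|f w|).
Proof. by move=> /integrable_abse. Qed.

Lemma L1_cst k : L1 (cst k).
Proof. exact: finite_measure_integrable_cst. Qed.

Lemma L1_le g f : measurable_fun setT f -> (forall w, `|f w| <= g w) -> L1 g -> L1 f.
Proof.
move=> mf fg; apply: le_integrable => //; first exact/measurable_EFinP.
by move=> w _ /=; rewrite lee_fin (le_trans (fg w))// ler_norm.
Qed.

Lemma L1_sum I (r : seq I) (f : I -> T -> R) : (forall i, L1 (f i)) ->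
  L1 (fun w => \sum_(i <- r) f i w).
Proof.
move=> lf; elim: r => [|i r IH].
  by under [X in L1 X]eq_fun do rewrite big_nil; exact: L1_cst.
by under [X in L1 X]eq_fun do rewrite big_cons; exact: L1D.
Qed.

Lemma ExD f g : L1 f -> L1 g -> Ex (fun w => f w + g w) = Ex f + Ex g.
Proof. by move=> lf lg; rewrite /Ex RintegralD. Qed.

Lemma ExZ k f : L1 f -> Ex (fun w => k * f w) = k * Ex f.
Proof. by move=> lf; rewrite /Ex RintegralZl. Qed.

Lemma ExN f : L1 f -> Ex (fun w => - f w) = - Ex f.
Proof.
move=> /(ExZ (- 1)); rewrite mulN1r => <-; apply: eq_Rintegral => w _.
by rewrite mulN1r.
Qed.

Lemma ExB f g : L1 f -> L1 g -> Ex (fun w => f w - g w) = Ex f - Ex g.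
Proof. by move=> lf lg; rewrite /Ex RintegralB. Qed.

Lemma Ex_sum I (r : seq I) (f : I -> T -> R) : (forall i, L1 (f i)) ->
  Ex (fun w => \sum_(i <- r) f i w) = \sum_(i <- r) Ex (f i).
Proof.
move=> lf; elim: r => [|i r IH].
  by rewrite big_nil /Ex; under eq_Rintegral do rewrite big_nil; rewrite Rintegral_cst// mul0r.
rewrite big_cons -IH -ExD//; last exact: L1_sum.
by apply: eq_Rintegral => w _; rewrite big_cons.
Qed.

Lemma Ex_cst k : Ex (cst k) = k.
Proof.
rewrite /Ex (_ : cst k = fun=> k)//; have := @Rintegral_cst _ _ _ P setT measurableT k.
by move=> ->; rewrite -[RHS]mulr1; congr (_ * _); exact: (congr1 fine (probability_setT P)).
Qed.

Lemma le_Ex f g : L1 f -> L1 g -> (forall w, f w <= g w) -> Ex f <= Ex g.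
Proof. by move=> lf lg fg; apply: le_Rintegral. Qed.

Lemma Ex_ge0 f : (forall w, 0 <= f w) -> 0 <= Ex f.
Proof. by move=> f0; apply: Rintegral_ge0. Qed.

Lemma le_norm_Ex f : L1 f -> `|Ex f| <= Ex (fun w => `|f w|).
Proof. by move=> lf; apply: le_normr_Rintegral. Qed.

Lemma EFin_Ex f : L1 f -> (Ex f)%:E = (\int[P]_w (f w)%:E)%E.
Proof. by move=> lf; rewrite /Ex /Rintegral fineK//; exact: integrable_fin_num. Qed.

Lemma ae_eq_L1 f g : measurable_fun setT g -> {ae P, forall w, f w = g w} -> L1 f -> L1 g.
Proof.
move=> mg fg lf; have mf := L1_meas lf.
move/integrableP: lf => [_ lf]; apply/integrableP; split; first exact/measurable_EFinP.
rewrite (le_lt_trans _ lf)// le_eqVlt; apply/orP; left; apply/eqP.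
apply: ae_eq_integral => //.
- by apply: measurableT_comp => //; exact/measurable_EFinP.
- by apply: measurableT_comp => //; exact/measurable_EFinP.
- by apply: filterS fg => w /= + _ => ->.
Qed.

Lemma ae_eq_Ex f g : measurable_fun setT f -> measurable_fun setT g ->
  {ae P, forall w, f w = g w} -> Ex f = Ex g.
Proof.
move=> mf mg fg; congr fine; apply: ae_eq_integral => //; [exact/measurable_EFinP..|].
by apply: filterS fg => w /= + _ => ->.
Qed.

Lemma Ex_eq0_ae f : L1 f -> (forall w, 0 <= f w) -> Ex f = 0 -> {ae P, forall w, f w = 0}.
Proof.
move=> lf f0 e0.
have : (\int[P]_w `|(EFin \o f) w| = 0)%E.
  rewrite -[RHS]/(0%:E) -e0 EFin_Ex//; apply: eq_integral => w _ /=.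
  by rewrite ger0_norm.
move=> /ae_eq_integral_abs; move=> /(_ measurableT).
have mf : measurable_fun setT (EFin \o f) by apply/measurable_EFinP; exact: L1_meas.
move=> /(_ mf); apply: filterS => w /= /(_ I) [].
by [].
Qed.

Lemma L2_meas f : L2 f -> measurable_fun setT f. Proof. by case. Qed.

Lemma L2P f : f \in Lfun P 2%:E <-> L2 f.
Proof.
split=> [fL|[mf lf]].
  split; last exact: Lfun2_integrable_sqr.
  by move: fL; rewrite inE => /andP[/[!inE]].
rewrite inE; apply/andP; split; rewrite inE//= /finite_norm unlock.
apply: poweR_lty; move/integrableP: lf => [_]; apply: le_lt_trans.
rewrite le_eqVlt; apply/orP; left; apply/eqP; apply: eq_integral => w _ /=.
by rewrite powR_mulrn// normrX.
Qed.

Lemma L2_mul f g : L2 f -> L2 g -> L1 (fun w => f w * g w).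
Proof.
move=> [mf lf] [mg lg]; apply: (@L1_le (fun w => f w ^+ 2 + g w ^+ 2)).
- exact: measurable_funM.
- move=> w; have := sqr_ge0 (`|f w| - `|g w|).
  rewrite sqrrB !real_normK ?num_real// normrM.
  have := mulr_ge0 (normr_ge0 (f w)) (normr_ge0 (g w)); lra.
- exact: L1D.
Qed.

Lemma L2D f g : L2 f -> L2 g -> L2 (fun w => f w + g w).
Proof.
move=> lf lg; split; first by apply: measurable_funD; exact: L2_meas.
have := L1D (L1D lf.2 lg.2) (L1Z 2 (L2_mul lf lg)).
by apply: eq_integrable => // w _; congr EFin; rewrite sqrrD; ring.
Qed.

Lemma L2Z k f : L2 f -> L2 (fun w => k * f w).
Proof.
move=> [mf lf]; split; first exact: measurable_funM.
by have := L1Z (k ^+ 2) lf; apply: eq_integrable => // w _ /=; rewrite exprMn.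
Qed.

Lemma L2N f : L2 f -> L2 (fun w => - f w).
Proof. by move=> /(L2Z (- 1)); under [X in L2 X]eq_fun do rewrite mulN1r. Qed.

Lemma L2B f g : L2 f -> L2 g -> L2 (fun w => f w - g w).
Proof. by move=> lf /L2N; exact: L2D. Qed.

Lemma L2_cst k : L2 (cst k). Proof. by split; [exact: measurable_cst|exact: (L1_cst (k ^+ 2))]. Qed.

Lemma L2_L1 f : L2 f -> L1 f.
Proof.
by move=> /L2_mul /(_ (L2_cst 1)); under [X in L1 X]eq_fun do rewrite mulr1.
Qed.

Lemma L2_bounded f k : measurable_fun setT f -> (forall w, `|f w| <= k) -> L2 f.
Proof.
move=> mf fk; split => //; apply: (@L1_le (cst (k ^+ 2))).
- exact: measurable_funX.
- by move=> w; rewrite normrX lerXn2r ?nnegrE// (le_trans _ (fk w)).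
- exact: L1_cst.
Qed.

Lemma L2_sum I (r : seq I) (p : pred I) (f : I -> T -> R) : (forall i, L2 (f i)) ->
  L2 (fun w => \sum_(i <- r | p i) f i w).
Proof.
move=> lf; elim: r => [|i r IH].
  by under [X in L2 X]eq_fun do rewrite big_nil; exact: L2_cst.
under [X in L2 X]eq_fun do rewrite big_cons; case: (p i) => //; exact: L2D.
Qed.

Lemma ae_eq_L2 f g : measurable_fun setT g -> {ae P, forall w, f w = g w} -> L2 f -> L2 g.
Proof.
move=> mg fg [mf lf]; split => //; apply: ae_eq_L1 lf; first exact: measurable_funX.
by apply: filterS fg => w ->.
Qed.

Lemma normr_indic_le1 (A : set T) w : `|\1_A w : R| <= 1.
Proof. by rewrite indicE; case: (_ \in _); rewrite ?normr1 ?normr0. Qed.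

Lemma L2_indic A : measurable A -> L2 (\1_A).
Proof.
move=> mA; apply: (@L2_bounded _ 1); first exact: measurable_indic.
by move=> w; exact: normr_indic_le1.
Qed.

Lemma L1_mul_bounded k f g : measurable_fun setT f -> (forall w, `|f w| <= k) -> L1 g ->
  L1 (fun w => f w * g w).
Proof.
move=> mf fk lg; apply: (@L1_le (fun w => k * `|g w|)).
- by apply: measurable_funM => //; exact: L1_meas.
- by move=> w; rewrite normrM ler_wpM2r.
- by apply: L1Z; exact: L1_norm.
Qed.

Lemma L2_mul_bounded k f g : measurable_fun setT f -> (forall w, `|f w| <= k) -> L2 g ->
  L2 (fun w => f w * g w).
Proof.
move=> mf fk [mg lg]; split; first exact: measurable_funM.
under [X in L1 X]eq_fun do rewrite exprMn.
apply: (@L1_mul_bounded (k ^+ 2)) => //; first exact: measurable_funX.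
by move=> w; rewrite normrX lerXn2r ?nnegrE// (le_trans _ (fk w)).
Qed.

Lemma L1_mul_indic A f : measurable A -> L1 f -> L1 (fun w => f w * \1_A w).
Proof.
move=> mA lf; apply: (@L1_le (fun w => `|f w|)).
- by apply: measurable_funM; [exact: L1_meas|exact: measurable_indic].
- by move=> w; rewrite normrM ler_piMr// normr_indic_le1.
- exact: L1_norm.
Qed.

Lemma integral_Ex (B : set T) f : measurable B -> L1 f ->
  (\int[P]_(w in B) (f w)%:E)%E = (Ex (fun w => f w * \1_B w))%:E.
Proof.
move=> mB lf; rewrite EFin_Ex.
  rewrite integral_mkcond; apply: eq_integral => w _.
  by rewrite patchE indicE; case: ifP => _; rewrite ?mulr1 ?mulr0.
exact: L1_mul_indic.
Qed.

Lemma Ex_indic A : measurable A -> Ex (\1_A) = fine (P A).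
Proof. by move=> mA; rewrite /Ex /Rintegral integral_indic// setIT. Qed.

End square_integrable.

Lemma measurable_sg (R : realType) : measurable_fun setT (fun x : R => Num.sg x).
Proof.
have -> : (fun x : R => Num.sg x) = (fun x => \1_`]0, +oo[ x - \1_`]-oo, 0[ x).
  apply/funext => x; rewrite !indicE !mem_setE !in_itv/= andbT.
  case: (ltrgtP x 0) => [x0|x0|->]; last by rewrite sgr0 subr0.
  - by rewrite ltr0_sg//= sub0r.
  - by rewrite gtr0_sg//= subr0.
by apply: measurable_funB; apply: measurable_indic.
Qed.

(** * Conditional expectations *)

Section conditional_expectation.
Context d (T : measurableType d) (R : realType) (P : probability T R).
Variable G : set (set T).
Hypothesis sG : sigma_algebra setT G.
Hypothesis Gm : G `<=` measurable.
Implicit Types f g : T -> R.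

Definition adapted f : Prop := forall B : set R, measurable B -> G (f @^-1` B).

(** A second measurable structure on the same set: [G] is already a sigma-algebra, so measurability
    on [TG] is measurability for [G], and the identity [idG] carries [P] to its restriction. *)
Let TG := g_sigma_algebraType G.

Let measG (B : set T) : (measurable : set (set TG)) B <-> G B.
Proof. by change (<<s G >> B <-> G B); rewrite sigma_algebra_id. Qed.

Lemma adaptedP f : adapted f <-> measurable_fun setT (f : TG -> R).
Proof.
split=> [af _ B mB|mf B mB]; first by rewrite setTI; apply/measG; exact: af.
by apply/measG; rewrite -[_ @^-1` _]setTI; exact: mf.
Qed.

Lemma adapted_meas f : adapted f -> measurable_fun setT f.
Proof. by move=> af _ B mB; rewrite setTI; apply: Gm; exact: af. Qed.

Let idG : T -> TG := id.

Let midG : measurable_fun setT idG.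
Proof. by move=> _ B /measG GB; rewrite setTI; exact: Gm. Qed.

HB.instance Definition _ := isMeasurableFun.Build _ _ T TG idG midG.

Import HBNNSimple.

(** Simple functions on [TG] increase to [u]; for them the claim follows by linearity, and dominated
    convergence with the bound |K u| gives the limit. *)
Let ortho_ge0 (K u : T -> R) : L1 P K -> (forall B, G B -> Ex P (fun w => K w * \1_B w) = 0) ->
  adapted u -> (forall w, 0 <= u w) -> L1 P (fun w => K w * u w) -> Ex P (fun w => K w * u w) = 0.
Proof.
move=> lK K0 au u0 lKu.
have mu : measurable_fun setT (EFin \o u : TG -> \bar R).
  by apply/measurable_EFinP/adaptedP.
pose h := nnsfun_approx measurableT mu.
have hu x n : h n x <= u x.
  by rewrite -lee_fin nnsfun_approxE; apply: (le_approx n (f := EFin \o u)) => // y _; rewrite lee_fin.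
have hcvg x : (fun n => (h n x)%:E) @ \oo --> (u x)%:E.
  have h0 (y : TG) : setT y -> (0 <= (EFin \o u) y)%E by rewrite /= lee_fin.
  exact: (cvg_nnsfun_approx measurableT mu h0 (x := x) Logic.I).
have mh n : measurable_fun setT (h n : T -> R).
  by apply: adapted_meas; apply/adaptedP.
have h0 n : Ex P (fun w => K w * h n w) = 0.
  have E w : K w * h n w = \sum_(y <- fset_set (range (h n))) y * (K w * \1_(h n @^-1` [set y]) w).
    rewrite [in LHS](fimfunE (h n)) fsbig_finite//= mulr_sumr.
    by apply: eq_bigr => y _; rewrite mulrCA.
  rewrite (funext E).
  have G1 y : G (h n @^-1` [set y]) by apply/measG; exact: measurable_sfunP.
  have l1 y : L1 P (fun w => K w * \1_(h n @^-1` [set y]) w).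
    by apply: L1_mul_indic => //; exact: Gm.
  have -> := @Ex_sum _ _ _ P _ (fset_set (range (h n)))
    (fun y w => y * (K w * \1_(h n @^-1` [set y]) w)).
    by rewrite big1// => y _; rewrite ExZ// K0// mulr0.
  by move=> y; exact: L1Z.
have [] := @dominated_convergence _ _ _ P setT measurableT
  (fun n w => (K w * h n w)%:E) (fun w => (K w * u w)%:E) (fun w => `|K w * u w|%:E).
- by move=> n; apply/measurable_EFinP/measurable_funM => //; exact: L1_meas lK.
- by apply/measurable_EFinP; exact: L1_meas lKu.
- apply: aeW => w _; under eq_fun do rewrite EFinM; rewrite EFinM.
  by apply: cvgeZl => //; exact: hcvg.
- exact: L1_norm.
- apply: aeW => w n _; rewrite /= lee_fin !normrM ler_wpM2l//.
  by rewrite !ger0_norm ?hu ?u0.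
move=> _ _; rewrite /= (_ : (fun n => _) = cst 0%E); last first.
  apply/funext => n; rewrite /= -EFin_Ex ?h0//.
  apply: (@L1_le _ _ _ _ (fun w => `|K w * u w|)); last exact: L1_norm.
  - by apply: measurable_funM => //; exact: L1_meas lK.
  - by move=> w; rewrite !normrM ler_wpM2l// !ger0_norm ?hu ?u0.
rewrite -EFin_Ex// => /cvg_lim; rewrite lim_cst// => /(_ (@ereal_hausdorff _)).
by case.
Qed.

Lemma adapted_ortho (K H : T -> R) : L1 P K ->
  (forall B, G B -> Ex P (fun w => K w * \1_B w) = 0) ->
  adapted H -> L1 P (fun w => K w * H w) -> Ex P (fun w => K w * H w) = 0.
Proof.
move=> lK K0 aH lKH; have mH := adapted_meas aH.
have part (u : T -> R) : adapted u -> (forall w, 0 <= u w) -> (forall w, u w <= `|H w|) ->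
    L1 P (fun w => K w * u w).
  move=> au u0 uH; apply: (@L1_le _ _ _ _ (fun w => `|K w * H w|)); last exact: L1_norm.
  - by apply: measurable_funM; [exact: L1_meas lK|exact: adapted_meas].
  - by move=> w; rewrite !normrM ler_wpM2l// ger0_norm.
pose p w := Num.max (H w) 0; pose n w := Num.max (- H w) 0.
have ap : adapted p.
  apply/adaptedP; apply: measurable_maxr => //; exact/adaptedP.
have an : adapted n.
  apply/adaptedP; apply: measurable_maxr => //; apply: measurableT_comp => //; exact/adaptedP.
have p0 w : 0 <= p w by rewrite /p le_max lexx orbT.
have n0 w : 0 <= n w by rewrite /n le_max lexx orbT.
have lp : L1 P (fun w => K w * p w).
  by apply: part => // w; rewrite /p ge_max ler_norm normr_ge0.
have ln : L1 P (fun w => K w * n w).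
  by apply: part => // w; rewrite /n ge_max normr_ge0 andbT -normrN ler_norm.
have -> : (fun w => K w * H w) = (fun w => K w * p w - K w * n w).
  apply/funext => w; rewrite -mulrBr; congr (_ * _); rewrite /p /n.
  by case: (leP (H w) 0); case: (leP (- H w) 0); lra.
by rewrite ExB// !ortho_ge0// subr0.
Qed.

Let PG := distribution P idG.

(** The conditional expectation is the derivative, on the smaller sigma-algebra, of the charge with
    density [f] with respect to the restriction of [P]. *)
Lemma condexp_exists f : L1 P f -> exists Y, is_condexp P G f Y.
Proof.
move=> lf.
pose nu := pushforward (induced_charge lf) idG.
have dom : nu `<< PG.
  apply/null_content_dominatesP => A mA; rewrite /PG /distribution /pushforward => PA.
  apply: null_set_integral => //; first exact: Gm (proj1 (measG A) mA).
  by apply: measurable_funTS; apply/measurable_EFinP; exact: L1_meas lf.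
pose Y0 := Radon_Nikodym nu PG; pose Y := Y0 midG.
have Yi : PG.-integrable setT Y by exact: Radon_Nikodym_integrable.
have Yfin w : Y w \is a fin_num by exact: Radon_Nikodym_fin_num.
have YP : P.-integrable setT (EFin \o (fine \o Y)).
  move/integrableP: Yi => [mY Yi]; apply/integrableP; split.
    apply/measurable_EFinP/adapted_meas/adaptedP.
    exact: measurableT_comp.
  move: Yi; rewrite ge0_integral_distribution//; last exact: measurableT_comp.
  apply: le_lt_trans; rewrite le_eqVlt; apply/orP; left; apply/eqP.
  by apply: eq_integral => w _ /=; rewrite -{2}(fineK (Yfin w)).
exists (fine \o Y); split => //.
  apply/adaptedP; apply: measurableT_comp => //.
  by move/integrableP: Yi => [].
move=> B GB; have mB : measurable (B : set TG) by exact/measG.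
have E : (nu B = \int[PG]_(w in B) Y w)%E.
  by apply: Radon_Nikodym_integral => //; exact: dom.
rewrite -[RHS]/(nu B) E integral_pushforward//.
- by apply: eq_integral => w _ /=; rewrite fineK.
- by move/integrableP: Yi => [].
- apply: (@integrableS _ _ _ _ setT) => //; first exact: Gm.
  by apply: eq_integrable YP => // w _ /=; rewrite fineK.
Qed.

Lemma condexpP f : L1 P f -> is_condexp P G f (condexp P G f).
Proof.
move=> /condexp_exists[Y YP].
exact: (@xgetPex _ (cst 0) [set Y | is_condexp P G f Y] (ex_intro _ Y YP)).
Qed.

Lemma is_condexp_L1 f Y : is_condexp P G f Y -> L1 P Y. Proof. by case. Qed.

Lemma is_condexp_adapted f Y : is_condexp P G f Y -> adapted Y. Proof. by case. Qed.

Lemma is_condexp_Ex f Y B : L1 P f -> is_condexp P G f Y -> G B ->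
  Ex P (fun w => Y w * \1_B w) = Ex P (fun w => f w * \1_B w).
Proof.
move=> lf [_ lY /(_ B) E] GB; have := E GB.
by rewrite !integral_Ex//; [case|exact: Gm..].
Qed.

Lemma is_condexpP f Y : L1 P f -> L1 P Y -> adapted Y ->
  (forall B, G B -> Ex P (fun w => Y w * \1_B w) = Ex P (fun w => f w * \1_B w)) ->
  is_condexp P G f Y.
Proof.
by move=> lf lY aY E; split => // B GB; rewrite !integral_Ex//; [congr EFin; exact: E|exact: Gm..].
Qed.

Lemma condexp_pullout f Y H : L1 P f -> is_condexp P G f Y -> adapted H ->
  L1 P (fun w => f w * H w) -> L1 P (fun w => Y w * H w) ->
  Ex P (fun w => Y w * H w) = Ex P (fun w => f w * H w).
Proof.
move=> lf fY aH lfH lYH; have lY := is_condexp_L1 fY.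
apply/eqP; rewrite -subr_eq0 -ExB//.
under [X in Ex P X]eq_fun do rewrite -mulrBl.
apply/eqP; apply: (@adapted_ortho (fun w => Y w - f w)) => //.
- exact: L1B.
- move=> B GB; under [X in Ex P X]eq_fun do rewrite mulrBl.
  have l1 (k : T -> R) : L1 P k -> L1 P (fun w => k w * \1_B w).
    by move=> lk; apply: L1_mul_indic => //; exact: Gm.
  rewrite ExB; [|exact: l1..]; apply/eqP; rewrite subr_eq0; apply/eqP.
  exact: is_condexp_Ex.
- by have := L1B lYH lfH; under [X in L1 P X]eq_fun do rewrite -mulrBl.
Qed.

Lemma adaptedB f g : adapted f -> adapted g -> adapted (fun w => f w - g w).
Proof. by move=> /adaptedP af /adaptedP ag; apply/adaptedP; exact: measurable_funB. Qed.

Lemma adaptedM f g : adapted f -> adapted g -> adapted (fun w => f w * g w).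
Proof. by move=> /adaptedP af /adaptedP ag; apply/adaptedP; exact: measurable_funM. Qed.

Lemma adapted_indic B : G B -> adapted (\1_B).
Proof. by move=> /measG mB; apply/adaptedP; exact: measurable_indic. Qed.

Lemma adapted_comp (h : R -> R) f : measurable_fun setT h -> adapted f -> adapted (h \o f).
Proof. by move=> mh /adaptedP af; apply/adaptedP; exact: measurableT_comp. Qed.

(** Testing against the sign of Y - Y', which is bounded and adapted, gives E|Y - Y'| = 0. Allowing
    [f] and [g] to differ on a null set is what makes chosen representatives usable. *)
Lemma condexp_ae_unique f g Y Y' : L1 P f -> L1 P g -> {ae P, forall w, f w = g w} ->
  is_condexp P G f Y -> is_condexp P G g Y' -> {ae P, forall w, Y w = Y' w}.
Proof.
move=> lf lg fg fY gY'.
have lY := is_condexp_L1 fY; have lY' := is_condexp_L1 gY'.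
have aY := is_condexp_adapted fY; have aY' := is_condexp_adapted gY'.
pose D w := Y w - Y' w; pose s w := Num.sg (D w).
have aD : adapted D by exact: adaptedB.
have as_ : adapted s by apply: adapted_comp aD; exact: measurable_sg.
have sb w : `|s w| <= 1 by rewrite /s normr_sg; case: (_ != 0).
have mss := adapted_meas as_.
have l1 (k : T -> R) : L1 P k -> L1 P (fun w => k w * s w).
  move=> lk; under [X in L1 P X]eq_fun do rewrite mulrC.
  exact: (@L1_mul_bounded _ _ _ _ 1).
have lD : L1 P (fun w => `|D w|) by apply: L1_norm; exact: L1B.
have : Ex P (fun w => `|D w|) = 0.
  have -> : (fun w => `|D w|) = (fun w => Y w * s w - Y' w * s w).
    by apply/funext => w; rewrite -mulrBl mulrC -normrEsg.
  rewrite ExB; [|exact: l1..]; apply/eqP; rewrite subr_eq0; apply/eqP.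
  apply: (etrans (condexp_pullout lf fY as_ (l1 _ lf) (l1 _ lY))).
  apply: (etrans _ (esym (condexp_pullout lg gY' as_ (l1 _ lg) (l1 _ lY')))).
  apply: ae_eq_Ex.
  - exact: L1_meas (l1 _ lf).
  - exact: L1_meas (l1 _ lg).
  - by apply: filterS fg => w ->.
move=> /(Ex_eq0_ae lD) => /(_ (fun w => normr_ge0 _)).
by apply: filterS => w /eqP; rewrite normr_eq0 subr_eq0 => /eqP.
Qed.

(** Square integrability of [Y] is not known in advance, so [Y] is truncated on the adapted sets |Y|
    <= n. Then E Yn^2 = E[f Yn], positivity of E(f - Yn)^2 bounds it by E f^2, and monotone
    convergence removes the truncation. *)
Lemma condexp_L2 f Y : L2 P f -> is_condexp P G f Y ->
  L2 P Y /\ Ex P (fun w => Y w ^+ 2) <= Ex P (fun w => f w ^+ 2).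
Proof.
move=> l2f fY; have lf := L2_L1 l2f; have aY := is_condexp_adapted fY.
have lY := is_condexp_L1 fY; have mY := adapted_meas aY.
pose B n : set T := [set w | `|Y w| <= n%:R].
have GB n : G (B n).
  have -> : B n = (fun w => `|Y w|) @^-1` `]-oo, n%:R].
    by apply/seteqP; split => w; rewrite /B/= in_itv.
  by apply: (adapted_comp (h := fun x => `|x|)) => //.
pose Yn n w := Y w * \1_(B n) w.
have aYn n : adapted (Yn n) by apply: adaptedM => //; exact: adapted_indic.
have Ynb n w : `|Yn n w| <= n%:R.
  rewrite /Yn indicE; have [Bw|_] := boolP (w \in B n); rewrite ?mulr0 ?normr0// mulr1.
  by move: Bw; rewrite inE.
have YnE n w : Y w * Yn n w = Yn n w ^+ 2.
  by rewrite /Yn indicE; case: (_ \in _); rewrite ?(mulr1, mulr0, expr0n).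
have l2Yn n : L2 P (Yn n).
  by apply: (@L2_bounded _ _ _ _ _ n%:R) => //; exact: adapted_meas.
have bound n : Ex P (fun w => Yn n w ^+ 2) <= Ex P (fun w => f w ^+ 2).
  have h : Ex P (fun w => Yn n w ^+ 2) = Ex P (fun w => f w * Yn n w).
    under [in LHS]eq_fun do rewrite -YnE.
    apply: (condexp_pullout lf fY) => //; first exact: L2_mul.
    under [X in L1 P X]eq_fun do rewrite YnE.
    by case: (l2Yn n).
  have : 0 <= Ex P (fun w => (f w - Yn n w) ^+ 2) by apply: Ex_ge0 => w; exact: sqr_ge0.
  have -> : (fun w => (f w - Yn n w) ^+ 2) =
      (fun w => f w ^+ 2 - 2 * (f w * Yn n w) + Yn n w ^+ 2).
    by apply/funext => w; ring.
  have i1 : L1 P (fun w => 2 * (f w * Yn n w)) by apply: L1Z; exact: L2_mul.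
  rewrite ExD; [|by apply: L1B => //; case: l2f|by case: (l2Yn n)].
  rewrite ExB//; last by case: l2f.
  have -> : Ex P (fun w => 2 * (f w * Yn n w)) = 2 * Ex P (fun w => f w * Yn n w).
    by apply: ExZ; exact: L2_mul.
  by rewrite -h; lra.
have mY2 : measurable_fun setT (fun w => Y w ^+ 2) by exact: measurable_funX.
have cv : (\int[P]_w (Y w ^+ 2)%:E <= (Ex P (fun w => f w ^+ 2))%:E)%E.
  have -> : (\int[P]_w (Y w ^+ 2)%:E = limn (fun n => \int[P]_w (Yn n w ^+ 2)%:E))%E.
    rewrite -monotone_convergence//.
    - apply: eq_integral => w _; apply/esym/cvg_lim => //.
      apply: cvg_near_cst; exists (Num.bound `|Y w|) => // n /= nb.
      have Bw : w \in B n.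
        rewrite inE /B/= ltW// (lt_le_trans (archi_boundP _))//.
        by rewrite ler_nat.
      by rewrite /Yn indicE Bw mulr1.
    - by move=> n; apply/measurable_EFinP/measurable_funX/L2_meas.
    - by move=> n w _; rewrite lee_fin sqr_ge0.
    - move=> w _ m n mn; rewrite lee_fin /Yn !indicE.
      have [Bw|_] := boolP (w \in B m); last by rewrite mulr0 expr0n sqr_ge0.
      suff -> : w \in B n by [].
      by move: Bw; rewrite !inE /B/= => /le_trans; apply; rewrite ler_nat.
  apply: lime_le.
    apply: ereal_nondecreasing_is_cvgn => m n mn; apply: ge0_le_integral => //.
    - by move=> w _; rewrite lee_fin sqr_ge0.
    - by apply/measurable_EFinP/measurable_funX/L2_meas.
    - by apply/measurable_EFinP/measurable_funX/L2_meas.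
    - move=> w _; rewrite lee_fin /Yn !indicE.
      have [Bw|_] := boolP (w \in B m); last by rewrite mulr0 expr0n sqr_ge0.
      suff -> : w \in B n by [].
      by move: Bw; rewrite !inE /B/= => /le_trans; apply; rewrite ler_nat.
  by apply: nearW => n; rewrite -EFin_Ex ?lee_fin ?bound//; case: (l2Yn n).
have l2Y : L2 P Y.
  split => //; apply/integrableP; split; first exact/measurable_EFinP.
  under eq_integral do rewrite /= ger0_norm ?sqr_ge0//.
  by rewrite (le_lt_trans cv)// ltry.
by split => //; rewrite -lee_fin EFin_Ex; case: l2Y.
Qed.

Lemma condexp_proj f Y H : L2 P f -> is_condexp P G f Y -> L2 P H -> adapted H ->
  Ex P (fun w => Y w * H w) = Ex P (fun w => f w * H w).
Proof.
move=> l2f fY l2H aH; have [l2Y _] := condexp_L2 l2f fY.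
by apply: (condexp_pullout (L2_L1 l2f) fY) => //; exact: L2_mul.
Qed.

End conditional_expectation.

(** * The Hilbert space of square integrable classes *)

Section L2space.
Context d (T : measurableType d) (R : realType) (P : probability T R).
Implicit Types f g : T -> R.

(** The choice is made from a set that depends only on the almost sure class of [f], so almost
    surely equal functions receive the same representative. *)
Definition l2_canon f : T -> R :=
  xget (cst 0) [set g | L2 P g /\ {ae P, forall w, g w = f w}].

Lemma l2_canonP f : L2 P f -> L2 P (l2_canon f) /\ {ae P, forall w, l2_canon f w = f w}.
Proof.
move=> lf; apply: (@xgetPex _ (cst 0) [set g | L2 P g /\ {ae P, forall w, g w = f w}]).
by exists f; split => //; exact: aeW.
Qed.

Lemma l2_canon_eq f g : {ae P, forall w, f w = g w} -> l2_canon f = l2_canon g.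
Proof.
move=> fg; rewrite /l2_canon; congr xget; apply/seteqP; split => k [lk kf]; split => //.
  by apply: filterS2 kf fg => w -> ->.
by apply: filterS2 kf fg => w -> ->.
Qed.

(* Square integrable functions modulo almost sure equality, each class being
   replaced by a chosen representative. *)
Record L2space := L2Mk {
  l2fun :> T -> R;
  l2funP : L2 P l2fun /\ l2_canon l2fun = l2fun }.

HB.instance Definition _ := gen_eqMixin L2space.
HB.instance Definition _ := gen_choiceMixin L2space.

Lemma l2_canon_proof f : L2 P f -> L2 P (l2_canon f) /\ l2_canon (l2_canon f) = l2_canon f.
Proof.
by move=> /l2_canonP[lf fE]; split => //; exact: l2_canon_eq.
Qed.

(** Made total by sending functions that are not square integrable to the class of 0. *)
Definition l2cls f : L2space :=
  match pselect (L2 P f) with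
  | left lf => L2Mk (l2_canon_proof lf)
  | right _ => L2Mk (l2_canon_proof (L2_cst P 0))
  end.

Lemma l2clsK f : L2 P f -> {ae P, forall w, l2cls f w = f w}.
Proof.
by move=> lf; rewrite /l2cls; case: pselect => // lf'; case: (l2_canonP lf).
Qed.

Lemma l2fun_inj (x y : L2space) : (x : T -> R) = y -> x = y.
Proof.
case: x y => f fP [g gP] /= fg; case: _ / fg gP => gP.
by congr L2Mk; exact: Prop_irrelevance.
Qed.

Lemma l2cls_eq f g : L2 P f -> L2 P g -> {ae P, forall w, f w = g w} -> l2cls f = l2cls g.
Proof.
move=> lf lg fg; apply: l2fun_inj; rewrite /l2cls.
by case: pselect => // lf'; case: pselect => // lg' /=; exact: l2_canon_eq.
Qed.

Lemma l2val (x : L2space) : L2 P x. Proof. by case: (l2funP x). Qed.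

Lemma l2clsV (x : L2space) : l2cls x = x.
Proof.
by apply: l2fun_inj; rewrite /l2cls; case: pselect => [lx|] /=; case: (l2funP x).
Qed.

Let add (x y : L2space) := l2cls (fun w => x w + y w).
Let opp (x : L2space) := l2cls (fun w => - x w).
Let scale (k : R) (x : L2space) := l2cls (fun w => k * x w).

Let lD (x y : L2space) := L2D (l2val x) (l2val y).

Let addA : associative add.
Proof.
move=> x y z; apply: l2cls_eq; [exact: L2D (l2val _) (l2val _)..|].
by apply: filterS2 (l2clsK (lD y z)) (l2clsK (lD x y)) => w -> ->; rewrite addrA.
Qed.

Let addC : commutative add.
Proof. by move=> x y; congr l2cls; apply/funext => w; rewrite addrC. Qed.

Let add0 : left_id (l2cls (cst 0)) add.
Proof.
move=> x; rewrite -[RHS]l2clsV; apply: l2cls_eq; [exact: L2D (l2val _) (l2val _)|exact: l2val|].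
by apply: filterS (l2clsK (L2_cst P 0)) => w ->; rewrite add0r.
Qed.

Let addN : left_inverse (l2cls (cst 0)) opp add.
Proof.
move=> x; apply: l2cls_eq; [exact: L2D (l2val _) (l2val _)|exact: L2_cst|].
by apply: filterS (l2clsK (L2N (l2val x))) => w ->; rewrite addNr.
Qed.

HB.instance Definition _ := GRing.isZmodule.Build L2space addA addC add0 addN.

Let scaleA k l x : scale k (scale l x) = scale (k * l) x.
Proof.
apply: l2cls_eq; [exact: L2Z (l2val _)..|].
by apply: filterS (l2clsK (L2Z l (l2val x))) => w ->; rewrite mulrA.
Qed.

Let scale1 : left_id 1 scale.
Proof.
by move=> x; rewrite -[RHS]l2clsV; congr l2cls; apply/funext => w; rewrite mul1r.
Qed.

Let scaleDr : right_distributive scale +%R.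
Proof.
move=> k x y; apply: l2cls_eq; [exact: L2Z (l2val _)|exact: L2D (l2val _) (l2val _)|].
apply: filterS3 (l2clsK (lD x y)) (l2clsK (L2Z k (l2val x))) (l2clsK (L2Z k (l2val y))).
by move=> w e1 e2 e3; rewrite e2 e3 -mulrDr -e1.
Qed.

Let scaleDl x : {morph scale^~ x : k l / k + l}.
Proof.
move=> k l; apply: l2cls_eq; [exact: L2Z (l2val _)|exact: L2D (l2val _) (l2val _)|].
apply: filterS2 (l2clsK (L2Z k (l2val x))) (l2clsK (L2Z l (l2val x))) => w -> ->.
by rewrite mulrDl.
Qed.

HB.instance Definition _ := GRing.Zmodule_isLmodule.Build R L2space scaleA scale1 scaleDr scaleDl.

Lemma l2clsD f g : L2 P f -> L2 P g -> l2cls f + l2cls g = l2cls (fun w => f w + g w).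
Proof.
move=> lf lg; apply: l2cls_eq; [exact: L2D (l2val _) (l2val _)|exact: L2D|].
by apply: filterS2 (l2clsK lf) (l2clsK lg) => w -> ->.
Qed.

Lemma l2clsZ k f : L2 P f -> k *: l2cls f = l2cls (fun w => k * f w).
Proof.
move=> lf; apply: l2cls_eq; [exact: L2Z (l2val _)|exact: L2Z|].
by apply: filterS (l2clsK lf) => w ->.
Qed.

Lemma l2cls0 : l2cls (cst 0) = 0. Proof. by []. Qed.

Lemma l2clsN f : L2 P f -> - l2cls f = l2cls (fun w => - f w).
Proof.
move=> lf; apply: l2cls_eq; [exact: L2N (l2val _)|exact: L2N|].
by apply: filterS (l2clsK lf) => w ->.
Qed.

Lemma l2clsB f g : L2 P f -> L2 P g -> l2cls f - l2cls g = l2cls (fun w => f w - g w).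
Proof. by move=> lf lg; rewrite l2clsN// l2clsD//; exact: L2N. Qed.

Lemma l2cls_sum I (r : seq I) (p : pred I) (f : I -> T -> R) : (forall i, L2 P (f i)) ->
  \sum_(i <- r | p i) l2cls (f i) = l2cls (fun w => \sum_(i <- r | p i) f i w).
Proof.
move=> lf; elim: r => [|i r IH].
  by rewrite big_nil; congr l2cls; apply/funext => w; rewrite big_nil.
rewrite big_cons IH; under [in RHS]eq_fun do rewrite big_cons.
by case: (p i) => //; rewrite l2clsD//; exact: L2_sum.
Qed.

Definition l2ip (x y : L2space) : R := Ex P (fun w => x w * y w).

Lemma ae_Ex_mul f f' g g' : L2 P f -> L2 P f' -> L2 P g -> L2 P g' ->
  {ae P, forall w, f w = f' w} -> {ae P, forall w, g w = g' w} ->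
  Ex P (fun w => f w * g w) = Ex P (fun w => f' w * g' w).
Proof.
move=> lf lf' lg lg' ff' gg'; apply: ae_eq_Ex.
- exact: measurable_funM (L2_meas lf) (L2_meas lg).
- exact: measurable_funM (L2_meas lf') (L2_meas lg').
- by apply: filterS2 ff' gg' => w -> ->.
Qed.

Lemma l2ip_cls f g : L2 P f -> L2 P g -> l2ip (l2cls f) (l2cls g) = Ex P (fun w => f w * g w).
Proof. by move=> lf lg; apply: ae_Ex_mul => //; [exact: l2val..|exact: l2clsK|exact: l2clsK]. Qed.

Lemma l2ipP : inner_product l2ip.
Proof.
split.
- by move=> x y; congr Ex; apply/funext => w; rewrite mulrC.
- move=> k x y z; rewrite -(l2clsV x) -(l2clsV y) -(l2clsV z).
  have lx := l2val x; have ly := l2val y; have lz := l2val z.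
  rewrite l2clsZ// l2clsD//; last exact: L2Z.
  rewrite !l2ip_cls//; last by apply: L2D => //; exact: L2Z.
  rewrite -ExZ; last exact: L2_mul.
  rewrite -ExD; [|by apply: L1Z; exact: L2_mul|exact: L2_mul].
  by congr Ex; apply/funext => w; ring.
- by move=> x; apply: Ex_ge0 => w; rewrite -expr2 sqr_ge0.
- move=> x x0; rewrite -[x]l2clsV -l2cls0; apply: l2cls_eq; [exact: l2val|exact: L2_cst|].
  have l1 : L1 P (fun w => x w * x w) by apply: L2_mul; exact: l2val.
  have x2 w : 0 <= x w * x w by rewrite -expr2 sqr_ge0.
  have h := Ex_eq0_ae l1 x2 x0.
  by apply: filterS h => w /eqP; rewrite mulf_eq0 orbb => /eqP.
Qed.

Local Notation nrm := (nrm l2ip).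

Lemma nrm_l2cls f : L2 P f -> nrm (l2cls f) = Num.sqrt (Ex P (fun w => f w ^+ 2)).
Proof. by move=> lf; congr Num.sqrt; rewrite l2ip_cls. Qed.

Lemma nrm_l2B (x y : L2space) : nrm (x - y) = Num.sqrt (Ex P (fun w => (x w - y w) ^+ 2)).
Proof.
rewrite -{1}(l2clsV x) -{1}(l2clsV y) l2clsB ?nrm_l2cls//; [|exact: l2val..].
exact: L2B (l2val _) (l2val _).
Qed.

Lemma Ex_norm_le_sqrt f : L2 P f -> Ex P (fun w => `|f w|) <= Num.sqrt (Ex P (fun w => f w ^+ 2)).
Proof.
move=> lf; have ln : L2 P (fun w => `|f w|).
  split; first by apply: measurableT_comp => //; exact: L2_meas lf.
  by under [X in L1 P X]eq_fun do rewrite real_normK ?num_real//; case: lf.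
have := cauchy_schwarz l2ipP (l2cls (fun w => `|f w|)) (l2cls (cst 1)).
rewrite l2ip_cls ?nrm_l2cls//; [|exact: L2_cst..].
under [X in Ex P X]eq_fun do rewrite mulr1.
have -> : Ex P (fun w => cst 1 w ^+ 2) = 1.
  by rewrite -[RHS](Ex_cst P); congr Ex; apply/funext => w; rewrite /= expr1n.
rewrite sqrtr1 mulr1; under [X in Num.sqrt (Ex P X)]eq_fun do rewrite real_normK ?num_real//.
by apply: le_trans; exact: ler_norm.
Qed.

(* Riesz-Fischer: a sequence with summable increments converges almost surely, and
   Fatou's lemma identifies the pointwise limit with the limit in norm. *)
Lemma l2_complete : nrm_complete l2ip.
Proof.
move=> u uC.
have half_gt0 k : 0 < (2^-1 : R) ^+ k by rewrite exprn_gt0 ?invr_gt0.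
have [N HN] := choice (fun k => uC _ (half_gt0 k)).
(* The sum dominates every [N i] with [i <= k], so all [v l] with [l >= k] lie within 2^-k of
   [v k]. *)
pose M k := (\sum_(i < k.+1) N i)%N.
have NM i k : (i <= k)%N -> (N i <= M k)%N.
  by move=> ik; rewrite /M (bigD1 (Ordinal (ik : (i < k.+1)%N)))//= leq_addr.
pose v k := u (M k).
have vC k l : (k <= l)%N -> nrm (v k - v l) <= 2^-1 ^+ k.
  by move=> kl; apply: HN; exact: NM.
pose g k w := `|v k.+1 w - v k w|.
have l2g k : L2 P (fun w => v k.+1 w - v k w) by apply: L2B; exact: l2val.
have mg k : measurable_fun setT (fun w => (g k w)%:E).
  by apply/measurable_EFinP; apply: measurableT_comp => //; exact: L2_meas (l2g k).
have Eg k : (\int[P]_w (g k w)%:E <= ((2^-1 : R) ^+ k)%:E)%E.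
  rewrite -EFin_Ex; last by apply: L1_norm; exact: L2_L1.
  by rewrite lee_fin (le_trans (Ex_norm_le_sqrt (l2g k)))// -nrm_l2B (nrmB l2ipP) vC.
have sumg : (\int[P]_w (\sum_(k <oo) (g k w)%:E) < +oo)%E.
  rewrite integral_nneseries//; last by move=> k w _; rewrite lee_fin normr_ge0.
  apply: (@le_lt_trans _ _ 2%:E); last exact: ltry.
  apply: lime_le.
    by apply: is_cvg_nneseries => k _ _; apply: integral_ge0 => w _; rewrite lee_fin normr_ge0.
  apply: nearW => n; apply: (@le_trans _ _ (\sum_(0 <= k < n) ((2^-1 : R) ^+ k)%:E)%E).
    by apply: lee_sum.
  rewrite sumEFin lee_fin.
  suff -> : \sum_(0 <= k < n) 2^-1 ^+ k = 2 - 2 * (2^-1 : R) ^+ n.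
    by rewrite lerBlDr lerDl mulr_ge0// ltW.
  elim: n => [|n IH]; first by rewrite big_nil expr0; lra.
  by rewrite big_nat_recr//= IH exprS; lra.
have cvv : {ae P, forall w, cvgn (fun k => v k w)}.
  have msum : measurable_fun setT (fun w => \sum_(k <oo) (g k w)%:E)%E.
    by apply: ge0_emeasurable_sum => // k w _ _; rewrite lee_fin normr_ge0.
  have i : P.-integrable setT (fun w => \sum_(k <oo) (g k w)%:E)%E.
    apply/integrableP; split => //; apply: le_lt_trans sumg.
    rewrite le_eqVlt; apply/orP; left; apply/eqP; apply: eq_integral => w _.
    by rewrite gee0_abs// nneseries_ge0// => k _ _; rewrite lee_fin normr_ge0.
  apply: filterS (integrable_ae measurableT i) => w /(_ Logic.I) fw.
  have /normed_cvg : cvgn [normed series (fun k => v k.+1 w - v k w)].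
    apply: nnseries_is_cvg => [k|]; first exact: normr_ge0.
    by rewrite ltey_eq fw.
  have -> : series (fun k => v k.+1 w - v k w) = (fun k => v k w - v 0%N w).
    by apply/funext => k; rewrite /series/= telescope_sumr.
  move=> h; rewrite (_ : (fun k => v k w) = (fun k => (v k w - v 0%N w) + v 0%N w)).
    by apply: is_cvgD => //; exact: is_cvg_cst.
  by apply/funext => k; rewrite subrK.
(* The upper limit is measurable everywhere and agrees with the limit wherever the latter exists. *)
pose l0 w := limn_esup (fun k => (v k w)%:E).
have ml0 : measurable_fun setT l0.
  by apply: measurable_fun_limn_esup => k; apply/measurable_EFinP; exact: L2_meas (l2val _).
pose l w := fine (l0 w).
have ml : measurable_fun setT l by exact: measurableT_comp.
have vl : {ae P, forall w, v k w @[k --> \oo] --> l w}.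
  apply: filterS cvv => w /cvg_ex[/= y vy].
  rewrite (_ : l w = y)// /l /l0.
  have vyE : (v k w)%:E @[k --> \oo] --> y%:E by apply: cvg_EFin => //; exact: nearW.
  by have [_ ->] := cvg_limn_einf_sup vyE.
have bound k : (\int[P]_w ((v k w - l w) ^+ 2)%:E <= ((2^-1 ^+ k) ^+ 2)%:E)%E.
  pose h j w := ((v k w - v j w) ^+ 2)%:E.
  have mh j : measurable_fun setT (h j).
    apply/measurable_EFinP; apply: measurable_funX.
    exact: measurable_funB (L2_meas (l2val _)) (L2_meas (l2val _)).
  have h0 j w : setT w -> (0 <= h j w)%E by move=> _; rewrite lee_fin sqr_ge0.
  have -> : (\int[P]_w ((v k w - l w) ^+ 2)%:E = \int[P]_w limn_einf (h^~ w))%E.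
    apply: ae_eq_integral => //.
    - apply/measurable_EFinP; apply: measurable_funX; apply: measurable_funB => //.
      exact: L2_meas (l2val _).
    - rewrite [X in measurable_fun _ X](_ : _ = fun w => - limn_esup (fun j => - h j w))%E//.
      by apply: measurableT_comp => //; apply: measurable_fun_limn_esup => j; exact: measurableT_comp.
    - apply: filterS vl => w vlw _; apply/esym.
      have : h^~ w @ \oo --> ((v k w - l w) ^+ 2)%:E.
        apply: cvg_EFin; first exact: nearW.
        rewrite (_ : _ \o _ = fun j => (v k w - v j w) * (v k w - v j w)); last first.
          by apply/funext => j /=; rewrite expr2.
        by rewrite expr2; apply: cvgM; apply: cvgB => //; exact: cvg_cst.
      by move=> /cvg_limn_einf_sup[].
  apply: le_trans (fatou P measurableT mh h0) _.
  rewrite limn_einf_lim; apply: lime_le; first exact: is_cvg_einfs.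
  apply: nearW => j; apply: (@le_trans _ _ (\int[P]_w h (maxn j k) w)%E).
    by apply: ereal_inf_lbound; exists (maxn j k) => //=; exact: leq_maxl.
  rewrite -EFin_Ex; last by case: (L2B (l2val (v k)) (l2val (v (maxn j k)))).
  rewrite lee_fin -[leLHS]sqr_sqrtr; last by apply: Ex_ge0 => w; exact: sqr_ge0.
  rewrite ler_sqr ?nnegrE ?sqrtr_ge0 ?(ltW (half_gt0 k))// -nrm_l2B.
  by apply: vC; exact: leq_maxr.
have l2vl k : L2 P (fun w => v k w - l w).
  have mvl : measurable_fun setT (fun w => v k w - l w).
    by apply: measurable_funB => //; exact: L2_meas (l2val _).
  split => //; apply/integrableP; split.
    by apply/measurable_EFinP; exact: measurable_funX.
  under eq_integral do rewrite /= ger0_norm ?sqr_ge0//.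
  by rewrite (le_lt_trans (bound k))// ltry.
have l2l : L2 P l.
  have := L2B (l2val (v 0%N)) (l2vl 0%N).
  by under [X in L2 P X]eq_fun do rewrite opprB addrC subrK.
have vl_le k : nrm (v k - l2cls l) <= 2^-1 ^+ k.
  rewrite -{1}(l2clsV (v k)) l2clsB//; last exact: l2val.
  rewrite nrm_l2cls// -[leRHS]ger0_norm ?(ltW (half_gt0 k))// -sqrtr_sqr.
  rewrite ler_sqrt ?sqr_ge0// -lee_fin EFin_Ex; [exact: bound|].
  by case: (l2vl k).
exists (l2cls l) => e e0.
have [k ke] : exists k, 2^-1 ^+ k <= e / 2 :> R.
  have e2 : 0 < e / 2 by rewrite divr_gt0.
  exists (Num.bound (e / 2)^-1); rewrite -[leRHS]invrK exprVn lef_pV2 ?posrE ?invr_gt0 ?exprn_gt0//.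
  rewrite ltW// (lt_le_trans (archi_boundP _)) ?invr_ge0 ?(ltW e2)//.
  by rewrite -natrX ler_nat ltnW// ltn_expl.
exists (maxn (N k) (M k)) => n; rewrite geq_max => /andP[Nn Mn].
rewrite (le_trans (le_nrmB3 l2ipP _ (v k) _))// [leRHS]splitr lerD//; last first.
  exact: le_trans (vl_le k) ke.
by apply: le_trans ke; apply: HN => //; exact: NM.
Qed.

End L2space.

(** * Transfer along a map with a given law *)

Section law_of_map.
Context d (Omega : measurableType d) d' (S : measurableType d') (R : realType).
Variables (P : probability Omega R) (mu : probability S R) (T : Omega -> S).

(** The map is arbitrary because two kinds of maps are shown to carry [P] to the law of (X, Z): the
    map [joint] and, for each coordinate, the map that resamples it. *)
Definition has_law : Prop :=
  measurable_fun setT T /\ forall B, measurable B -> mu B = P (T @^-1` B).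

Hypothesis lawT : has_law.

Let mT : measurable_fun setT T. Proof. by case: lawT. Qed.

Let integral_law (f : S -> \bar R) : measurable_fun setT f -> (forall x, (0 <= f x)%E) ->
  (\int[mu]_x f x = \int[P]_w f (T w))%E.
Proof.
move=> mf f0; rewrite (eq_measure_integral (pushforward P T)).
  by rewrite ge0_integral_pushforward.
by move=> B mB _; exact: (lawT.2 _ mB).
Qed.

Lemma law_ae (p : S -> Prop) : {ae mu, forall x, p x} -> {ae P, forall w, p (T w)}.
Proof.
move=> [N [mN N0 pN]]; exists (T @^-1` N); split.
- by rewrite -[_ @^-1` _]setTI; exact: mT.
- by case: lawT => _ <-.
- by move=> w /= npw; apply: pN.
Qed.

Lemma law_ae_eq (f g : S -> R) : measurable_fun setT f -> measurable_fun setT g ->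
  {ae P, forall w, f (T w) = g (T w)} -> {ae mu, forall x, f x = g x}.
Proof.
move=> mf mg fg.
pose N := (fun x => f x - g x) @^-1` (~` [set 0]).
have mN : measurable N.
  by rewrite -[N]setTI; apply: measurable_funB => //; exact: measurableC.
exists N; split => //; last by move=> x /= xN e; apply: xN; apply/eqP; rewrite -subr_eq0 e.
case: lawT => _ ->//; case: fg => M [mM M0 sM].
apply: (subset_measure0 _ _ _ M0) => //; first by rewrite -[_ @^-1` _]setTI; exact: mT.
by move=> w /= Nw; apply: sM => /= e; apply: Nw; rewrite /= e subrr.
Qed.

Lemma law_L1 (f : S -> R) : measurable_fun setT f -> L1 mu f <-> L1 P (fun w => f (T w)).
Proof.
move=> mf; split=> /integrableP[m i]; apply/integrableP; split.
- by apply/measurable_EFinP; exact: measurableT_comp.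
- by move: i; rewrite integral_law//; exact: measurableT_comp.
- exact/measurable_EFinP.
- by rewrite integral_law//; apply: measurableT_comp => //; exact/measurable_EFinP.
Qed.

Lemma law_L2 (f : S -> R) : measurable_fun setT f -> L2 mu f <-> L2 P (fun w => f (T w)).
Proof.
move=> mf; have mf2 : measurable_fun setT (fun x => f x ^+ 2) by exact: measurable_funX.
split=> -[_ lf]; split => //; [exact: measurableT_comp|exact: (proj1 (law_L1 mf2))|exact: (proj2 (law_L1 mf2))].
Qed.

Lemma law_Ex (f : S -> R) : measurable_fun setT f ->  L1 mu f -> Ex P (fun w => f (T w)) = Ex mu f.
Proof.
move=> mf lf; apply: EFin_inj; rewrite !EFin_Ex//; last exact: (proj1 (law_L1 mf)).
rewrite (eq_measure_integral (pushforward P T)).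
  rewrite integral_pushforward//; first exact/measurable_EFinP.
  exact: (proj1 (law_L1 mf)).
by move=> B mB _; exact: (lawT.2 _ mB).
Qed.

Lemma law_Ex_indic B (g : S -> R) : measurable B -> L1 mu g ->
  Ex P (fun w => g (T w) * \1_(T @^-1` B) w) = Ex mu (fun x => g x * \1_B x).
Proof.
move=> mB lg; have l1 := L1_mul_indic mB lg.
by rewrite -law_Ex//; exact: L1_meas l1.
Qed.

Lemma law_condexp (G : set (set S)) (G' : set (set Omega)) f Y :
  G `<=` measurable -> G' = preimage_set_system setT T G ->
  L1 mu f -> is_condexp mu G f Y -> is_condexp P G' (fun w => f (T w)) (fun w => Y (T w)).
Proof.
move=> Gm -> lf fY; have lY := is_condexp_L1 fY.
have mf := L1_meas lf; have mY := L1_meas lY.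
apply: is_condexpP => //.
- by move=> _ [B GB <-]; rewrite setTI -[_ @^-1` _]setTI; exact/mT/Gm.
- exact: (proj1 (law_L1 mf)).
- exact: (proj1 (law_L1 mY)).
- move=> B mB; exists (Y @^-1` B); first exact: is_condexp_adapted fY _ mB.
  by rewrite setTI.
- move=> _ [B GB <-]; rewrite setTI.
  by rewrite !law_Ex_indic//; [exact: (is_condexp_Ex Gm lf fY GB)|exact: Gm..].
Qed.

Lemma law_condexpV (G : set (set S)) f Y :
  G `<=` measurable -> L1 mu f -> L1 mu Y -> adapted G Y ->
  is_condexp P (preimage_set_system setT T G) (fun w => f (T w)) (fun w => Y (T w)) ->
  is_condexp mu G f Y.
Proof.
move=> Gm lf lY aY fY; apply: is_condexpP => // B GB.
rewrite -!law_Ex_indic//; try exact: Gm.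
have TGm : preimage_set_system setT T G `<=` measurable.
  by move=> _ [C GC <-]; rewrite setTI -[_ @^-1` _]setTI; exact/mT/Gm.
apply: (is_condexp_Ex TGm _ fY); first exact: (proj1 (law_L1 (L1_meas lf))).
by exists B => //; rewrite setTI.
Qed.

End law_of_map.

(** * The law of (X, Z) *)

Section product_space.
Context d (Omega : measurableType d) (R : realType) (P : probability Omega R).
Context (A : countType) (E : A -> ptopologicalType) (E0 : ptopologicalType).
Variables (X : forall a, {RV P >-> borel (E a)}) (Z : {RV P >-> borel E0}).

Local Notation S := (EAZ E E0).

Definition coordX a (x : S) : borel (E a) := x.1 a.
Definition coordZ (x : S) : borel E0 := x.2.

Lemma measurable_coordX a : measurable_fun setT (@coordX a).
Proof.
by move=> _ B mB; apply: sub_sigma_algebra; left; exists a => //; exists B.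
Qed.

Lemma measurable_coordZ : measurable_fun setT coordZ.
Proof. by move=> _ B mB; apply: sub_sigma_algebra; right; exists B. Qed.

Lemma measurable_to_EAZ (T : Omega -> S) :
  (forall a, measurable_fun setT (fun w => coordX a (T w))) ->
  measurable_fun setT (fun w => coordZ (T w)) -> measurable_fun setT T.
Proof.
move=> mX mZ; apply: (@measurability _ _ Omega S setT T (@coordinate_cylinders A E E0)) => //.
move=> _ [_ [[a _ [B mB <-]]|[B mB <-]] <-]; rewrite !setTI.
  by rewrite -[X in measurable X]setTI; exact: mX.
by rewrite -[X in measurable X]setTI; exact: mZ.
Qed.

Definition joint (w : Omega) : S := (fun a => X a w, Z w).

Lemma measurable_joint : measurable_fun setT joint.
Proof.
apply: measurable_to_EAZ => [a|]; first exact: (measurable_funP (X a)).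
exact: (measurable_funP Z).
Qed.

HB.instance Definition _ := isMeasurableFun.Build _ _ _ _ joint measurable_joint.

Definition joint_law : probability S R := distribution P joint.

Lemma joint_has_law : has_law P joint_law joint.
Proof. by split; first exact: measurable_joint. Qed.

Definition sZ : set (set S) := preimage_set_system setT coordZ measurable.

Definition sG (B : set A) : set (set S) :=
  <<s \bigcup_(b in ~` B) preimage_set_system setT (@coordX b) measurable `|` sZ >>.

Lemma sigma_sG B : sigma_algebra setT (sG B). Proof. exact: smallest_sigma_algebra. Qed.

Lemma sigma_sZ : sigma_algebra setT sZ.
Proof. exact/sigma_algebra_preimage/sigma_algebra_measurable. Qed.

Lemma sG_meas B : sG B `<=` measurable.
Proof.
apply: smallest_sub; first exact: sigma_algebra_measurable.
move=> _ [[b _ [C mC <-]]|[C mC <-]].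
  exact: measurable_coordX.
exact: measurable_coordZ.
Qed.

Lemma sZ_sG B : sZ `<=` sG B.
Proof. by move=> C sC; apply: sub_sigma_algebra; right. Qed.

Lemma sZ_meas : sZ `<=` measurable.
Proof. by apply: subset_trans (@sG_meas set0); exact: sZ_sG. Qed.

Lemma sigma_calG B : sigma_algebra setT (calG X Z B). Proof. exact: smallest_sigma_algebra. Qed.

Lemma sigmaZE : sigmaZ Z = preimage_set_system setT joint sZ.
Proof. exact: (preimage_set_system_comp setT joint coordZ measurable). Qed.

(** The conditioning sigma-algebras on [Omega] are pulled back from the canonical space, so
    conditional expectations can be computed there and composed with [joint]. *)
Lemma calGE B : calG X Z B = preimage_set_system setT joint (sG B).
Proof.
apply: etrans; last exact: g_sigma_preimageE.
rewrite preimage_set_systemU; congr (<<s _ `|` _ >>); last first.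
  exact: (preimage_set_system_comp setT joint coordZ measurable).
rewrite /preimage_set_system image_bigcup; apply: eq_bigcupr => b _.
exact: (preimage_set_system_comp setT joint (@coordX b) measurable).
Qed.

Lemma sG0_measurable : sG set0 = measurable.
Proof. by rewrite /sG setC0. Qed.

Lemma sigma_sigmaZ : sigma_algebra setT (sigmaZ Z).
Proof. exact/sigma_algebra_preimage/sigma_algebra_measurable. Qed.

Lemma sigmaZ_meas : sigmaZ Z `<=` measurable.
Proof. by move=> _ [B mB <-]; exact: measurable_funP. Qed.

Lemma calG_meas B : calG X Z B `<=` measurable.
Proof.
rewrite calGE => _ [C mC <-]; rewrite -[X in measurable X]setTI.
by rewrite setTI; apply: measurable_joint => //; exact: sG_meas mC.
Qed.

End product_space.

Section conditional_expectation_order.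
Context d (T : measurableType d) (R : realType) (P : probability T R) (G : set (set T)).
Hypothesis Gm : G `<=` measurable.

Lemma is_condexp_ae f Y Y' : L1 P f -> is_condexp P G f Y -> L1 P Y' -> adapted G Y' ->
  {ae P, forall w, Y w = Y' w} -> is_condexp P G f Y'.
Proof.
move=> lf fY lY' aY' YY'; apply: is_condexpP => // B GB.
rewrite -(is_condexp_Ex Gm lf fY GB); apply: ae_eq_Ex.
- by apply: measurable_funM; [exact: L1_meas lY'|exact/measurable_indic/Gm].
- apply: measurable_funM; [exact: L1_meas (is_condexp_L1 fY)|exact/measurable_indic/Gm].
- by apply: filterS YY' => w ->.
Qed.

Lemma condexp_ge0 f Y : L1 P f -> (forall w, 0 <= f w) -> is_condexp P G f Y ->
  {ae P, forall w, 0 <= Y w}.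
Proof.
move=> lf f0 fY; have lY := is_condexp_L1 fY.
pose B : set T := Y @^-1` `]-oo, 0[.
have GB : G B by apply: is_condexp_adapted fY _ _ => //; exact: measurable_itv.
have BE w : \1_B w = ((Y w < 0)%R : nat)%:R :> R.
  by rewrite indicE; congr (nat_of_bool _)%:R; apply/idP/idP; rewrite inE /B/= in_itv.
have u0 w : 0 <= - (Y w * \1_B w).
  rewrite BE; case: ltP => [/ltW Y0|_]; first by rewrite mulr1 oppr_ge0.
  by rewrite mulr0 oppr0.
have lu := L1_mul_indic (Gm GB) lY.
have e0 : Ex P (fun w => - (Y w * \1_B w)) = 0.
  apply/eqP; rewrite eq_le Ex_ge0// andbT ExN// (is_condexp_Ex Gm lf fY GB) oppr_le0.
  by apply: Ex_ge0 => w; rewrite mulr_ge0// BE.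
apply: filterS (Ex_eq0_ae (L1N lu) u0 e0) => w.
by rewrite BE; case: ltP => // Y0 /eqP; rewrite mulr1 oppr_eq0 => /eqP Yw; rewrite Yw ltxx in Y0.
Qed.

End conditional_expectation_order.

(** * Conditional probabilities of a coordinate given Z *)

Section kernels.
Context d (Omega : measurableType d) (R : realType) (P : probability Omega R).
Context (A : countType) (E : A -> ptopologicalType) (E0 : ptopologicalType).
Variables (X : forall a, {RV P >-> borel (E a)}) (Z : {RV P >-> borel E0}).
Hypothesis indepX : cond_independent X Z.

Local Notation S := (EAZ E E0).
Local Notation mu := (joint_law X Z).
Local Notation joint := (joint X Z).

(** Formulated for one set [C] at a time. The bounds hold everywhere and not only almost surely, so
    that multiplying a bounded function of Z by a kernel gives a bounded function of Z again. *)
Definition is_kernel a (C : set (borel (E a))) (k : S -> R) : Prop :=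
  [/\ adapted (@sZ A E E0) k, forall x, 0 <= k x <= 1 &
      is_condexp P (sigmaZ Z) (\1_(X a @^-1` C)) (fun w => k (joint w))].

Lemma kernel_exists a C : measurable C -> exists k, @is_kernel a C k.
Proof.
move=> mC; have lw := joint_has_law X Z.
pose B : set S := @coordX A E E0 a @^-1` C.
have mB : measurable B by rewrite -[B]setTI; exact: measurable_coordX.
have l1 : L1 mu (\1_B) by exact: L2_L1 (L2_indic _ mB).
have szm := @sZ_meas A E E0; have ssz := @sigma_sZ A E E0.
have c := condexpP ssz szm l1.
set k0 := condexp _ _ _ in c.
have a0 := is_condexp_adapted c.
(* The version [k0] lies in [0, 1] almost everywhere, by positivity applied to the indicator and to
   its complement; clipping it makes the bounds hold at every point. *)
pose cut (y : R) := Num.max 0 (Num.min 1 y).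
have mcut : measurable_fun setT cut.
  by apply: measurable_maxr => //; apply: measurable_minr.
have cutb y : 0 <= cut y <= 1.
  by rewrite /cut le_max lexx/= ge_max ler01/= ge_min lexx.
pose k x := cut (k0 x).
have ak : adapted (@sZ A E E0) k by exact: (adapted_comp ssz).
exists k; split => //; first by move=> x; exact: cutb.
have mk := adapted_meas szm ak.
have lk : L1 mu k.
  apply: L2_L1; apply: (@L2_bounded _ _ _ mu k 1) => // x.
  by case/andP: (cutb (k0 x)) => h0 h1; rewrite ger0_norm.
rewrite (sigmaZE X Z); apply: (@law_condexp _ _ _ _ _ _ _ _ lw (@sZ A E E0) _ (\1_B) k szm erefl l1).
apply: (is_condexp_ae szm l1 c lk ak).
have i01 x : 0 <= (\1_B x : R) <= 1.
  by rewrite indicE; case: (_ \in _) => /=; rewrite lexx ler01.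
have ge0 := condexp_ge0 szm l1 (fun x => proj1 (andP (i01 x))) c.
have l1C : L1 mu (fun x => 1 - \1_B x) by apply: L1B => //; exact: L1_cst.
have cC : is_condexp mu (@sZ A E E0) (fun x => 1 - \1_B x) (fun x => 1 - k0 x).
  apply: is_condexpP => //.
  - by apply: L1B; [exact: L1_cst|exact: is_condexp_L1 c].
  - by apply: (adapted_comp (h := fun y => 1 - y) ssz _ a0); exact: measurable_funB.
  - move=> D GD.
    have lD f : L1 mu f -> L1 mu (fun w => f w * \1_D w) by apply: L1_mul_indic; exact: szm.
    have EE f : L1 mu f -> Ex mu (fun w => (1 - f w) * \1_D w) =
        Ex mu \1_D - Ex mu (fun w => f w * \1_D w).
      move=> lf; rewrite -ExB; [|exact: L2_L1 (L2_indic _ (szm _ GD))|exact: lD].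
      by congr Ex; apply/funext => w; rewrite mulrBl mul1r.
    by rewrite !EE//; [congr (_ - _); exact: is_condexp_Ex c GD|exact: is_condexp_L1 c].
have le1 : {ae mu, forall x, 0 <= 1 - k0 x}.
  by apply: (condexp_ge0 szm l1C _ cC) => x; rewrite subr_ge0; case/andP: (i01 x).
apply: filterS2 ge0 le1 => x h0 h1.
by rewrite /k /cut min_r ?max_r//; lra.
Qed.

Definition kernel a C : S -> R := xget (cst 0) [set k | @is_kernel a C k].

Lemma kernelP a C : measurable C -> is_kernel C (@kernel a C).
Proof. by move=> /kernel_exists h; exact: (@xgetPex _ (cst 0) [set k | is_kernel C k] h). Qed.

Lemma kernel_L1 a C k : @is_kernel a C k -> L1 mu k.
Proof.
case=> ak k01 _; apply: L2_L1; apply: (@L2_bounded _ _ _ mu k 1).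
  exact: (adapted_meas (@sZ_meas A E E0) ak).
by move=> x; case/andP: (k01 x) => h0 h1; rewrite ger0_norm.
Qed.

Lemma kernel_joint_L1 a C k : @is_kernel a C k -> L1 P (fun w => k (joint w)).
Proof.
move=> h; have lk := kernel_L1 h.
exact: (proj1 (law_L1 (joint_has_law X Z) (L1_meas lk))).
Qed.

Lemma adapted_joint G (k : S -> R) : adapted G k -> 
  adapted (preimage_set_system setT joint G) (fun w => k (joint w)).
Proof. by move=> ak B mB; exists (k @^-1` B); [exact: ak|rewrite setTI]. Qed.

(** Here conditional independence enters: the function of Z that gives the conditional probability
    of X_a in C given Z also gives it given Z and all other coordinates. *)
Lemma kernel_condexp a C k : measurable C -> @is_kernel a C k ->
  is_condexp mu (@sG A E E0 [set a]) (\1_(@coordX A E E0 a @^-1` C)) k.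
Proof.
move=> mC hk; have [ak k01 ck] := hk; have lw := joint_has_law X Z.
have mXC : measurable (X a @^-1` C) by rewrite -[_ @^-1` _]setTI; exact: measurable_funP.
have l1 : L1 P (\1_(X a @^-1` C)) by exact: L2_L1 (L2_indic _ mXC).
have adk : adapted (@sG A E E0 [set a]) k by move=> B mB; apply: sZ_sG; exact: ak.
have mB : measurable (@coordX A E E0 a @^-1` C) by rewrite -[_ @^-1` _]setTI; exact: measurable_coordX.
apply: (law_condexpV lw) => //.
- exact: sG_meas.
- exact: L2_L1 (L2_indic _ mB).
- exact: kernel_L1 hk.
rewrite -calGE.
have c := condexpP (sigma_calG X Z [set a]) (@calG_meas _ _ _ _ _ _ _ X Z [set a]) l1.
apply: (is_condexp_ae (@calG_meas _ _ _ _ _ _ _ X Z [set a]) l1 c).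
- exact: kernel_joint_L1 hk.
- by rewrite calGE; exact: adapted_joint.
- have sz := sigma_sigmaZ Z; have zm := @sigmaZ_meas _ _ _ _ _ Z.
  have h := condexp_ae_unique sz zm l1 l1 (aeW _ (fun=> erefl)) (condexpP sz zm l1) ck.
  apply: filterS2 (indepX mC) h.
  by move=> w -> ->.
Qed.

End kernels.

(** * Density of the span of a generating family *)

Section l2_induction.
Context d (T : measurableType d) (R : realType) (P : probability T R).
Local Notation nrm := (nrm (@l2ip _ _ _ P)).
Local Notation V := (L2space P).

Lemma l2cls_dominated_approx (f : T -> R) (u : nat -> T -> R) e : L2 P f -> (forall n, L2 P (u n)) ->
  (forall w, u n w @[n --> \oo] --> f w) -> (forall n w, `|u n w| <= `|f w|) -> 0 < e ->
  exists n, nrm (l2cls P f - l2cls P (u n)) <= e.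
Proof.
move=> lf lu uf ule e0; have lfu n : L2 P (fun w => f w - u n w) by exact: L2B.
pose F n w := ((f w - u n w) ^+ 2)%:E.
have bnd n w : (f w - u n w) ^+ 2 <= 4 * f w ^+ 2.
  have h : `|f w - u n w| <= 2 * `|f w|.
    by rewrite (le_trans (ler_normB _ _))// mulr2n mulrDl mul1r lerD.
  rewrite -real_normK ?num_real// -[f w ^+ 2]real_normK ?num_real//.
  have -> : 4 * `|f w| ^+ 2 = (2 * `|f w|) ^+ 2 by ring.
  by rewrite lerXn2r// nnegrE// mulr_ge0.
have mF n : measurable_fun setT (F n).
  by apply/measurable_EFinP; apply: measurable_funX; exact: L2_meas (lfu n).
have cF : {ae P, forall w, setT w -> F ^~ w @ \oo --> (cst 0%E : T -> \bar R) w}.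
  apply: aeW => w _; apply: cvg_EFin; first exact: nearW.
  rewrite (_ : _ \o _ = fun n => (f w - u n w) * (f w - u n w)); last first.
    by apply/funext => n /=; rewrite expr2.
  rewrite -[X in _ --> X](mul0r (0 : R)).
  by apply: cvgM; rewrite -[X in _ --> X](subrr (f w)); apply: cvgB => //; exact: cvg_cst.
have dom : {ae P, forall w n, setT w -> (`|F n w| <= (4 * f w ^+ 2)%:E)%E}.
  by apply: aeW => w n _; rewrite gee0_abs lee_fin ?sqr_ge0.
have [_ _] := dominated_convergence measurableT mF (measurable_cst _) cF (L1Z 4 lf.2) dom.
rewrite integral0 => /fine_cvgP[_ /cvgrPdist_le /(_ (e ^+ 2))].
rewrite exprn_gt0// => /(_ isT)[n _ /(_ n (leqnn n))].
rewrite /= sub0r normrN => h; exists n.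
rewrite l2clsB// nrm_l2cls// -[leRHS]ger0_norm ?(ltW e0)// -sqrtr_sqr.
rewrite ler_sqrt ?sqr_ge0//; exact: le_trans (ler_norm _) h.
Qed.

Import HBNNSimple.

(** A monotone class argument in norm: Dynkin's lemma handles indicators, then come simple
    functions, nonnegative functions and differences. Every approximating sequence is dominated by
    its own limit, which turns pointwise convergence into convergence in norm. *)
Lemma l2_induction (G : set (set T)) (p : V -> Prop) :
  measurable = <<s G >> -> setI_closed G ->
  (forall k x y, p x -> p y -> p (k *: x + y)) ->
  (forall x, (forall e, 0 < e -> exists2 y, p y & nrm (x - y) <= e) -> p x) ->
  p (l2cls P (cst 1)) -> (forall B, G B -> p (l2cls P (\1_B))) ->
  forall x, p x.
Proof.
move=> mG GI plin pcl p1 pG.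
have p0 : p 0 by have := plin (-1) _ _ p1 p1; rewrite scaleN1r addNr.
have pZ k x : p x -> p (k *: x) by move=> px; have := plin k _ _ px p0; rewrite addr0.
have pB x y : p x -> p y -> p (x - y).
  by move=> px py; have := plin (-1) _ _ py px; rewrite scaleN1r addrC.
have pD x y : p x -> p y -> p (x + y) by move=> px; rewrite -[x]scale1r; exact: plin.
have psum I (r : seq I) (f : I -> V) : (forall i, p (f i)) -> p (\sum_(i <- r) f i).
  by move=> pf; elim: r => [|i r IH]; rewrite ?big_nil ?big_cons//; exact: pD.
have pm B : measurable B -> p (l2cls P (\1_B)).
  rewrite mG; move: B; apply: (dynkin_induction mG GI) => //.
  - by rewrite indicT.
  - move=> B mB pIB.
    have -> : l2cls P (\1_(~` B)) = l2cls P (cst 1) - l2cls P (\1_B).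
      rewrite l2clsB; [|exact: L2_cst|exact: L2_indic].
      congr l2cls; apply/funext => w; rewrite !indicE in_setC /=.
      by case: (w \in B); rewrite ?subrr ?subr0.
    exact: pB.
  - move=> F mF tF pF; apply: pcl => e e0.
    pose u n : T -> R := fun w => \sum_(k < n) \1_(F k) w.
    have lu n : L2 P (u n) by apply: L2_sum => k; exact: L2_indic.
    have uE n w : u n w = \1_(\big[setU/set0]_(k < n) F k) w.
      rewrite /u -(big_mkord xpredT F) -(big_mkord xpredT (fun k => \1_(F k) w)).
      elim: n => [|n IH]; first by rewrite !big_geq// indic0.
      rewrite !big_nat_recr//= IH.
      rewrite !indicE in_setU.
      case: (boolP (w \in F n)) => [wF|_]; last by rewrite orbF addr0.
      rewrite orbT memNset ?add0r// big_mkord -bigcup_mkord.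
      move=> [k /= kn Fk]; move/trivIsetP : tF => /(_ k n Logic.I Logic.I).
      rewrite lt_eqF// => /(_ isT); rewrite predeqE => /(_ w)[+ _]; apply.
      by split => //; move: wF; rewrite inE.
    have mU : measurable (\bigcup_k F k) by exact: bigcup_measurable.
    have [] := @l2cls_dominated_approx (\1_(\bigcup_k F k)) u e (L2_indic _ mU) lu _ _ e0.
    + move=> w; have [[k _ Fk]|nF] := pselect ((\bigcup_k F k) w).
        apply: cvg_near_cst; exists k.+1 => // n /= kn.
        rewrite uE !indicE !mem_set//; first by exists k.
        by rewrite -bigcup_mkord; exists k.
      apply: cvg_near_cst; apply: nearW => n; rewrite uE !indicE !memNset//.
      by rewrite -bigcup_mkord => -[k _ Fk]; apply: nF; exists k.
    + move=> n w; rewrite uE !indicE !normr_nat ler_nat.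
      case: (boolP (w \in \big[setU/set0]_(k < n) F k)) => //; rewrite inE -bigcup_mkord => -[k _ Fk].
      by rewrite mem_set//; exists k.
    + move=> n h; exists (l2cls P (u n)) => //.
      have -> : l2cls P (u n) = \sum_(k < n) l2cls P (\1_(F k)).
        by rewrite l2cls_sum// => i; exact: L2_indic.
      exact: psum.
have pnn f : L2 P f -> (forall w, 0 <= f w) -> p (l2cls P f).
  move=> lf f0; apply: pcl => e e0.
  have mf : measurable_fun setT (EFin \o f) by apply/measurable_EFinP; exact: L2_meas lf.
  pose u := nnsfun_approx measurableT mf.
  have u0 n w : 0 <= u n w by [].
  have f0' x : setT x -> (0 <= (EFin \o f) x)%E by move=> _; rewrite lee_fin.
  have ule n w : u n w <= f w.
    by rewrite /u nnsfun_approxE -lee_fin; exact: (le_approx n f0').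
  have lu n : L2 P (u n).
    split; first exact: measurable_funP.
    apply: (@L1_le _ _ _ P (fun w => f w ^+ 2)); last by case: lf.
      by apply: measurable_funX; exact: measurable_funP.
    by move=> w; rewrite ger0_norm ?sqr_ge0// lerXn2r// nnegrE.
  have [] := @l2cls_dominated_approx f u e lf lu _ _ e0.
  + move=> w; have /fine_cvgP[_] := cvg_nnsfun_approx measurableT mf f0' (x := w) Logic.I.
    exact.
  + by move=> n w; rewrite !ger0_norm.
  + move=> n h; exists (l2cls P (u n)) => //.
    rewrite (_ : (u n : T -> R) = fun w => \sum_(i < #|` fset_set (u n @` setT)|)
        ((fset_set (u n @` setT))`_i * \1_(u n @^-1` [set (fset_set (u n @` setT))`_i]) w)); last first.
      by apply/funext => w; exact: fimfunEord.
    have mi y : measurable (u n @^-1` [set y]).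
      by rewrite -[_ @^-1` _]setTI; exact: measurable_funP.
    rewrite -l2cls_sum; last by move=> i; apply: L2Z; exact: L2_indic.
    by apply: psum => i; rewrite -l2clsZ; [apply/pZ/pm|exact: L2_indic].
move=> x; rewrite -[x]l2clsV; have lx := l2val x.
have mx := L2_meas lx.
have l2m (g : T -> R) : measurable_fun setT g -> (forall w, `|g w| <= `|x w|) -> L2 P g.
  move=> mg gx; split=> //; apply: (@L1_le _ _ _ P (fun w => x w ^+ 2)); last by case: lx.
    exact: measurable_funX.
  by move=> w; rewrite normrX -[leRHS]real_normK ?num_real// lerXn2r// nnegrE.
have lp : L2 P (fun w => Num.max (x w) 0).
  apply: l2m; first exact: measurable_maxr.
  by move=> w; rewrite /Num.max; case: ifP; rewrite ?normr0.
have ln : L2 P (fun w => Num.max (- x w) 0).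
  apply: l2m; first by apply: measurable_maxr => //; exact: measurableT_comp.
  by move=> w; rewrite /Num.max; case: ifP; rewrite ?normr0 ?normrN.
have -> : l2cls P x = l2cls P (fun w => Num.max (x w) 0) - l2cls P (fun w => Num.max (- x w) 0).
  rewrite l2clsB//; congr l2cls; apply/funext => w.
  by rewrite /Num.max oppr_lt0; case: ltrgtP => // [||->]; rewrite ?subr0 ?sub0r ?opprK.
by apply: pB; apply: pnn => // w; rewrite le_max lexx orbT.
Qed.

End l2_induction.

(** * Projections determined by elementary vectors *)

Section elementary_vectors.
Context {R : realType} {V : lmodType R} {A : choiceType}.
Variables (ip : V -> V -> R) (Q : A -> V -> V).
Hypothesis ipP : inner_product ip.
Hypothesis complete : nrm_complete ip.
Hypothesis Qlin : forall a k x y, Q a (k *: x + y) = k *: Q a x + Q a y.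
Hypothesis Qsym : forall a x y, ip (Q a x) y = ip x (Q a y).
Hypothesis Qid : forall a x, Q a (Q a x) = Q a x.

(* [el s] stands for the classes of the functionals [k(Z) \prod_(a in s) 1(X_a in C_a)],
   on which conditional independence determines the projections [Q a]. *)
Variable el : {fset A} -> V -> Prop.
Hypothesis el_ind : forall p : V -> Prop,
  (forall c x y, p x -> p y -> p (c *: x + y)) ->
  (forall x, (forall e, 0 < e -> exists2 y, p y & nrm ip (x - y) <= e) -> p x) ->
  (forall s y, el s y -> p y) -> forall x, p x.
Hypothesis el_comm : forall a b s y, el s y -> Q a (Q b y) = Q b (Q a y).
Hypothesis el_out : forall a s y, el s y -> a \notin s -> Q a y = y.
Hypothesis el_in : forall a s y, el s y -> a \in s -> el (s `\ a)%fset (Q a y).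

Variable D : A -> V -> V.
Hypothesis DE : forall a x, D a x = x - Q a x.

Lemma nrm_projection a x : nrm ip (Q a x) <= nrm ip x.
Proof.
have h := cauchy_schwarz ipP (Q a x) x.
have [->|n0] := eqVneq (nrm ip (Q a x)) 0; first exact: nrm_ge0.
rewrite -(@ler_pM2l _ (nrm ip (Q a x))); last by rewrite lt_neqAle eq_sym n0 nrm_ge0.
rewrite -expr2 (sqr_nrm ipP) Qsym Qid -Qsym.
exact: le_trans (ler_norm _) h.
Qed.

(** Conditional expectations do not commute in general. Here they do on elementary vectors, and the
    property passes to the closed span because the [Q a] are contractions. *)
Lemma el_Qcomm a b x : Q a (Q b x) = Q b (Q a x).
Proof.
move: x; apply: el_ind => [c x y px py|x H|s y sy].
- by rewrite !Qlin px py.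
- apply/eqP; rewrite -subr_eq0; apply/eqP/(nrm_eq0 ipP)/eqP.
  rewrite eq_le (nrm_ge0 ip) andbT; apply/ler_addgt0Pr => e e0; rewrite add0r.
  have [y py xy] := H _ (divr_gt0 e0 (@ltr0Sn R 1)).
  rewrite (le_trans (le_nrmB3 ipP _ (Q a (Q b y)) _))// [leRHS]splitr lerD//.
    by rewrite -!(QB Qlin) !(le_trans (nrm_projection _ _)).
  by rewrite py -!(QB Qlin) !(le_trans (nrm_projection _ _))// (nrmB ipP).
- exact: el_comm sy.
Qed.

Lemma el_dense x e : 0 < e -> exists y s, supported Q s y /\ nrm ip (x - y) <= e.
Proof.
move: x e; apply: el_ind => [c x y px py|x H|s y sy] e e0.
- have c0 : 0 < `|c| + 1 by rewrite ltr_wpDl.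
  have e2 : 0 < e / 2 by rewrite divr_gt0.
  have [x' [s [sx' hx]]] := px _ (divr_gt0 e2 c0).
  have [y' [t [ty' hy]]] := py _ e2.
  exists (c *: x' + y'), (s `|` t)%fset; split.
    by move=> a; rewrite inE negb_or => /andP[sa ta]; rewrite Qlin sx'// ty'.
  rewrite opprD addrACA -scalerBr (le_trans (le_nrmD ipP _ _))// [leRHS]splitr lerD//.
  rewrite (nrmZ ipP) (le_trans (ler_wpM2l (normr_ge0 _) hx))//.
  by rewrite mulrCA ler_piMr ?(ltW e2)// ler_pdivrMr// mul1r lerDl.
- have e2 : 0 < e / 2 by rewrite divr_gt0.
  have [y py xy] := H _ e2; have [z [s [sz yz]]] := py _ e2.
  by exists z, s; split => //; rewrite (le_trans (le_nrmB3 ipP _ y _))// [leRHS]splitr lerD.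
- by exists y, s; split; [move=> a; exact: el_out sy|rewrite subrr (nrm0 ipP) ltW].
Qed.

(** The component of order 0 is the product of the [Q a] over [l]; each factor keeps the vector
    elementary and removes its coordinate from the support. *)
Lemma hoeff0_el (l : seq A) s y : el s y ->
  exists2 s', el s' (hoeff Q D l 0 y) & forall b, b \in s' -> b \in s /\ b \notin l.
Proof.
move=> sy; elim: l => [|a l [s' IH sl]]; first by exists s.
have [sa|sa] := boolP (a \in s').
  exists (s' `\ a)%fset; first by rewrite /= add0r; exact: el_in.
  by move=> b; rewrite !inE negb_or => /andP[-> /sl[]].
exists s'; first by rewrite /= add0r (el_out IH).
move=> b bs; have [? ?] := sl _ bs; split => //; rewrite inE negb_or; apply/andP; split => //.
by apply: contraNneq sa => <-.
Qed.

(** Let [y] be elementary with support in [t]. Moving the component of order 0 over [t] to the other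
    side of the inner product turns [y] into an elementary vector with empty support, to which [x]
    is orthogonal. Then [t] grows. *)
Lemma proj0_eq0 x : (forall y, el fset0 y -> ip x y = 0) -> proj ip Q D 0 x = 0.
Proof.
move=> xk; suff H y : ip (proj ip Q D 0 x) y = 0.
  by apply: (nrm_eq0 ipP); rewrite /nrm H sqrtr0.
move: y; apply: el_ind => [c y z py pz|y H|s y sy].
- by rewrite (ipDr ipP) (ipZr ipP) py pz mulr0 addr0.
- apply/eqP; rewrite -normr_eq0 eq_le normr_ge0 andbT; apply/ler_addgt0Pr => e e0; rewrite add0r.
  have c0 : 0 < nrm ip (proj ip Q D 0 x) + 1 by rewrite ltr_wpDl ?(nrm_ge0 ip).
  have [z pz yz] := H _ (divr_gt0 e0 c0).
  rewrite -[y](subrK z) (ipDr ipP) pz addr0 (le_trans (cauchy_schwarz ipP _ _))//.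
  rewrite (le_trans (ler_wpM2l (nrm_ge0 _ _) yz))//.
  by rewrite mulrCA ler_piMr ?(ltW e0)// ler_pdivrMr// mul1r lerDl.
- apply/eqP; rewrite -normr_eq0 eq_le normr_ge0 andbT; apply/ler_addgt0Pr => e e0; rewrite add0r.
  have c0 : 0 < nrm ip y + 1 by rewrite ltr_wpDl ?(nrm_ge0 ip).
  have cv := proj_cvg ipP complete Qlin Qsym Qid el_Qcomm DE el_dense 0 x.
  have [t st xt] := net_cvgP s cv (divr_gt0 e0 c0).
  have z : ip (fhoeff Q D t 0 x) y = 0.
    rewrite /fhoeff (hoeff_sym ipP Qlin Qsym el_Qcomm DE).
    have [s' h s'E] := hoeff0_el (enum_fset t) sy; apply: xk.
    suff -> : fset0 = s' by [].
    apply/esym/fsetP => b; rewrite inE; apply/negP => /s'E[bs]; apply/negP; rewrite negbK.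
    by move/fsubsetP : st; apply.
  rewrite -[proj ip Q D 0 x](subKr (fhoeff Q D t 0 x)) (ipBl ipP) z sub0r normrN.
  rewrite (le_trans (cauchy_schwarz ipP _ _))// (le_trans (ler_wpM2r (nrm_ge0 _ _) xt))//.
  by rewrite mulrAC -mulrA ler_piMr ?(ltW e0)// ler_pdivrMr// mul1r lerDl.
Qed.

End elementary_vectors.

Section condexp_operator.
Context d (T : measurableType d) (R : realType) (P : probability T R) (G : set (set T)).
Hypotheses (sG : sigma_algebra setT G) (Gm : G `<=` measurable).
Local Notation V := (L2space P).

Definition l2_condexp (x : V) : V := l2cls P (condexp P G x).

Lemma l2_condexpE f Y : L2 P f -> is_condexp P G f Y -> l2_condexp (l2cls P f) = l2cls P Y.
Proof.
move=> lf fY; have lx := l2val (l2cls P f).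
have c := condexpP sG Gm (L2_L1 lx).
apply: l2cls_eq; [exact: (condexp_L2 sG Gm lx c).1|exact: (condexp_L2 sG Gm lf fY).1|].
exact: (condexp_ae_unique sG Gm (L2_L1 lx) (L2_L1 lf) (l2clsK lf) c fY).
Qed.

Lemma l2_condexpP (x : V) : is_condexp P G x (condexp P G x).
Proof. by apply: condexpP => //; exact: L2_L1 (l2val x). Qed.

Lemma l2_condexp_L2 (x : V) : L2 P (condexp P G x).
Proof. exact: (condexp_L2 sG Gm (l2val x) (l2_condexpP x)).1. Qed.

Lemma is_condexp_lin k f g Y Y' : L1 P f -> L1 P g -> is_condexp P G f Y -> is_condexp P G g Y' ->
  is_condexp P G (fun w => k * f w + g w) (fun w => k * Y w + Y' w).
Proof.
move=> lf lg fY gY'; have lY := is_condexp_L1 fY; have lY' := is_condexp_L1 gY'.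
apply: (is_condexpP Gm).
- by apply: L1D => //; exact: L1Z.
- by apply: L1D => //; exact: L1Z.
- have /(adaptedP sG) aY := is_condexp_adapted fY; have /(adaptedP sG) aY' := is_condexp_adapted gY'.
  by apply/(adaptedP sG); apply: measurable_funD => //; exact: measurable_funM.
- move=> B GB.
  have lB h : L1 P h -> L1 P (fun w => h w * \1_B w) by apply: L1_mul_indic; exact: Gm.
  have EE h h' : L1 P h -> L1 P h' -> Ex P (fun w => (k * h w + h' w) * \1_B w) =
      k * Ex P (fun w => h w * \1_B w) + Ex P (fun w => h' w * \1_B w).
    move=> lh lh'; rewrite -ExZ; last exact: lB.
    rewrite -ExD; [|by apply: L1Z; exact: lB|exact: lB].
    by congr Ex; apply/funext => w; ring.
  rewrite !EE//; congr (k * _ + _).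
    exact: (is_condexp_Ex Gm lf fY GB).
  exact: (is_condexp_Ex Gm lg gY' GB).
Qed.

Lemma l2_condexp_lin k x y : l2_condexp (k *: x + y) = k *: l2_condexp x + l2_condexp y.
Proof.
have lx := l2val x; have ly := l2val y.
rewrite -[in LHS](l2clsV x) -[in LHS](l2clsV y) l2clsZ// l2clsD//; last exact: L2Z.
rewrite /l2_condexp l2clsZ ?l2clsD; [|by try apply: L2Z; exact: l2_condexp_L2..].
apply: l2_condexpE; first by apply: L2D => //; exact: L2Z.
by apply: is_condexp_lin; [exact: L2_L1|exact: L2_L1|exact: l2_condexpP..].
Qed.

Lemma l2_condexp_sym x y : l2ip (l2_condexp x) y = l2ip x (l2_condexp y).
Proof.
have H x' y' : l2ip (l2_condexp x') y' = Ex P (fun w => condexp P G x' w * condexp P G y' w).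
  rewrite -[y' in LHS]l2clsV l2ip_cls; [|exact: l2_condexp_L2|exact: l2val].
  have C (f g : T -> R) : Ex P (fun w => f w * g w) = Ex P (fun w => g w * f w).
    by congr Ex; apply/funext => w; rewrite mulrC.
  rewrite C [RHS]C.
  apply/esym; apply: (condexp_proj sG Gm (l2val y') (l2_condexpP y') (l2_condexp_L2 x')).
  exact: is_condexp_adapted (l2_condexpP x').
by rewrite H [RHS](ipC (@l2ipP _ _ _ P)) H; congr Ex; apply/funext => w; rewrite mulrC.
Qed.

Lemma is_condexp_adapted_id f : L1 P f -> adapted G f -> is_condexp P G f f.
Proof. by move=> lf af; apply: is_condexpP. Qed.

Lemma l2_condexp_fix f : L2 P f -> adapted G f -> l2_condexp (l2cls P f) = l2cls P f.
Proof. by move=> lf af; apply: l2_condexpE => //; apply: is_condexp_adapted_id => //; exact: L2_L1. Qed.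

Lemma l2_condexp_idem x : l2_condexp (l2_condexp x) = l2_condexp x.
Proof.
apply: l2_condexp_fix; first exact: l2_condexp_L2.
exact: is_condexp_adapted (l2_condexpP x).
Qed.

End condexp_operator.

(** * Elementary functionals of the coordinates *)

Section elementary_functionals.
Context d (Omega : measurableType d) (R : realType) (P : probability Omega R).
Context (A : countType) (E : A -> ptopologicalType) (E0 : ptopologicalType).
Variables (X : forall a, {RV P >-> borel (E a)}) (Z : {RV P >-> borel E0}).
Hypothesis indepX : cond_independent X Z.

Local Notation S := (EAZ E E0).
Local Notation mu := (joint_law X Z).
Local Notation V := (L2space mu).
Local Notation cls := (l2cls mu).
Local Notation nrm := (nrm (@l2ip _ _ _ mu)).
Local Notation sZ := (@sZ A E E0).
Local Notation sG := (@sG A E E0).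
Implicit Types (s : {fset A}) (k : S -> R) (C : forall a, set (borel (E a))).

Definition elem k s C (x : S) : R :=
  k x * \prod_(a <- enum_fset s) \1_(C a) (coordX a x).

Definition bounded_sZ k : Prop := adapted sZ k /\ exists M, forall x, `|k x| <= M.

Lemma elem_adapted (B : set A) k s C : bounded_sZ k -> (forall a, measurable (C a)) ->
  (forall a, a \in s -> ~ B a) -> adapted (sG B) (elem k s C).
Proof.
move=> [ak _] mC sB; have ss := @sigma_sG A E E0 B.
apply: (adaptedM ss); first by move=> D mD; apply: sZ_sG; exact: ak.
have {}sB a : a \in enum_fset s -> ~ B a by exact: sB.
elim: (enum_fset s) sB => [|a l IH] sB.
  under [X in adapted _ X]eq_fun do rewrite big_nil.
  by apply/(adaptedP ss); exact: measurable_cst.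
under [X in adapted _ X]eq_fun do rewrite big_cons.
apply: (adaptedM ss); last by apply: IH => b bl; apply: sB; rewrite inE bl orbT.
apply: (@adapted_indic _ _ _ _ ss (@coordX A E E0 a @^-1` C a)).
apply: sub_sigma_algebra; left; exists a; first by apply: sB; rewrite inE eqxx.
by exists (C a) => //; rewrite setTI.
Qed.

Lemma elem_le M k s C x : (forall x, `|k x| <= M) -> `|elem k s C x| <= M.
Proof.
move=> kM; rewrite /elem normrM -[leRHS]mulr1 ler_pM//.
rewrite normr_prod; elim: (enum_fset s) => [|a l IH]; first by rewrite big_nil.
by rewrite big_cons mulr_ile1// ?prodr_ge0// normr_indic_le1.
Qed.

Lemma elem_L2 k s C : bounded_sZ k -> (forall a, measurable (C a)) -> L2 mu (elem k s C).
Proof.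
move=> hk mC; have [M kM] := hk.2.
apply: (@L2_bounded _ _ _ mu _ M); last by move=> x; exact: elem_le.
by apply: (adapted_meas (@sG_meas A E E0 set0)); apply: elem_adapted => // a _ [].
Qed.

Lemma elem_split k s C a x : a \in s ->
  elem k s C x = elem k (s `\ a)%fset C x * \1_(C a) (coordX a x).
Proof.
move=> sa; rewrite /elem -mulrA; congr (_ * _).
have p : perm_eq (enum_fset s) (a :: enum_fset (s `\ a)%fset).
  by rewrite -{1}(fsetD1K sa); apply: perm_fset1U; rewrite !inE eqxx.
by rewrite (perm_big _ p) big_cons mulrC.
Qed.

Definition condexpX a : V -> V := l2_condexp (sG [set a]).

Local Notation Q := condexpX.
Local Notation sGs a := (@sigma_sG A E E0 [set a]).
Local Notation sGm a := (@sG_meas A E E0 [set a]).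

Lemma condexpX_elem_out a k s C : bounded_sZ k -> (forall a, measurable (C a)) -> a \notin s ->
  Q a (cls (elem k s C)) = cls (elem k s C).
Proof.
move=> hk mC as'; apply: l2_condexp_fix => //; [exact: sigma_sG|exact: sG_meas|exact: elem_L2|].
by apply: elem_adapted => // b bs /= ba; move: as'; rewrite -ba bs.
Qed.

Definition kernelM k a (B : set (borel (E a))) (x : S) : R := k x * kernel X Z B x.

Lemma bounded_kernelM k a (B : set (borel (E a))) : measurable B ->
  bounded_sZ k -> bounded_sZ (kernelM k B).
Proof.
move=> mB [ak [M kM]]; have [al l01 _] := kernelP X Z mB.
split; first exact: (adaptedM (@sigma_sZ A E E0)).
exists M => x; rewrite normrM -[leRHS]mulr1 ler_pM//.
by case/andP: (l01 x) => h0 h1; rewrite ger0_norm.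
Qed.

(** All factors other than the indicator of the coordinate [a] are bounded and measurable for the
    conditioning sigma-algebra, so they are pulled out, and that indicator is replaced by its
    kernel. *)
Lemma condexpX_elem_in a k s C : bounded_sZ k -> (forall a, measurable (C a)) -> a \in s ->
  Q a (cls (elem k s C)) = cls (elem (kernelM k (C a)) (s `\ a)%fset C).
Proof.
move=> hk mC sa; have hk' := bounded_kernelM (mC a) hk.
have lR : L2 mu (elem (kernelM k (C a)) (s `\ a)%fset C) by exact: elem_L2.
have ss := sGs a; have sm := sGm a.
have aR : adapted (sG [set a]) (elem (kernelM k (C a)) (s `\ a)%fset C).
  by apply: elem_adapted => // b; rewrite !inE => /andP[/eqP].
have aH : adapted (sG [set a]) (elem k (s `\ a)%fset C).
  by apply: elem_adapted => // b; rewrite !inE => /andP[/eqP].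
apply: l2_condexpE => //; first exact: elem_L2.
apply: (is_condexpP sm) => //; [exact: L2_L1 (elem_L2 _ hk mC)|exact: L2_L1|].
move=> B GB; have cK := kernel_condexp indepX (mC a) (kernelP X Z (mC a)).
have mI : measurable (@coordX A E E0 a @^-1` C a).
  by rewrite -[_ @^-1` _]setTI; exact: measurable_coordX.
have lI : L2 mu (\1_(@coordX A E E0 a @^-1` C a)) by exact: L2_indic.
have lK := kernel_L1 (kernelP X Z (mC a)).
have [M kM] := hk.2.
have aHB : adapted (sG [set a]) (fun x => elem k (s `\ a)%fset C x * \1_B x).
  by apply: (adaptedM ss) => //; exact: (adapted_indic ss).
have bH x : `|elem k (s `\ a)%fset C x * \1_B x| <= M.
  by rewrite normrM -[leRHS]mulr1 ler_pM ?normr_indic_le1//; exact: elem_le.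
have lH f : L1 mu f -> L1 mu (fun x => f x * (elem k (s `\ a)%fset C x * \1_B x)).
  move=> lf; have := L1_mul_bounded (adapted_meas sm aHB) bH lf.
  by under [X in L1 _ X]eq_fun do rewrite mulrC.
have := condexp_pullout ss sm (L2_L1 lI) cK aHB (lH _ (L2_L1 lI)) (lH _ lK).
move=> h; transitivity (Ex mu (fun w => kernel X Z (C a) w * (elem k (s `\ a)%fset C w * \1_B w))).
  by congr Ex; apply/funext => w; rewrite /elem /kernelM; ring.
rewrite h; congr Ex; apply/funext => w; rewrite (elem_split k C w sa).
by rewrite -[\1_(_ @^-1` _) w]/(\1_(C a) (coordX a w)); ring.
Qed.

(** Conditioning out one coordinate only introduces a function of Z, on which the other projection
    acts trivially; both orders thus give the same product of kernels. *)
Lemma condexpX_comm_elem a b k s C : bounded_sZ k -> (forall a, measurable (C a)) ->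
  Q a (Q b (cls (elem k s C))) = Q b (Q a (cls (elem k s C))).
Proof.
move=> hk mC; have [->//|ab] := eqVneq a b.
have hM c := bounded_kernelM (mC c) hk.
have [sa|sa] := boolP (a \in s); have [sb|sb] := boolP (b \in s).
- rewrite !condexpX_elem_in//; try by rewrite !inE ?sa ?sb ?andbT// eq_sym.
  congr cls; apply/funext => x; rewrite /elem /kernelM.
  by rewrite fsetDDl fsetUC -fsetDDl; ring.
- by rewrite (condexpX_elem_out _ mC sb)// condexpX_elem_in// condexpX_elem_out// !inE (negbTE sb) andbF.
- by rewrite (condexpX_elem_out _ mC sa)// condexpX_elem_in// condexpX_elem_out// !inE (negbTE sa) andbF.
- by rewrite !condexpX_elem_out.
Qed.

Definition rect (C0 : set (borel E0)) s C : set S :=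
  [set x | C0 (coordZ x) /\ forall a, a \in s -> C a (coordX a x)].

Definition rects : set (set S) := [set B | exists (C0 : set (borel E0)) s C,
  [/\ measurable C0, forall a, measurable (C a) & B = rect C0 s C]].

Lemma indic_rect (C0 : set (borel E0)) s C x :
  \1_(rect C0 s C) x = elem (\1_(@coordZ A E E0 @^-1` C0)) s C x.
Proof.
rewrite /elem; have -> : \prod_(a <- enum_fset s) \1_(C a) (coordX a x) =
    (all (fun a => coordX a x \in C a) (enum_fset s))%:R :> R.
  elim: (enum_fset s) => [|a l IH]; first by rewrite big_nil.
  by rewrite big_cons IH indicE -natrM mulnb.
rewrite !indicE -natrM mulnb; congr (nat_of_bool _)%:R.
apply/idP/andP; rewrite !inE => -[C0x Cx]; split => //.
  by apply/allP => a sa; rewrite inE; exact: Cx.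
by move=> a sa; move/allP : Cx => /(_ a sa); rewrite inE.
Qed.

Lemma rects_setI : setI_closed rects.
Proof.
move=> _ _ [C0 [s [C [mC0 mC ->]]]] [D0 [t [D [mD0 mD ->]]]].
(* A coordinate listed in only one of the two rectangles is unconstrained in the other one. *)
pose F a : set (borel (E a)) := (if a \in s then C a else setT) `&` (if a \in t then D a else setT).
exists (C0 `&` D0), (s `|` t)%fset, F; split.
- exact: measurableI.
- by move=> a; apply: measurableI; case: ifP.
- apply/seteqP; split=> x.
    move=> [[xC0 xC] [xD0 xD]]; split => // a _; split; case: ifP => // h.
      exact: xC.
    exact: xD.
  move=> [[xC0 xD0] xF]; split; split => // a sa.
    by have [] := xF a; rewrite ?inE ?sa.
  have [_] : F a (coordX a x) by apply: xF; rewrite inE sa orbT.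
    by rewrite sa.
Qed.

Lemma measurable_rects : (measurable : set (set S)) = <<s rects >>.
Proof.
apply/seteqP; split; last first.
  apply: smallest_sub; first exact: sigma_algebra_measurable.
  move=> _ [C0 [s [C [mC0 mC ->]]]].
  rewrite (_ : rect _ _ _ = @coordZ A E E0 @^-1` C0 `&`
      \bigcap_(a in [set` s]) (@coordX A E E0 a @^-1` C a)).
    apply: measurableI; first by rewrite -[_ @^-1` _]setTI; exact: measurable_coordZ.
    apply: fin_bigcap_measurable => [|a _]; first exact: finite_fset.
    by rewrite -[_ @^-1` _]setTI; exact: measurable_coordX.
  by apply/seteqP; split=> x [? h]; split => // a; exact: h.
apply: smallest_sub; first exact: smallest_sigma_algebra.
move=> _ [[a _ [B mB <-]]|[B mB <-]]; apply: sub_sigma_algebra.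
  exists setT, [fset a]%fset, (dfwith (fun=> setT) a B); split => //.
    by move=> b; have [->|ab] := eqVneq b a; rewrite ?dfwithin// dfwithout// eq_sym.
  apply/seteqP; split=> x.
    by move=> [_ Bx]; split => // b; rewrite inE => /eqP ->; rewrite dfwithin.
  by move=> [_ /(_ a)]; rewrite inE eqxx dfwithin => /(_ isT).
exists B, fset0, (fun=> setT); split => //.
by apply/seteqP; split=> x [] // _ Bx; split.
Qed.

Lemma elementary_induction (p : V -> Prop) :
  (forall c x y, p x -> p y -> p (c *: x + y)) ->
  (forall x, (forall e, 0 < e -> exists2 y, p y & nrm (x - y) <= e) -> p x) ->
  (forall k s C, bounded_sZ k -> (forall a, measurable (C a)) -> p (cls (elem k s C))) ->
  forall x, p x.
Proof.
move=> plin pcl pe.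
have pr (C0 : set (borel E0)) s C : measurable C0 -> (forall a, measurable (C a)) -> p (cls (\1_(rect C0 s C))).
  move=> mC0 mC; rewrite (_ : \1_(rect C0 s C) = elem (\1_(@coordZ A E E0 @^-1` C0)) s C).
    apply: pe => //; split.
      apply: (adapted_indic (@sigma_sZ A E E0)); exists C0 => //; exact: setTI.
    by exists 1 => x; exact: normr_indic_le1.
  by apply/funext => x; exact: indic_rect.
apply: (l2_induction measurable_rects rects_setI plin pcl).
  rewrite (_ : cst 1 = \1_(rect setT fset0 (fun=> setT))); first exact: pr.
  by apply/funext => x; rewrite indicE mem_set.
by move=> _ [C0 [s [C [mC0 mC ->]]]]; exact: pr.
Qed.

Definition coD a (x : V) : V := x - Q a x.

Local Notation ip := (@l2ip _ _ _ mu).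
Let ipP : inner_product ip := @l2ipP _ _ _ mu.
Let complete : nrm_complete ip := @l2_complete _ _ _ mu.

Lemma condexpX_lin a c x y : Q a (c *: x + y) = c *: Q a x + Q a y.
Proof. exact: (l2_condexp_lin (sGs a) (sGm a)). Qed.

Lemma condexpX_sym a x y : ip (Q a x) y = ip x (Q a y).
Proof. exact: (l2_condexp_sym (sGs a) (sGm a)). Qed.

Lemma condexpX_idem a x : Q a (Q a x) = Q a x.
Proof. exact: (l2_condexp_idem (sGs a) (sGm a)). Qed.

Let el s (y : V) : Prop := exists k C,
  [/\ bounded_sZ k, forall a, measurable (C a) & y = cls (elem k s C)].

Let el_ind (p : V -> Prop) :
  (forall c x y, p x -> p y -> p (c *: x + y)) ->
  (forall x, (forall e, 0 < e -> exists2 y, p y & nrm (x - y) <= e) -> p x) ->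
  (forall s y, el s y -> p y) -> forall x, p x.
Proof.
move=> plin pcl pe; apply: (elementary_induction plin pcl) => k s C hk mC.
by apply: (pe s); exists k, C; split.
Qed.

Let el_comm a b s y : el s y -> Q a (Q b y) = Q b (Q a y).
Proof. by move=> [k [C [hk mC ->]]]; apply: condexpX_comm_elem. Qed.

Let el_out a s y : el s y -> a \notin s -> Q a y = y.
Proof. by move=> [k [C [hk mC ->]]]; apply: condexpX_elem_out. Qed.

Let el_in a s y : el s y -> a \in s -> el (s `\ a)%fset (Q a y).
Proof.
move=> [k [C [hk mC ->]]] sa; exists (kernelM k (C a)), C; split => //.
  exact: bounded_kernelM.
exact: condexpX_elem_in.
Qed.

Let coDE a x : coD a x = x - Q a x := erefl.

Let QC := el_Qcomm ipP condexpX_lin condexpX_sym condexpX_idem el_ind el_comm.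
Let Qdense := el_dense ipP condexpX_lin el_ind el_out.

(** Elementary functionals over the empty set are the bounded functions of Z, so the hypothesis is
    the orthogonality required by [proj0_eq0]. *)
Lemma centered_proj0 (x : V) : (forall k, bounded_sZ k -> Ex mu (fun w => x w * k w) = 0) ->
  proj ip Q coD 0 x = 0.
Proof.
move=> xk; apply: (proj0_eq0 ipP complete condexpX_lin condexpX_sym condexpX_idem
  el_ind el_comm el_out el_in coDE).
move=> _ [k [C [hk mC ->]]]; rewrite -(l2clsV x) l2ip_cls; [|exact: l2val|exact: elem_L2].
rewrite -[RHS](xk k hk); congr Ex; apply/funext => w.
by rewrite /elem big_nil mulr1.
Qed.

Definition proj_cvgX := proj_cvg ipP complete condexpX_lin condexpX_sym condexpX_idem QC coDE Qdense.
Definition linv_existsX := linv_exists ipP complete condexpX_lin condexpX_sym condexpX_idem QC coDE Qdense.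
Definition energy_geX := energy_ge ipP complete condexpX_lin condexpX_sym condexpX_idem QC coDE Qdense.
Definition partialL_linvX := partialL_linv ipP complete condexpX_lin condexpX_sym condexpX_idem QC coDE Qdense.
Definition sum_D_linvX := sum_D_linv ipP complete condexpX_lin condexpX_sym condexpX_idem QC coDE Qdense.
Definition sum_subset_projX := sum_subset_proj condexpX_lin QC coDE.
End elementary_functionals.

(** * Chaos decomposition of functionals *)

Section L2_norm.
Context d (T : measurableType d) (R : realType) (P : probability T R).

Lemma LnormE f : L2 P f -> ('N[P]_(2%:E) [EFin \o f] = (Num.sqrt (Ex P (fun w => f w ^+ 2)))%:E)%E.
Proof.
move=> lf; rewrite unlock /= (_ : (\int[P]_x _ = (Ex P (fun w => f w ^+ 2))%:E)%E).
  by rewrite poweR12_sqrt// lee_fin; apply: Ex_ge0 => w; exact: sqr_ge0.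
rewrite EFin_Ex; last by case: lf.
by apply: eq_integral => w _; rewrite powR_mulrn// real_normK ?num_real.
Qed.

Lemma L2_cvgP (u : nat -> T -> R) Y : (forall n, L2 P (u n)) -> L2 P Y ->
  L2_cvg P u Y <-> forall e, 0 < e -> exists N, forall n, (N <= n)%N ->
    Num.sqrt (Ex P (fun w => (u n w - Y w) ^+ 2)) <= e.
Proof.
move=> lu lY; rewrite /L2_cvg.
rewrite (_ : (fun m => _) = fun m => (Num.sqrt (Ex P (fun w => (u m w - Y w) ^+ 2)))%:E); last first.
  by apply/funext => m; rewrite LnormE//; exact: L2B.
split=> [/fine_cvgP[_ /cvgrPdist_le] h e e0|h].
  have [N _ HN] := h _ e0; exists N => n Nn; have := HN n Nn.
  by rewrite /= sub0r normrN; apply: le_trans; exact: ler_norm.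
apply/fine_cvgP; split; first exact: nearW.
apply/cvgrPdist_le => e e0; have [N HN] := h _ e0.
by exists N => // n Nn /=; rewrite sub0r normrN ger0_norm ?sqrtr_ge0// HN.
Qed.

Lemma ae_dist0 f g : L2 P f -> L2 P g -> Num.sqrt (Ex P (fun w => (f w - g w) ^+ 2)) <= 0 ->
  {ae P, forall w, f w = g w}.
Proof.
move=> lf lg h; have [mfg lfg] := L2B lf lg.
have e0 : Ex P (fun w => (f w - g w) ^+ 2) = 0.
  apply/eqP; rewrite eq_le [X in _ && X]Ex_ge0 ?andbT; last by move=> w; exact: sqr_ge0.
  by rewrite -(@ler_sqrt _ _ 0) // sqrtr0.
apply: filterS (Ex_eq0_ae lfg (fun w => sqr_ge0 _) e0) => w /eqP.
by rewrite sqrf_eq0 subr_eq0 => /eqP.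
Qed.

Lemma dist_triangle f g h : L2 P f -> L2 P g -> L2 P h ->
  Num.sqrt (Ex P (fun w => (f w - h w) ^+ 2)) <=
  Num.sqrt (Ex P (fun w => (f w - g w) ^+ 2)) + Num.sqrt (Ex P (fun w => (g w - h w) ^+ 2)).
Proof.
move=> lf lg lh; have := le_nrmD (@l2ipP _ _ _ P) (l2cls P (fun w => f w - g w)) (l2cls P (fun w => g w - h w)).
rewrite l2clsD; [|exact: L2B..].
rewrite !nrm_l2cls; [|exact: L2B|exact: L2B|by apply: L2D; exact: L2B].
by rewrite (_ : (fun w => (f w - g w + (g w - h w)) ^+ 2) = fun w => (f w - h w) ^+ 2)//;
  apply/funext => w; rewrite subrKA.
Qed.

Lemma L2_cvg_unique (u : nat -> T -> R) Y Y' : (forall n, L2 P (u n)) -> L2 P Y -> L2 P Y' ->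
  L2_cvg P u Y -> L2_cvg P u Y' -> {ae P, forall w, Y w = Y' w}.
Proof.
move=> lu lY lY' /(L2_cvgP lu lY) h /(L2_cvgP lu lY') h'; apply: ae_dist0 => //.
apply/ler_addgt0Pr => e e0; rewrite add0r; have e2 : 0 < e / 2 by rewrite divr_gt0.
have [N HN] := h _ e2; have [N' HN'] := h' _ e2.
rewrite (le_trans (dist_triangle lY (lu (maxn N N')) lY'))// [leRHS]splitr lerD//.
  under [X in Ex P X]eq_fun do rewrite -sqrrN opprB.
  by apply: HN; exact: leq_maxl.
by apply: HN'; exact: leq_maxr.
Qed.

End L2_norm.

(** * Random variables as elements of the canonical Hilbert space *)

Section pullback.
Context d (Omega : measurableType d) d' (S : measurableType d') (R : realType).
Variables (P : probability Omega R) (mu : probability S R) (T : Omega -> S).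
Local Notation V := (L2space mu).
Local Notation cls := (l2cls mu).
Local Notation ip := (@l2ip _ _ _ mu).
Local Notation nrm := (nrm (@l2ip _ _ _ mu)).
Implicit Types F G : Omega -> R.

(** A relation rather than a map, so that it applies to random variables obtained by choice, which
    are determined only almost surely. *)
Definition rep F (x : V) : Prop := L2 P F /\ {ae P, forall w, F w = x (T w)}.

Hypothesis lw : has_law P mu T.

Lemma pull_L2 (x : V) : L2 P (fun w => x (T w)).
Proof. by have lx := l2val x; apply: (proj1 (law_L2 lw (L2_meas lx))). Qed.

Lemma rep_pull (x : V) : rep (fun w => x (T w)) x.
Proof. by split; [exact: pull_L2|exact: aeW]. Qed.

Lemma rep_ae F G x : rep F x -> L2 P G -> {ae P, forall w, G w = F w} -> rep G x.
Proof. by move=> [_ Fx] lG GF; split => //; apply: filterS2 GF Fx => w ->. Qed.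

Lemma cls_pull (f : S -> R) : L2 mu f -> {ae P, forall w, cls f (T w) = f (T w)}.
Proof. by move=> lf; apply: (law_ae lw (p := fun x => cls f x = f x)); exact: l2clsK. Qed.

Lemma rep_lin k F G x y : rep F x -> rep G y -> rep (fun w => k * F w + G w) (k *: x + y).
Proof.
move=> [lF Fx] [lG Gy]; split; first by apply: L2D => //; exact: L2Z.
have lx := l2val x; have ly := l2val y.
have e : k *: x + y = cls (fun s => k * x s + y s).
  by rewrite -{1}(l2clsV x) -{1}(l2clsV y) l2clsZ// l2clsD//; exact: L2Z.
rewrite e; have h := cls_pull (L2D (L2Z k lx) ly).
by apply: filterS3 Fx Gy h => w -> -> ->.
Qed.

Lemma rep0 : rep (cst 0) 0.
Proof.
split; first exact: L2_cst.
by apply: filterS (cls_pull (L2_cst mu 0)) => w ->.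
Qed.

Lemma repZ k F x : rep F x -> rep (fun w => k * F w) (k *: x).
Proof.
move=> Fx; have := rep_lin k Fx rep0; rewrite addr0.
by under [X in rep X _]eq_fun do rewrite addr0.
Qed.

Lemma repD F G x y : rep F x -> rep G y -> rep (fun w => F w + G w) (x + y).
Proof.
move=> Fx Gy; have := rep_lin 1 Fx Gy; rewrite scale1r.
by under [X in rep X _]eq_fun do rewrite mul1r.
Qed.

Lemma repN F x : rep F x -> rep (fun w => - F w) (- x).
Proof.
move=> /(repZ (- 1)); rewrite scaleN1r.
by under [X in rep X _]eq_fun do rewrite mulN1r.
Qed.

Lemma repB F G x y : rep F x -> rep G y -> rep (fun w => F w - G w) (x - y).
Proof. by move=> Fx /repN; exact: repD. Qed.

Lemma rep_sum I (r : seq I) (p : pred I) (f : I -> Omega -> R) (x : I -> V) :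
  (forall i, rep (f i) (x i)) ->
  rep (fun w => \sum_(i <- r | p i) f i w) (\sum_(i <- r | p i) x i).
Proof.
move=> fx; elim: r => [|i r IH].
  by under [X in rep X _]eq_fun do rewrite big_nil; rewrite big_nil; exact: rep0.
under [X in rep X _]eq_fun do rewrite big_cons; rewrite big_cons.
by case: (p i) => //; exact: repD.
Qed.

Lemma rep_Ex F G x y : rep F x -> rep G y -> Ex P (fun w => F w * G w) = ip x y.
Proof.
move=> [lF Fx] [lG Gy]; have lx := l2val x; have ly := l2val y.
have lxy := L2_mul lx ly.
rewrite (ae_Ex_mul lF (pull_L2 x) lG (pull_L2 y) Fx Gy).
exact: (law_Ex lw (L1_meas lxy) lxy).
Qed.

Lemma rep_nrm F x : rep F x -> Num.sqrt (Ex P (fun w => F w ^+ 2)) = nrm x.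
Proof.
move=> Fx; congr Num.sqrt; rewrite -(rep_Ex Fx Fx).
by congr Ex; apply/funext => w; rewrite expr2.
Qed.

End pullback.

Section representation.
Context d (Omega : measurableType d) (R : realType) (P : probability Omega R).
Context (A : countType) (E : A -> ptopologicalType) (E0 : ptopologicalType).
Variables (X : forall a, {RV P >-> borel (E a)}) (Z : {RV P >-> borel E0}).
Hypothesis indepX : cond_independent X Z.

Local Notation S := (EAZ E E0).
Local Notation mu := (joint_law X Z).
Local Notation joint := (joint X Z).
Local Notation V := (L2space mu).
Local Notation cls := (l2cls mu).
Local Notation ip := (@l2ip _ _ _ mu).
Local Notation nrm := (nrm (@l2ip _ _ _ mu)).
Local Notation Q := (condexpX (X := X) (Z := Z)).
Local Notation coD := (coD (X := X) (Z := Z)).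
Local Notation sG := (@sG A E E0).
Local Notation lw := (joint_has_law X Z).
Implicit Types F G : Omega -> R.

Local Notation rep := (rep P (mu := mu) joint).

Let joint_L2 x := pull_L2 lw x.
Let rep_joint x := rep_pull lw x.
Let rep_ae := @rep_ae _ _ _ _ _ P mu joint.
Let cls_joint := @cls_pull _ _ _ _ _ _ _ _ lw.
Let repZ := @repZ _ _ _ _ _ _ _ _ lw.
Let repN := @repN _ _ _ _ _ _ _ _ lw.
Let repB := @repB _ _ _ _ _ _ _ _ lw.
Let rep_sum := @rep_sum _ _ _ _ _ _ _ _ lw.
Let rep_Ex := @rep_Ex _ _ _ _ _ _ _ _ lw.
Let rep_nrm := @rep_nrm _ _ _ _ _ _ _ _ lw.

Lemma rep_represents F f : L2 P F -> represents X Z f F -> L2 mu f /\ rep F (cls f).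
Proof.
move=> lF [mf Ff]; have lf : L2 mu f.
  apply: (proj2 (law_L2 lw mf)); apply: (ae_eq_L2 _ Ff lF).
  exact: (measurableT_comp mf (measurable_joint X Z)).
by split => //; split => //; apply: filterS2 Ff (cls_joint lf) => w -> ->.
Qed.

Lemma rep_condexp a F x : rep F x -> rep (condexp P (calG X Z [set a]) F) (Q a x).
Proof.
move=> [lF Fx]; have lx := l2val x.
have sg := sigma_calG X Z [set a]; have gm := @calG_meas _ _ _ _ _ _ _ X Z [set a].
have c := condexpP sg gm (L2_L1 lF).
have ss := @sigma_sG A E E0 [set a]; have sm := @sG_meas A E E0 [set a].
have cx := l2_condexpP ss sm x.
have c' := law_condexp lw sm (calGE X Z [set a]) (L2_L1 lx) cx.
split; first exact: (condexp_L2 sg gm lF c).1.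
have h := condexp_ae_unique sg gm (L2_L1 lF) (L2_L1 (joint_L2 x)) Fx c c'.
by apply: filterS2 h (cls_joint (l2_condexp_L2 ss sm x)) => w -> ->.
Qed.

Lemma rep_D a F x : rep F x -> rep (D X Z a F) (coD a x).
Proof. by move=> Fx; apply: repB => //; exact: rep_condexp. Qed.

Lemma rep_chaos_proj B J F x : rep F x -> rep (chaos_proj X Z B J F) (subset_proj Q coD B J x).
Proof.
move=> Fx; rewrite /chaos_proj /subset_proj.
elim: (enum_fset J) => [|a l IH] /=; last exact: rep_D.
by elim: (enum_fset (B `\` J)%fset) => [//|a l IH] /=; exact: rep_condexp.
Qed.

Lemma rep_chaos_partial n B F x : rep F x -> rep (chaos_partial X Z n B F) (fhoeff Q coD B n x).
Proof.
move=> Fx; rewrite -(sum_subset_projX indepX).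
by apply: rep_sum => J; exact: rep_chaos_proj.
Qed.

(** Without such a sequence the convergence clause of [is_chaos] would be vacuous and the chosen
    chaos undetermined. The coding of the countable type supplies one. *)
Lemma exhausting_exists : exists B : nat -> {fset A}, exhausting B.
Proof.
pose B m : {fset A} := [fset a in pmap choice.unpickle (iota 0 m)]%fset.
exists B; split=> [m|a].
  apply/fsubsetP => a; rewrite !inE !mem_pmap => /mapP[i].
  rewrite mem_iota => /andP[_ im] e; apply/mapP; exists i => //.
  by rewrite mem_iota /= add0n ltnS ltnW.
exists (choice.pickle a).+1; rewrite !inE mem_pmap; apply/mapP; exists (choice.pickle a); last by rewrite choice.pickleK.
by rewrite mem_iota /= add0n leqnn.
Qed.

Lemma exhausting_sub (B : nat -> {fset A}) s : exhausting B -> exists N, forall m, (N <= m)%N ->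
  (s `<=` B m)%fset.
Proof.
move=> [mB cB].
have mono m n : (m <= n)%N -> (B m `<=` B n)%fset.
  elim: n => [|n IH]; first by rewrite leqn0 => /eqP ->.
  rewrite leq_eqVlt => /orP[/eqP -> //|]; rewrite ltnS => /IH h.
  exact: fsubset_trans (mB n).
suff [N HN] : exists N, forall a, a \in enum_fset s -> a \in B N.
  by exists N => m Nm; apply/fsubsetP => a sa; have /fsubsetP := mono _ _ Nm; apply; exact: HN.
elim: (enum_fset s) => [|a l [N HN]]; first by exists 0%N.
have [M aM] := cB a; exists (maxn N M) => b; rewrite inE => /orP[/eqP ->|bl].
  by have /fsubsetP := mono _ _ (leq_maxr N M); apply.
by have /fsubsetP := mono _ _ (leq_maxl N M); apply; exact: HN.
Qed.

Lemma rep_L2_cvg (u : nat -> Omega -> R) Y (v : nat -> V) y :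
  (forall n, rep (u n) (v n)) -> rep Y y -> L2_cvg P u Y <-> nrm_cvg ip v y.
Proof.
move=> uv Yy; have lu n := (uv n).1.
split=> [/(L2_cvgP lu Yy.1) h|h].
  move=> e /h[N HN]; exists N => n /HN.
  by rewrite (rep_nrm (repB (uv n) Yy)).
apply/(L2_cvgP lu Yy.1) => e /h[N HN]; exists N => n /HN.
by rewrite (rep_nrm (repB (uv n) Yy)).
Qed.

Lemma is_chaos_rep n F x Y : rep F x -> rep Y (proj ip Q coD n x) -> is_chaos X Z n F Y.
Proof.
move=> Fx Yy; split; first by apply/L2P; case: Yy.
move=> B eB; apply: (proj2 (rep_L2_cvg (fun m => rep_chaos_partial n (B m) Fx) Yy)).
move=> e e0; have [s0 H] := proj_cvgX indepX n x e0.
by have [N HN] := exhausting_sub s0 eB; exists N => m Nm; apply: H; exact: HN.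
Qed.

(** The projection of [x] pulls back to a candidate, so the chosen chaos meets its specification;
    two candidates are limits in L^2 of one sequence and hence agree almost surely. *)
Lemma rep_chaos n F x : rep F x -> rep (chaos X Z n F) (proj ip Q coD n x).
Proof.
move=> Fx; have Y0 := rep_joint (proj ip Q coD n x).
have h : is_chaos X Z n F (chaos X Z n F).
  exact: (@xgetPex _ (cst 0) [set Y | is_chaos X Z n F Y] (ex_intro _ _ (is_chaos_rep Fx Y0))).
have h0 := is_chaos_rep Fx Y0.
have [B eB] := exhausting_exists.
have lc : L2 P (chaos X Z n F) by apply/L2P; case: h.
apply: (rep_ae Y0) => //.
apply: (@L2_cvg_unique _ _ _ P (fun m => chaos_partial X Z n (B m) F)) => //.
- by move=> m; case: (rep_chaos_partial n (B m) Fx).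
- by case: h => _; exact.
- by case: h0 => _; exact.
Qed.

(** Same argument as for the chaoses; the minus sign reflects the positive weights in [is_linv]. *)
Lemma rep_Linv F x g : rep F x -> is_linv ip Q coD x g -> rep (Linv X Z F) (- g).
Proof.
move=> Fx xg; pose u m w := - \sum_(1 <= n < m) chaos X Z n F w / n%:R.
pose v m : V := - \sum_(1 <= n < m) (n%:R : R)^-1 *: proj ip Q coD n x.
have uv m : rep (u m) (v m).
  apply: repN; apply: rep_sum => n.
  under [X in rep X _]eq_fun do rewrite mulrC.
  by apply: repZ; exact: rep_chaos.
have Y0 := rep_joint (- g).
have h0 : is_Linv X Z F (fun w => (- g) (joint w)).
  split; first by apply/L2P; case: Y0.
  apply: (proj2 (rep_L2_cvg uv Y0)) => e /xg[N HN]; exists N => m Nm.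
  rewrite /v opprK addrC -[_ + _]opprB (nrmN (@l2ipP _ _ _ mu)) (nrmB (@l2ipP _ _ _ mu)) (nrmB (@l2ipP _ _ _ mu)).
  exact: HN.
have h : is_Linv X Z F (Linv X Z F).
  exact: (@xgetPex _ (cst 0) [set Y | is_Linv X Z F Y] (ex_intro _ _ h0)).
have lc : L2 P (Linv X Z F) by apply/L2P; case: h.
apply: (rep_ae Y0) => //.
apply: (@L2_cvg_unique _ _ _ P u) => //.
- by move=> m; case: (uv m).
- by case: h.
- by case: h0.
Qed.

Lemma rep_energy F x : rep F x -> (dirichlet_energy X Z F =
  \sum_(1 <= n <oo) (n%:R * ip (proj ip Q coD n x) (proj ip Q coD n x))%:E)%E.
Proof.
move=> Fx; apply: eq_eseriesr => n _; rewrite EFinM; congr (_ * _)%E.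
have c := rep_chaos n Fx; rewrite unlock -(rep_Ex c c) EFin_Ex; last exact: L2_mul c.1 c.1.
by apply: eq_integral => w _; congr EFin; rewrite /= expr2.
Qed.

End representation.

(** * Resampling one coordinate *)

Section copies.
Context d (Omega : measurableType d) (R : realType) (P : probability Omega R).
Context (A : countType) (E : A -> ptopologicalType) (E0 : ptopologicalType).
Variables (X : forall a, {RV P >-> borel (E a)}) (Z : {RV P >-> borel E0}).
Variable X' : forall a, {RV P >-> borel (E a)}.
Hypotheses (indepX : cond_independent X Z) (copyX' : cond_copies X Z X').

Local Notation S := (EAZ E E0).
Local Notation mu := (joint_law X Z).
Local Notation joint := (joint X Z).
Local Notation V := (L2space mu).
Local Notation cls := (l2cls mu).
Local Notation ip := (@l2ip _ _ _ mu).
Local Notation nrm := (nrm (@l2ip _ _ _ mu)).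
Local Notation Q := (condexpX (X := X) (Z := Z)).
Local Notation lw := (joint_has_law X Z).

Definition resample a (w : Omega) : S := (dfwith (fun b => X b w) a (X' a w), Z w).

Lemma coordX_resample_in a w : coordX a (resample a w) = X' a w.
Proof. by rewrite /coordX /= dfwithin. Qed.

Lemma coordX_resample_out a b w : b != a -> coordX b (resample a w) = X b w.
Proof. by move=> ba; rewrite /coordX /= dfwithout// eq_sym. Qed.

Lemma measurable_resample a : measurable_fun setT (resample a).
Proof.
apply: measurable_to_EAZ => [b|]; last exact: (measurable_funP Z).
have [->|ba] := eqVneq b a.
  by under eq_fun do rewrite coordX_resample_in; exact: measurable_funP.
by under eq_fun do rewrite coordX_resample_out//; exact: measurable_funP.
Qed.

(** The level set of [k] through [x] is a preimage under the coordinate Z, so it contains every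
    point with the same Z-coordinate. *)
Lemma bounded_sZ_coordZ (k : S -> R) x y : bounded_sZ k -> coordZ x = coordZ y -> k x = k y.
Proof.
move=> [ak _] xy; have [D mD e] := ak _ (measurable_set1 (k x)).
have : (k @^-1` [set k x]) x by [].
by rewrite -e setTI /preimage/= xy => Dy; apply/esym; rewrite -[_ = _]/((k @^-1` [set k x]) y) -e setTI.
Qed.

Lemma elem_resample a (k : S -> R) s C w : bounded_sZ k -> a \notin s ->
  elem k s C (resample a w) = elem k s C (joint w).
Proof.
move=> hk sa; rewrite /elem (bounded_sZ_coordZ hk (y := joint w))//; congr (_ * _).
apply: eq_big_seq => b sb; rewrite coordX_resample_out//.
by apply: contraNneq sa => <-.
Qed.

(** The two clauses on copies are chained: the conditional law of the copy given (X, Z) is the one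
    given Z, which is that of X_a given Z, represented by the kernel. *)
Lemma copy_condexp a (C : set (borel (E a))) : measurable C ->
  is_condexp P (calG X Z set0) (\1_(X' a @^-1` C)) (fun w => kernel X Z C (joint w)).
Proof.
move=> mC; have hk := kernelP X Z mC; have [ak _ ck] := hk.
have [c1 c2] := copyX' a.
have mX (Y : {RV P >-> borel (E a)}) : measurable (Y @^-1` C).
  by rewrite -[_ @^-1` _]setTI; exact: measurable_funP.
have l1 Y : L1 P (\1_((Y : {RV P >-> borel (E a)}) @^-1` C)) by exact: L2_L1 (L2_indic _ (mX Y)).
have sg := sigma_calG X Z set0; have gm := @calG_meas _ _ _ _ _ _ _ X Z set0.
have sz := sigma_sigmaZ Z; have zm := @sigmaZ_meas _ _ _ _ _ Z.
apply: (is_condexp_ae gm (l1 _) (condexpP sg gm (l1 (X' a)))).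
- exact: kernel_joint_L1 hk.
- by rewrite calGE; apply: adapted_joint => B mB; apply: sZ_sG; exact: ak.
- have h := condexp_ae_unique sz zm (l1 _) (l1 _) (aeW _ (fun=> erefl)) (condexpP sz zm (l1 (X a))) ck.
  by apply: filterS3 (c1 _ mC) (c2 _ mC) h => w -> -> ->.
Qed.

(** Averaging over the resampled coordinate, with (X, Z) fixed, turns its indicator into the kernel,
    which is what [Q a] does to an elementary functional. *)
Lemma Ex_elem_resample a (H : Omega -> R) k s C : L2 P H -> adapted (calG X Z set0) H ->
  bounded_sZ k -> (forall b, measurable (C b)) ->
  exists y : V, y = Q a (cls (elem k s C)) /\
    Ex P (fun w => H w * elem k s C (resample a w)) = Ex P (fun w => H w * y (joint w)).
Proof.
move=> lH aH hk mC; eexists; split; first by [].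
have sg := sigma_calG X Z set0; have gm := @calG_meas _ _ _ _ _ _ _ X Z set0.
have ajE (k' : S -> R) t : bounded_sZ k' -> adapted (calG X Z set0) (fun w => elem k' t C (joint w)).
  move=> hk'; rewrite calGE; apply: (@adapted_joint _ _ _ _ _ _ _ X Z _ (elem k' t C)).
  by apply: elem_adapted => // b _ [].
have lE (k' : S -> R) t : bounded_sZ k' -> L2 P (fun w => elem k' t C (joint w)).
  move=> hk'; have l := elem_L2 X Z t hk' mC.
  exact: (proj1 (law_L2 lw (L2_meas l))).
have red (k' : S -> R) t : bounded_sZ k' ->
    Ex P (fun w => H w * cls (elem k' t C) (joint w)) = Ex P (fun w => H w * elem k' t C (joint w)).
  move=> hk'; apply: (ae_Ex_mul lH lH (pull_L2 lw _) (lE _ _ hk')); first exact: aeW.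
  exact: (cls_pull lw (elem_L2 X Z t hk' mC)).
have [sa|sa] := boolP (a \in s); last first.
  rewrite (condexpX_elem_out X Z hk mC sa) red//; congr Ex; apply/funext => w.
  by rewrite (elem_resample C w hk sa).
have hM := bounded_kernelM X Z (mC a) hk.
rewrite (condexpX_elem_in indepX hk mC sa) red//.
have sa' : a \notin (s `\ a)%fset by rewrite !inE eqxx.
pose W w := H w * elem k (s `\ a)%fset C (joint w).
have aW : adapted (calG X Z set0) W by apply: (adaptedM sg) => //; exact: ajE.
have [M kM] := hk.2.
have lW : L2 P W.
  rewrite /W; under [X in L2 P X]eq_fun do rewrite mulrC.
  apply: (@L2_mul_bounded _ _ _ P M) => //; first exact: L2_meas (lE _ _ hk).
  by move=> w; exact: elem_le.
have mI : measurable (X' a @^-1` C a) by rewrite -[_ @^-1` _]setTI; exact: measurable_funP.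
have lI := L2_indic P mI.
have hK := kernelP X Z (mC a).
have cK := copy_condexp (mC a).
have lKW : L1 P (fun w => kernel X Z (C a) (joint w) * W w).
  apply: (@L1_mul_bounded _ _ _ P 1); [exact: L1_meas (kernel_joint_L1 hK)| |exact: L2_L1].
  by case: hK => _ k01 _ w; case/andP: (k01 (joint w)) => h0 h1; rewrite ger0_norm.
have := condexp_pullout sg gm (L2_L1 lI) cK aW (L2_mul lI lW) lKW.
move=> h; transitivity (Ex P (fun w => \1_(X' a @^-1` C a) w * W w)).
  congr Ex; apply/funext => w; rewrite (elem_split k C _ sa) (elem_resample C w hk sa').
  by rewrite coordX_resample_in -[\1_(_ @^-1` _) w]/(\1_(C a) (X' a w)) /W; ring.
by rewrite -h; congr Ex; apply/funext => w; rewrite /W /elem /kernelM; ring.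
Qed.

(** The rectangles form a generating pi-system. On them, [Ex_elem_resample] with H = 1 reduces the
    claim to <1, Q a y> = <Q a 1, y> = <1, y>. *)
Lemma resample_has_law a : has_law P mu (resample a).
Proof.
have mr := measurable_resample a; split => //.
pose Tm : {mfun Omega >-> S} := HB.pack (resample a) (isMeasurableFun.Build _ _ _ _ (resample a) mr).
move=> B mB; rewrite -[RHS]/(distribution P Tm B).
apply: (measure_unique (@rects A E E0) (fun=> setT)) => //.
- exact: measurable_rects.
- exact: rects_setI.
- move=> _; exists setT, fset0, (fun=> setT); split => //.
  by apply/seteqP; split.
- by rewrite bigcup_const.
- move=> _ [C0 [s [C [mC0 mC ->]]]].
  pose k : S -> R := \1_(@coordZ A E E0 @^-1` C0).
  have hk : bounded_sZ k.
    split; first by apply: (adapted_indic (@sigma_sZ A E E0)); exists C0 => //; exact: setTI.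
    by exists 1 => x; exact: normr_indic_le1.
  have rE : \1_(rect C0 s C) = elem k s C :> (S -> R) by apply/funext => x; exact: indic_rect.
  have mr0 : measurable (rect C0 s C).
    by rewrite measurable_rects; apply: sub_sigma_algebra; exists C0, s, C.
  have mrr : measurable (resample a @^-1` rect C0 s C) by rewrite -[_ @^-1` _]setTI; apply: measurable_resample.
  have l1 : L2 mu (cst 1 : S -> R) by exact: L2_cst.
  have a1 : adapted (calG X Z set0) (cst 1 : Omega -> R).
    by apply/(adaptedP (sigma_calG X Z set0)); exact: measurable_cst.
  have [y [yE h]] := Ex_elem_resample a s (L2_cst P 1) a1 hk mC.
  have lE := elem_L2 X Z s hk mC.
  have : Ex mu (elem k s C) = Ex P (fun w => elem k s C (resample a w)).
    transitivity (Ex P (fun w => cst 1 w * elem k s C (resample a w))); last first.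
      by congr Ex; apply/funext => w; rewrite mul1r.
    rewrite h; have -> : Ex P (fun w => cst 1 w * y (joint w)) = ip (cls (cst 1)) y.
      apply: (rep_Ex lw); last exact: rep_pull.
      split; first exact: L2_cst.
      by apply: filterS (cls_pull lw (L2_cst mu 1)) => w ->.
    have ss := @sigma_sG A E E0 [set a]; have sm := @sG_meas A E E0 [set a].
    have Q1 : Q a (cls (cst 1)) = cls (cst 1).
      apply: (l2_condexp_fix ss sm l1).
      by apply/(adaptedP ss); exact: measurable_cst.
    rewrite yE -condexpX_sym Q1 l2ip_cls//.
    by congr Ex; apply/funext => x; rewrite mul1r.
  rewrite -rE (_ : (fun w => _) = \1_(resample a @^-1` rect C0 s C))//.
  rewrite !Ex_indic// => e.
  have f1 : mu (rect C0 s C) \is a fin_num by exact: fin_num_measure.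
  have f2 : P (resample a @^-1` rect C0 s C) \is a fin_num by exact: fin_num_measure.
  exact: (etrans (esym (fineK f1)) (etrans (congr1 EFin e) (fineK f2))).
- by move=> _; apply: le_lt_trans (probability_le1 mu measurableT) (ltry 1).
Qed.

(** Both sides are bounded bilinear forms, so elementary [y] suffice. Boundedness of the left side
    uses that the resampled point has the same law as the original one. *)
Lemma Ex_joint_resample a (x y : V) :
  Ex P (fun w => x (joint w) * y (resample a w)) = ip x (Q a y).
Proof.
have lwa := resample_has_law a.
pose B (x' y' : V) := Ex P (fun w => x' (joint w) * y' (resample a w)).
have lj (z : V) : L2 P (fun w => z (joint w)) := pull_L2 lw z.
have lr (z : V) : L2 P (fun w => z (resample a w)) := pull_L2 lwa z.
have Blin x' c y1 y2 : B x' (c *: y1 + y2) = c * B x' y1 + B x' y2.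
  have h := (rep_lin lwa c (rep_pull lwa y1) (rep_pull lwa y2)).2.
  rewrite /B -ExZ; last exact: L2_mul.
  rewrite -ExD; [|by apply: L1Z; exact: L2_mul|exact: L2_mul].
  transitivity (Ex P (fun w => x' (joint w) * (c * y1 (resample a w) + y2 (resample a w)))); last first.
    by congr Ex; apply/funext => w; ring.
  apply: ae_Ex_mul => //; [by apply: L2D => //; exact: L2Z|exact: aeW|].
  by apply: filterS h => w ->.
have Bbound x' y' : `|B x' y'| <= nrm x' * nrm y'.
  rewrite /B -l2ip_cls//; apply: le_trans (cauchy_schwarz (@l2ipP _ _ _ P) _ _) _.
  rewrite !nrm_l2cls//.
  by rewrite (rep_nrm lw (rep_pull lw x')) (rep_nrm lwa (rep_pull lwa y')).
have ipP : inner_product ip := @l2ipP _ _ _ mu.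
move: y x; apply: elementary_induction => [c y z py pz x|y H x|k s C hk mC x].
- rewrite -/(B _ _) Blin /B py pz condexpX_lin.
  by rewrite (ipDr ipP) (ipZr ipP).
- apply/eqP; rewrite -subr_eq0 -normr_eq0 eq_le normr_ge0 andbT.
  apply/ler_addgt0Pr => e e0; rewrite add0r.
  have c0 : 0 < 2 * (nrm x + 1) by rewrite mulr_gt0// ltr_wpDl ?(nrm_ge0 ip).
  have [z pz yz] := H _ (divr_gt0 e0 c0).
  have -> : y = 1 *: (y - z) + z by rewrite scale1r subrK.
  rewrite -/(B _ _) Blin condexpX_lin (ipDr ipP) (ipZr ipP) [B x z]pz !mul1r.
  rewrite opprD addrACA subrr addr0.
  rewrite (le_trans (ler_normB _ _))//.
  have b1 := Bbound x (y - z).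
  have nQ := nrm_projection ipP (@condexpX_sym _ _ _ _ _ _ _ X Z)
    (@condexpX_idem _ _ _ _ _ _ _ X Z) a (y - z).
  have b2 := le_trans (cauchy_schwarz ipP x (Q a (y - z))) (ler_wpM2l (nrm_ge0 ip x) nQ).
  rewrite (le_trans (lerD b1 b2))//.
  have : nrm x * nrm (y - z) <= nrm x * (e / (2 * (nrm x + 1))) by rewrite ler_wpM2l// nrm_ge0.
  have : nrm x * (e / (2 * (nrm x + 1))) <= e / 2.
    by rewrite mulrCA ler_wpM2l ?(ltW e0)// invfM mulrCA ler_piMr// ler_pdivrMr ?mul1r ?lerDl// ltr_wpDl ?(nrm_ge0 ip).
  by move: (nrm x * _) => u; lra.
- have aH : adapted (calG X Z set0) (fun w => x (joint w)).
    rewrite calGE; apply: adapted_joint; rewrite sG0_measurable => D mD.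
    by rewrite -[_ @^-1` _]setTI; exact: (L2_meas (l2val x)).
  have [y [yE h]] := Ex_elem_resample a s (lj x) aH hk mC.
  rewrite -yE -(rep_Ex lw (rep_pull lw x) (rep_pull lw y)) -h.
  have lE := elem_L2 X Z s hk mC.
  apply: ae_Ex_mul => //; [exact: (proj1 (law_L2 lwa (L2_meas lE)))|exact: aeW|].
  exact: (cls_pull lwa lE).
Qed.

End copies.

(** * Unordered sums and their finite approximations *)

Section unordered_sums.
Context (R : realType) (A : countType).
Implicit Types (u : A -> \bar R) (s : {fset A}).

(** Gives access to the convergence theorems for series indexed by integers; integers that code no
    element contribute 0. *)
Lemma esum_series u : (forall a, (0 <= u a)%E) ->
  (\esum_(a in [set: A]) u a = \sum_(n <oo) oapp u 0 (@choice.pickle_inv A n))%E.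
Proof.
move=> u0; pose v n := oapp u 0%E (@choice.pickle_inv A n).
have v0 n : (0 <= v n)%E by rewrite /v; case: (@choice.pickle_inv A n) => /=.
transitivity (\esum_(a in [set: A]) v (choice.pickle a))%E.
  by apply: eq_esum => a _; rewrite /v choice.pickleK_inv.
rewrite -(esum_image [set: A] choice.pickle v); last first.
  by move=> a b _ _ /(congr1 (@choice.pickle_inv A)); rewrite !choice.pickleK_inv => -[].
rewrite nneseries_esumT// esum_mkcond; apply: eq_esum => n _.
case: ifPn => //; rewrite notin_setE => nn; rewrite /v.
case e : (@choice.pickle_inv A n) => [a|//]; exfalso; apply: nn; exists a => //.
by have := @choice.pickle_invK A n; rewrite /= /omap /obind e.
Qed.

Lemma esum_split u s : (forall a, (0 <= u a)%E) ->
  (\esum_(a in [set: A]) u a =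
   \sum_(a <- enum_fset s) u a + \esum_(a in ~` [set` s]) u a)%E.
Proof.
move=> u0; rewrite (esumID [set` s])// !setTI; congr (_ + _)%E.
by rewrite esum_fset// fsbig_finite//= set_fsetK.
Qed.

Lemma sum_le_esum u s : (forall a, (0 <= u a)%E) ->
  (\sum_(a <- enum_fset s) u a <= \esum_(a in [set: A]) u a)%E.
Proof. by move=> u0; rewrite (esum_split s u0) leeDl// esum_ge0. Qed.

Lemma esum_le u c : (forall s, \sum_(a <- enum_fset s) u a <= c)%E ->
  (\esum_(a in [set: A]) u a <= c)%E.
Proof.
move=> h; apply: ge_ereal_sup => _ [B [fB _] <-].
by rewrite fsbig_finite.
Qed.

Lemma esum_tail u (e : R) : (forall a, (0 <= u a)%E) ->
  (\esum_(a in [set: A]) u a < +oo)%E -> 0 < e ->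
  exists s0, forall s, (s0 `<=` s)%fset -> (\esum_(a in ~` [set` s]) u a <= e%:E)%E.
Proof.
move=> u0 uoo e0.
have fin : (\esum_(a in [set: A]) u a)%E \is a fin_num by rewrite ge0_fin_numE// esum_ge0.
have [_ [B [fB _] <-] h] := ub_ereal_sup_adherent e0 fin.
exists (fset_set B) => s Bs.
have le : (\sum_(a \in B) u a <= \sum_(a <- enum_fset s) u a)%E.
  rewrite fsbig_finite//=; apply: lee_sum_nneg_subfset => //.
  by move/fsubsetP : Bs.
have {}h : (\esum_(a in [set: A]) u a - e%:E < \sum_(a \in B) u a)%E by [].
move: fin h; rewrite (esum_split s u0) => fin h.
have f1 : (\sum_(a <- enum_fset s) u a)%E \is a fin_num.
  by move: fin; rewrite fin_numD => /andP[].
have f2 : (\esum_(a in ~` [set` s]) u a)%E \is a fin_num.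
  by move: fin; rewrite fin_numD => /andP[].
move: (lt_le_trans h le) f1 f2.
move: (\sum_(a <- _) _)%E (esum _ _) => [x| |] [y| |]//.
by rewrite lee_fin /= lte_fin => h' _ _; lra.
Qed.

Section integral.
Context d (T : measurableType d) (P : probability T R).

Lemma esum_integral (f : A -> T -> \bar R) :
  (forall a, measurable_fun setT (f a)) -> (forall a w, 0 <= f a w)%E ->
  measurable_fun setT (fun w => \esum_(a in [set: A]) f a w)%E /\
  (\int[P]_w (\esum_(a in [set: A]) f a w) = \esum_(a in [set: A]) \int[P]_w f a w)%E.
Proof.
move=> mf f0.
pose v n w := oapp (f^~ w) 0%E (@choice.pickle_inv A n).
have vE w : (\esum_(a in [set: A]) f a w = \sum_(n <oo) v n w)%E by rewrite esum_series.
have mv n : measurable_fun setT (v n).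
  by rewrite /v; case: (@choice.pickle_inv A n) => [a|]/=; [exact: mf|exact: measurable_cst].
have v0 n w : (0 <= v n w)%E by rewrite /v; case: (@choice.pickle_inv A n) => /=.
split.
  under eq_fun do rewrite vE.
  by apply: ge0_emeasurable_sum => // n w _ _; exact: v0.
under eq_integral do rewrite vE.
rewrite integral_nneseries// esum_series; last by move=> a; exact: integral_ge0.
apply: eq_eseriesr => n _; rewrite /v.
by case: (@choice.pickle_inv A n) => [a|]//=; rewrite integral0.
Qed.

Variable g : A -> T -> R.
Hypothesis lg : forall a, L1 P (g a).
Hypothesis g_sum : (\esum_(a in [set: A]) (Ex P (fun w => `|g a w|))%:E < +oo)%E.

Let U w := usum (fun a => g a w).
Let tail s w := (\esum_(a in ~` [set` s]) (`|g a w|)%:E)%E.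

Let m_abs a : measurable_fun setT (fun w => (`|g a w|)%:E).
Proof. by apply/measurable_EFinP; apply: measurableT_comp => //; exact: L1_meas (lg a). Qed.

Let tailE s : measurable_fun setT (tail s) /\
  (\int[P]_w tail s w = \esum_(a in ~` [set` s]) (Ex P (fun w => `|g a w|))%:E)%E.
Proof.
pose f a w := if a \in ~` [set` s] then (`|g a w|)%:E else 0%E.
have fE w : tail s w = (\esum_(a in [set: A]) f a w)%E by rewrite /tail esum_mkcond.
have [|a w|m _] := @esum_integral f.
- by move=> a; rewrite /f; case: (a \in _); [exact: m_abs|exact: measurable_cst].
- by rewrite /f; case: (a \in _).
split; first by rewrite (_ : tail s = fun w => \esum_(a in [set: A]) f a w)%E//; apply/funext.
under eq_integral do rewrite fE.
rewrite [RHS]esum_mkcond.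
have [|a w|_ ->] := @esum_integral f.
- by move=> a; rewrite /f; case: (a \in _); [exact: m_abs|exact: measurable_cst].
- by rewrite /f; case: (a \in _).
apply: eq_esum => a _; rewrite /f; case: (a \in _); last exact: integral0.
by rewrite EFin_Ex//; exact: L1_norm.
Qed.

Let mU : measurable_fun setT U.
Proof.
apply: measurable_funB; apply: measurableT_comp => //; apply: (esum_integral _ _).1.
- move=> a; apply/measurable_EFinP; apply: measurable_funrpos; exact: L1_meas (lg a).
- by move=> a w; rewrite lee_fin; exact: funrpos_ge0.
- move=> a; apply/measurable_EFinP; apply: measurable_funrneg; exact: L1_meas (lg a).
- by move=> a w; rewrite lee_fin; exact: funrneg_ge0.
Qed.

(** Where the absolute series diverges, [usum] has no meaning, as [fine] sends infinite values to 0.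
    Integrability of the full tail confines this to a null set, off which positive and negative
    parts can be split separately. *)
Let U_tail s : {ae P, forall w, ((`|\sum_(a <- enum_fset s) g a w - U w|)%:E <= tail s w)%E}.
Proof.
have [m0 i0] := tailE fset0.
have s0E (u : A -> \bar R) : (\esum_(a in ~` [set` fset0]) u a = \esum_(a in [set: A]) u a)%E.
  by congr esum; apply/seteqP; split => // a _ /=; rewrite inE.
have it : P.-integrable setT (tail fset0).
  apply/integrableP; split => //; rewrite s0E in i0.
  under eq_integral do rewrite gee0_abs ?esum_ge0//.
  by rewrite i0.
apply: filterS (integrable_ae measurableT it) => w /(_ Logic.I).
rewrite /tail s0E => fin.
pose p a := (funrpos (fun a => g a w) a)%:E; pose n a := (funrneg (fun a => g a w) a)%:E.
have p0 a : (0 <= p a)%E by rewrite lee_fin funrpos_ge0.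
have n0 a : (0 <= n a)%E by rewrite lee_fin funrneg_ge0.
have pn a : (`|g a w|)%:E = (p a + n a)%E.
  by rewrite -EFinD; congr EFin; exact: (congr1 (@^~ a) (esym (funrposDneg (g^~ w)))).
have gE a : g a w = fine (p a) - fine (n a).
  exact: (congr1 (@^~ a) (esym (funrposBneg (g^~ w)))).
have tE : (\esum_(a in ~` [set` s]) (`|g a w|)%:E =
    \esum_(a in ~` [set` s]) p a + \esum_(a in ~` [set` s]) n a)%E.
  by rewrite -esumD//; apply: eq_esum => a _; exact: pn.
have sE : (\esum_(a in [set: A]) (`|g a w|)%:E =
    \esum_(a in [set: A]) p a + \esum_(a in [set: A]) n a)%E.
  by rewrite -esumD//; apply: eq_esum => a _; exact: pn.
move: fin; rewrite sE fin_numD => /andP[fp fn].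
rewrite /U /usum -[X in fine X - _]/(\esum_(a in [set: A]) p a)%E.
rewrite -[X in _ - (_ - fine X)]/(\esum_(a in [set: A]) n a)%E tE.
move: fp fn; rewrite (esum_split s p0) (esum_split s n0) !fin_numD.
move=> /andP[fp1 fp2] /andP[fn1 fn2]; rewrite !fineD//.
have sumE : \sum_(a <- enum_fset s) g a w =
    fine (\sum_(a <- enum_fset s) p a)%E - fine (\sum_(a <- enum_fset s) n a)%E.
  rewrite !sumEFin/= -sumrB; apply: eq_bigr => a _; exact: gE.
have tp0 : 0 <= fine (\esum_(a in ~` [set` s]) p a)%E by rewrite fine_ge0// esum_ge0.
have tn0 : 0 <= fine (\esum_(a in ~` [set` s]) n a)%E by rewrite fine_ge0// esum_ge0.
rewrite -(fineK fp2) -(fineK fn2) -EFinD lee_fin sumE ler_norml.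
by apply/andP; split; lra.
Qed.

Lemma usum_L1_approx s e :
  (\esum_(a in ~` [set` s]) (Ex P (fun w => `|g a w|))%:E <= e%:E)%E ->
  L1 P (fun w => \sum_(a <- enum_fset s) g a w - U w) /\
  Ex P (fun w => `|\sum_(a <- enum_fset s) g a w - U w|) <= e.
Proof.
move=> h; have [mt it] := tailE s.
have md : measurable_fun setT (fun w => \sum_(a <- enum_fset s) g a w - U w).
  apply: measurable_funB => //.
  by apply: measurable_sum => a; exact: L1_meas (lg a).
have le : (\int[P]_w (`|\sum_(a <- enum_fset s) g a w - U w|)%:E <= e%:E)%E.
  apply: le_trans h; rewrite -it; apply: ae_ge0_le_integral => //.
  - by apply/measurable_EFinP; exact: measurableT_comp.
  - by move=> w _; apply: esum_ge0.
  - by apply: filterS (U_tail s) => w + _.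
have l1 : L1 P (fun w => \sum_(a <- enum_fset s) g a w - U w).
  apply/integrableP; split; first exact/measurable_EFinP.
  exact: le_lt_trans le (ltry e).
by split => //; rewrite -lee_fin EFin_Ex//; exact: L1_norm.
Qed.

Lemma usum_L1 : L1 P U.
Proof.
have f0 : (\esum_(a in ~` [set` fset0]) (Ex P (fun w => `|g a w|))%:E < +oo)%E.
  by apply: le_lt_trans g_sum; rewrite (esum_split fset0) ?leeDr// => [|a];
    rewrite ?big_nil// lee_fin Ex_ge0.
have ff : (\esum_(a in ~` [set` fset0]) (Ex P (fun w => `|g a w|))%:E)%E \is a fin_num.
  by rewrite ge0_fin_numE// esum_ge0// => a _; rewrite lee_fin Ex_ge0.
(* Over the empty set the partial sum is 0, so the integrable difference is minus the unordered sum
   itself. *)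
have [] := @usum_L1_approx fset0 (fine (\esum_(a in ~` [set` fset0]) (Ex P (fun w => `|g a w|))%:E)%E).
  by rewrite fineK.
move=> /L1N; under [X in L1 P X]eq_fun do rewrite big_nil sub0r opprK.
by [].
Qed.

Lemma usum_approx e : 0 < e -> exists s0, forall s, (s0 `<=` s)%fset ->
  Ex P (fun w => `|\sum_(a <- enum_fset s) g a w - U w|) <= e.
Proof.
move=> e0; have [|s0 H] := @esum_tail _ e _ g_sum e0.
  by move=> a; rewrite lee_fin Ex_ge0.
by exists s0 => s /H /usum_L1_approx[].
Qed.

End integral.
End unordered_sums.

Lemma lipschitz_L1 d (T : measurableType d) (R : realType) (P : probability T R)
    (h : R -> R) (f : T -> R) :
  (forall y z, `|h y - h z| <= `|y - z|) -> L1 P f -> L1 P (fun w => h (f w)).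
Proof.
move=> hL lf; have mh : measurable_fun setT h.
  by apply: continuous_measurable_fun; exact: lipschitz_continuous.
apply: (@L1_le _ _ _ P (fun w => `|f w| + `|h 0|)).
- by apply: measurableT_comp => //; exact: L1_meas lf.
- move=> w; have := hL (f w) 0; rewrite subr0 => le.
  by rewrite -[h (f w)](subrK (h 0)) (le_trans (ler_normD _ _))// lerD2r.
- by apply: L1D; [exact: L1_norm|exact: L1_cst].
Qed.

(** * Resampling differences and the carré du champ *)

Section carre_du_champ.
Context d (Omega : measurableType d) (R : realType) (P : probability Omega R).
Context (A : countType) (E : A -> ptopologicalType) (E0 : ptopologicalType).
Variables (X : forall a, {RV P >-> borel (E a)}) (Z : {RV P >-> borel E0}).
Variable X' : forall a, {RV P >-> borel (E a)}.
Hypotheses (indepX : cond_independent X Z) (copyX' : cond_copies X Z X').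

Local Notation S := (EAZ E E0).
Local Notation mu := (joint_law X Z).
Local Notation joint := (joint X Z).
Local Notation resample := (resample X Z X').
Local Notation V := (L2space mu).
Local Notation cls := (l2cls mu).
Local Notation ip := (@l2ip _ _ _ mu).
Local Notation nrm := (nrm (@l2ip _ _ _ mu)).
Local Notation Q := (condexpX (X := X) (Z := Z)).
Local Notation coD := (coD (X := X) (Z := Z)).
Local Notation lw := (joint_has_law X Z).
Local Notation rep := (rep P (mu := mu) joint).
Local Notation dl := (Delta X Z X').
Local Notation G0 := (calG X Z set0).
Let lwr a := resample_has_law indepX copyX' a.
Let sg : sigma_algebra setT G0 := sigma_calG X Z set0.
Let gm : G0 `<=` measurable := @calG_meas _ _ _ _ _ _ _ X Z set0.

Let coDE' a (z : V) : coD a z = z - Q a z := erefl.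

Lemma adapted_functional (x : S -> R) : measurable_fun setT x -> adapted G0 (fun w => x (joint w)).
Proof.
move=> mx; rewrite calGE; apply: adapted_joint; rewrite sG0_measurable => D mD.
by rewrite -[_ @^-1` _]setTI; exact: mx.
Qed.

Lemma functional_ofP F x : rep F x -> represents X Z (functional_of X Z F) F.
Proof.
move=> [lF Fx]; apply: (@xgetPex _ (cst 0) [set f | represents X Z f F]).
by exists (x : S -> R); split; first exact: L2_meas (l2val x).
Qed.

Lemma replace_rep a F x : rep F x -> {ae P, forall w, replace X Z X' a F w = x (resample a w)}.
Proof.
move=> Fx; have [mf Ff] := functional_ofP Fx; have mx := L2_meas (l2val x).
apply: (law_ae (lwr a) (p := fun z => functional_of X Z F z = x z)).
apply: (law_ae_eq lw mf mx).
by apply: filterS2 Ff Fx.2 => w <- <-.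
Qed.

Lemma Delta_rep a F x : rep F x -> {ae P, forall w, dl a F w = x (joint w) - x (resample a w)}.
Proof. by move=> Fx; apply: filterS2 Fx.2 (replace_rep a Fx) => w; rewrite /Delta/= => -> ->. Qed.

Lemma replace_L2 a F x : rep F x -> L2 P (replace X Z X' a F).
Proof.
move=> Fx; apply: (ae_eq_L2 _ _ (pull_L2 (lwr a) x)).
  exact: (measurableT_comp (functional_ofP Fx).1 (measurable_resample X Z X' a)).
by apply: filterS (replace_rep a Fx) => w ->.
Qed.

Lemma Delta_L2 a F x : rep F x -> L2 P (dl a F).
Proof. by move=> Fx; apply: L2B; [exact: Fx.1|exact: replace_L2 Fx]. Qed.

(** Of the four terms of the expanded product, the two diagonal ones equal <x, y> because both maps
    have the same law, and the two mixed ones equal <x, Q a y> by symmetry of [Q a]. *)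
Lemma Ex_Delta a F G x y : rep F x -> rep G y ->
  Ex P (fun w => dl a F w * dl a G w) = 2 * ip x (coD a y).
Proof.
move=> Fx Gy.
have lj (z : V) : L2 P (fun w => z (joint w)) := pull_L2 lw z.
have lr (z : V) : L2 P (fun w => z (resample a w)) := pull_L2 (lwr a) z.
have dE F' x' : rep F' x' -> L2 P (fun w => x' (joint w) - x' (resample a w)).
  by move=> _; exact: L2B.
rewrite (ae_Ex_mul (Delta_L2 a Fx) (dE _ _ Fx) (Delta_L2 a Gy) (dE _ _ Gy) (Delta_rep a Fx) (Delta_rep a Gy)).
transitivity (Ex P (fun w => x (joint w) * y (joint w)) - Ex P (fun w => x (joint w) * y (resample a w))
   - (Ex P (fun w => y (joint w) * x (resample a w)) - Ex P (fun w => x (resample a w) * y (resample a w)))).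
  have m1 := L2_mul (lj x) (lj y); have m2 := L2_mul (lj x) (lr y).
  have m3 := L2_mul (lj y) (lr x); have m4 := L2_mul (lr x) (lr y).
  rewrite -(ExB m1 m2) -(ExB m3 m4) -(ExB (L1B m1 m2) (L1B m3 m4)).
  by congr Ex; apply/funext => w; ring.
rewrite (Ex_joint_resample indepX copyX') (Ex_joint_resample indepX copyX').
rewrite (rep_Ex lw (rep_pull lw x) (rep_pull lw y)).
rewrite (rep_Ex (lwr a) (rep_pull (lwr a) x) (rep_pull (lwr a) y)).
have ipP : inner_product ip := @l2ipP _ _ _ mu.
rewrite (ipBr ipP) (ipC ipP y) (condexpX_sym a x y).
by move: (ip x y) (ip x (Q a y)) => u v; ring.
Qed.

Lemma condexp_norm_le (f : Omega -> R) Y : L1 P f -> is_condexp P G0 f Y ->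
  Ex P (fun w => `|Y w|) <= Ex P (fun w => `|f w|).
Proof.
move=> lf fY; have lY := is_condexp_L1 fY; have aY := is_condexp_adapted fY.
pose H w := Num.sg (Y w).
have aH : adapted G0 H by exact: (adapted_comp sg (@measurable_sg R) aY).
have bH w : `|H w| <= 1 by rewrite normr_sg; case: (Y w != 0).
have mH := adapted_meas gm aH.
have lH u : L1 P u -> L1 P (fun w => u w * H w).
  by move=> lu; have := L1_mul_bounded mH bH lu; under [X in L1 _ X]eq_fun do rewrite mulrC.
have -> : Ex P (fun w => `|Y w|) = Ex P (fun w => Y w * H w).
  by congr Ex; apply/funext => w; rewrite /H mulrC -normrEsg.
rewrite (condexp_pullout sg gm lf fY aH (lH _ lf) (lH _ lY)).
apply: le_Ex; [exact: lH|exact: L1_norm|move=> w].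
by rewrite (le_trans (ler_norm _))// normrM ler_piMr.
Qed.

Section integration_by_parts.
Variables (F G : Omega -> R) (x g : V).
Hypotheses (Fx : rep F x) (Gg : rep G g).
Hypotheses (x0 : proj ip Q coD 0 x = 0) (xg : is_linv ip Q coD x g).

(** Half the sum is the inner product of the partial sum of the D a g with [y], and those partial
    sums converge to [x]. Keeping finite sets allows a common choice of [s] with the approximation
    of Gamma. *)
Lemma ibp_approx H y e : rep H y -> 0 < e -> exists s0 : {fset A}, forall s, (s0 `<=` s)%fset ->
  `|Ex P (fun w => F w * H w) -
    2^-1 * \sum_(a <- enum_fset s) Ex P (fun w => dl a G w * dl a H w)| <= e.
Proof.
move=> Hy e0; have ipP : inner_product ip := @l2ipP _ _ _ mu.
have c0 : 0 < nrm y + 1 by rewrite ltr_wpDl ?(nrm_ge0 ip).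
have [s0 Hs] := partialL_linvX indepX x0 xg (divr_gt0 e0 c0).
exists s0 => s ss; have {}Hs := Hs s ss.
have -> : 2^-1 * \sum_(a <- enum_fset s) Ex P (fun w => dl a G w * dl a H w) =
    ip (partialL coD (enum_fset s) g) y.
  rewrite /partialL (ip_suml ipP) mulr_sumr; apply: eq_bigr => a _.
  rewrite (Ex_Delta a Gg Hy) mulrA mulVf// mul1r coDE' coDE' (ipBr ipP) (ipBl ipP).
  by rewrite condexpX_sym.
rewrite (rep_Ex lw Fx Hy) -(ipBl ipP).
have := cauchy_schwarz ipP (x - partialL coD (enum_fset s) g) y.
rewrite (nrmB ipP) => h; apply: le_trans h _.
apply: le_trans (ler_wpM2r (nrm_ge0 _ _) Hs) _.
by rewrite mulrAC -mulrA ler_piMr ?(ltW e0)// ler_pdivrMr// mul1r lerDl.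
Qed.

Lemma sum_Delta_linv s : \sum_(a <- enum_fset s) Ex P (fun w => dl a G w ^+ 2) <= 2 * Ex P (fun w => F w ^+ 2).
Proof.
have ipP : inner_product ip := @l2ipP _ _ _ mu.
have -> : Ex P (fun w => F w ^+ 2) = nrm x ^+ 2.
  by rewrite -(rep_nrm lw Fx) sqr_sqrtr// Ex_ge0// => w; exact: sqr_ge0.
apply: le_trans (ler_wpM2l _ (sum_D_linvX indepX s x0 xg)) => //.
rewrite mulr_sumr; apply: ler_sum => a _.
rewrite (_ : (fun w => _) = fun w => dl a G w * dl a G w); last first.
  by apply/funext => w; rewrite expr2.
rewrite (Ex_Delta a Gg Gg) ler_wpM2l// le_eqVlt; apply/orP; left; apply/eqP.
rewrite coDE' !(ipBr ipP) !(ipBl ipP) condexpX_sym condexpX_sym.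
by rewrite (condexpX_idem a g) [X in _ = _ - _ - X]subrr subr0.
Qed.

End integration_by_parts.

Section stein_bound.
Variables (F G : Omega -> R) (x g : V).
Hypotheses (Fx : rep F x) (Gg : rep G g).
Hypotheses (x0 : proj ip Q coD 0 x = 0) (xg : is_linv ip Q coD x g).
Hypothesis Gamma_sum :
  (\esum_(a in [set: A]) (Ex P (fun w => `|dl a F w * dl a G w|))%:E < +oo)%E.

Let L2F : L2 P F := Fx.1.
Let L2dF a : L2 P (dl a F) := Delta_L2 a Fx.
Let L2dG a : L2 P (dl a G) := Delta_L2 a Gg.
Let L1FG a : L1 P (fun w => dl a F w * dl a G w) := L2_mul (L2dF a) (L2dG a).
Let gam a := condexp P G0 (fun w => dl a F w * dl a G w).
Let gamP a : is_condexp P G0 (fun w => dl a F w * dl a G w) (gam a) := condexpP sg gm (L1FG a).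
Let L1gam a : L1 P (gam a) := is_condexp_L1 (gamP a).
Let Gam := Gamma X Z X' F G.

Let gam_sum : (\esum_(a in [set: A]) (Ex P (fun w => `|gam a w|))%:E < +oo)%E.
Proof.
apply: le_lt_trans Gamma_sum; apply: le_esum => a _.
by rewrite lee_fin; exact: condexp_norm_le (L1FG a) (gamP a).
Qed.

Lemma Gamma_L1 : L1 P Gam.
Proof. exact: L1Z (usum_L1 L1gam gam_sum). Qed.

(** As [H] is bounded and measurable for sigma(X, Z), the conditional expectation inside each term
    of Gamma can be removed, and the L^1 error of the finite sums is multiplied by at most [K]. *)
Lemma Ex_Gamma_approx (H : Omega -> R) K e : adapted G0 H -> 0 <= K -> (forall w, `|H w| <= K) ->
  0 < e ->
  exists s0 : {fset A}, forall s, (s0 `<=` s)%fset ->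
  `|Ex P (fun w => H w * Gam w) -
    2^-1 * \sum_(a <- enum_fset s) Ex P (fun w => H w * (dl a F w * dl a G w))| <= e.
Proof.
move=> aH K0 bH e0; have mH := adapted_meas gm aH.
have c0 : 0 < K + 1 by rewrite ltr_wpDl.
have [s0 Hs] := usum_approx L1gam gam_sum (divr_gt0 e0 c0).
exists s0 => s /Hs {}Hs.
have lH u : L1 P u -> L1 P (fun w => H w * u w) by move=> lu; exact: (L1_mul_bounded mH bH lu).
have E1 a : Ex P (fun w => H w * (dl a F w * dl a G w)) = Ex P (fun w => H w * gam a w).
  have C (u v : Omega -> R) : Ex P (fun w => u w * v w) = Ex P (fun w => v w * u w).
    by congr Ex; apply/funext => w; rewrite mulrC.
  have lH' u : L1 P u -> L1 P (fun w => u w * H w).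
    by move=> /lH; under [X in L1 _ X]eq_fun do rewrite mulrC.
  rewrite C (C H (gam a)); apply/esym.
  by apply: (condexp_pullout sg gm (L1FG a) (gamP a) aH); exact: lH'.
have lU := usum_L1 L1gam gam_sum.
have lS : L1 P (fun w => \sum_(a <- enum_fset s) gam a w) by exact: L1_sum.
have -> : Ex P (fun w => H w * Gam w) -
    2^-1 * \sum_(a <- enum_fset s) Ex P (fun w => H w * (dl a F w * dl a G w)) =
    - (2^-1 * Ex P (fun w => H w * (\sum_(a <- enum_fset s) gam a w - usum (fun a => gam a w)))).
  have -> : Ex P (fun w => H w * Gam w) = 2^-1 * Ex P (fun w => H w * usum (fun a => gam a w)).
    rewrite -ExZ; last exact: lH.
    by congr Ex; apply/funext => w; rewrite /Gam /Gamma mulrCA.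
  have -> : \sum_(a <- enum_fset s) Ex P (fun w => H w * (dl a F w * dl a G w)) =
      Ex P (fun w => H w * \sum_(a <- enum_fset s) gam a w).
    under eq_bigr do rewrite E1.
    rewrite -Ex_sum; last by move=> a; exact: lH.
    by congr Ex; apply/funext => w; rewrite mulr_sumr.
  have -> : Ex P (fun w => H w * (\sum_(a <- enum_fset s) gam a w - usum (fun a => gam a w))) =
      Ex P (fun w => H w * \sum_(a <- enum_fset s) gam a w) - Ex P (fun w => H w * usum (fun a => gam a w)).
    rewrite -(ExB (lH _ lS) (lH _ lU)).
    by congr Ex; apply/funext => w; rewrite mulrBr.
  by move: (Ex P _) (Ex P _) => u v; ring.
have lD : L1 P (fun w => \sum_(a <- enum_fset s) gam a w - usum (fun a => gam a w)) by exact: L1B.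
rewrite normrN normrM ger0_norm ?invr_ge0//.
have h1 := le_norm_Ex (lH _ lD).
have h2 : Ex P (fun w => `|H w * (\sum_(a <- enum_fset s) gam a w - usum (fun a => gam a w))|) <=
    K * (e / (K + 1)).
  apply: le_trans (ler_wpM2l K0 Hs); rewrite -ExZ; last exact: L1_norm.
  apply: le_Ex; [exact/L1_norm/lH|by apply: L1Z; exact: L1_norm|move=> w].
  by rewrite normrM ler_wpM2r.
have h3 : K * (e / (K + 1)) <= e.
  by rewrite mulrCA ler_piMr ?(ltW e0)// ler_pdivrMr// mul1r lerDl.
have := le_trans h1 (le_trans h2 h3).
move: `|Ex P _| (normr_ge0 (Ex P (fun w => H w * (\sum_(a <- enum_fset s) gam a w - usum (fun a => gam a w))))) => u _.
lra.
Qed.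

(** The approximation of Gamma with H = 1 and the integration by parts with H = F involve the same
    finite sums. *)
Lemma Ex_Gamma : Ex P Gam = Ex P (fun w => F w ^+ 2).
Proof.
apply/eqP; rewrite -subr_eq0 -normr_eq0 eq_le normr_ge0 andbT.
apply/ler_addgt0Pr => e e0; rewrite add0r; have e2 : 0 < e / 2 by rewrite divr_gt0.
have a1 : adapted G0 (cst 1 : Omega -> R) by apply/(adaptedP sg); exact: measurable_cst.
have [|s1 H1] := @Ex_Gamma_approx (cst 1) 1 _ a1 ler01 _ e2; first by move=> w; rewrite normr1.
have [s2 H2] := ibp_approx Fx Gg x0 xg Fx e2.
have := H1 (s1 `|` s2)%fset (fsubsetUl _ _); have := H2 (s1 `|` s2)%fset (fsubsetUr _ _).
have -> : Ex P (fun w => cst 1 w * Gam w) = Ex P Gam by congr Ex; apply/funext => w; rewrite mul1r.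
have -> : Ex P (fun w => F w * F w) = Ex P (fun w => F w ^+ 2).
  by congr Ex; apply/funext => w; rewrite expr2.
under eq_bigr do under [X in Ex P X]eq_fun do rewrite mulrC.
under [in X in _ -> X -> _]eq_bigr do under [X in Ex P X]eq_fun do rewrite mul1r.
rewrite !ler_norml => /andP[? ?] /andP[? ?]; apply/andP; split; lra.
Qed.

(** * The bound for one test function *)

Lemma stein_bound (h : R -> R) (t : R) : (forall y z, `|h y - h z| <= `|y - z|) ->
  (\esum_(a in [set: A]) \int[P]_w (`|dl a G w| * dl a F w ^+ 2)%:E <= t%:E)%E ->
  `|Ex P (fun w => h (F w)) - \int[@lebesgue_measure R]_y (h y * ndens y)| <=
  Num.sqrt (2 / pi) * Ex P (fun w => `|Gam w - 1|) + 2^-1 * t.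
Proof.
move=> hL ht; set Nh := \int[_]_y _; set c := Num.sqrt _.
have [f [f' [fd fe [fb f'b] ft]]] := stein_solution hL.
have cf : continuous f by exact: is_derive_continuous fd.
have ch : continuous h by exact: lipschitz_continuous.
have mf : measurable_fun setT f by exact: continuous_measurable_fun.
have mh : measurable_fun setT h by exact: continuous_measurable_fun.
have f'E y : f' y = y * f y + (h y - Nh) by rewrite -fe; lra.
have mf' : measurable_fun setT f'.
  rewrite (_ : f' = fun y => y * f y + (h y - Nh)); last by apply/funext.
  by apply: measurable_funD; [exact: measurable_funM|exact: measurable_funB].
have mF := L2_meas L2F; have mx := L2_meas (l2val x).
have c0 : 0 <= c by exact: sqrtr_ge0.
have lfx : L2 mu (fun z => f (x z)).
  by apply: (@L2_bounded _ _ _ mu _ 1) => //; exact: measurableT_comp.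
have lfF : L2 P (fun w => f (F w)).
  by apply: (@L2_bounded _ _ _ P _ 1) => //; exact: measurableT_comp.
pose y := cls (fun z => f (x z)).
have Hy : rep (fun w => f (F w)) y.
  split => //; apply: filterS2 Fx.2 (cls_pull lw lfx) => w e1 e2.
  by rewrite e2 e1.
have L2df a := Delta_L2 a Hy.
(* The representing class replaces [F], which is only almost surely equal to a variable measurable
   for sigma(X, Z). *)
pose fF' w := f' (x (joint w)).
have aF' : adapted G0 fF' by apply: (adapted_functional (x := fun z => f' (x z))); exact: measurableT_comp.
have bF' w : `|fF' w| <= c by exact: f'b.
have mF' := adapted_meas gm aF'.
(* The Taylor remainder of [f] between the original and the resampled value of [F], almost surely at
   most the square of their difference. The linear part is what pairs with Gamma. *)
pose rho a w := fF' w * dl a F w - dl a (fun w => f (F w)) w.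
have L2rho a : L2 P (rho a) by apply: L2B => //; exact: (L2_mul_bounded mF' bF').
have rho_le a : {ae P, forall w, `|rho a w| <= dl a F w ^+ 2}.
  have e1 := Delta_rep a Fx; have e2 := Delta_rep a Hy.
  have e3 := cls_pull lw lfx; have e4 := cls_pull (lwr a) lfx.
  have e5 : {ae P, forall w, dl a (fun w => f (F w)) w = f (x (joint w)) - f (x (resample a w))}.
    by apply: filterS3 e2 e3 e4 => w -> -> ->.
  apply: filterS2 e1 e5 => w d1 d2.
  rewrite /rho d2 d1 /fF'; move: (ft (x (joint w)) (x (resample a w))).
  move: (x (joint w)) (x (resample a w)) => u v.
  rewrite (_ : f v - f u - f' u * (v - u) = f' u * (u - v) - (f u - f v)); last by ring.
  by have -> : (v - u) ^+ 2 = (u - v) ^+ 2 by ring.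
have L1Grho a : L1 P (fun w => dl a G w * rho a w) by exact: L2_mul.
have rho_sum s : \sum_(a <- enum_fset s) `|Ex P (fun w => dl a G w * rho a w)| <= t.
  rewrite -lee_fin -sumEFin; apply: le_trans ht.
  apply: le_trans (sum_le_esum s _); last first.
    by move=> a; apply: integral_ge0 => w _; rewrite lee_fin mulr_ge0// sqr_ge0.
  apply: lee_sum => a _.
  apply: (@le_trans _ _ (Ex P (fun w => `|dl a G w * rho a w|))%:E).
    by rewrite lee_fin; exact: le_norm_Ex.
  rewrite EFin_Ex; last exact: L1_norm.
  apply: ae_ge0_le_integral => //.
  - by apply/measurable_EFinP; apply: measurableT_comp => //; exact: L1_meas (L1Grho a).
  - by move=> w _; rewrite lee_fin mulr_ge0// sqr_ge0.
  - apply/measurable_EFinP; apply: measurable_funM.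
      by apply: measurableT_comp => //; exact: L2_meas (L2dG a).
    by apply: measurable_funX; exact: L2_meas (L2dF a).
  - by apply: filterS (rho_le a) => w + _; rewrite lee_fin normrM => /ler_wpM2l; apply.
have split_a a : Ex P (fun w => dl a G w * dl a (fun w => f (F w)) w) =
    Ex P (fun w => fF' w * (dl a F w * dl a G w)) - Ex P (fun w => dl a G w * rho a w).
  rewrite -(ExB (L1_mul_bounded mF' bF' (L1FG a)) (L1Grho a)).
  by congr Ex; apply/funext => w; rewrite /rho; ring.
have L1F' : L1 P fF' by apply: L2_L1; exact: (@L2_bounded _ _ _ P _ c).
have L1Gam := Gamma_L1.
have L1Gam1 : L1 P (fun w => Gam w - 1) by apply: L1B => //; exact: L1_cst.
have L1Ff : L1 P (fun w => F w * f (F w)) by exact: L2_mul.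
have L1h := lipschitz_L1 hL (L2_L1 L2F).
have E1 : Ex P (fun w => h (F w)) - Nh = Ex P fF' - Ex P (fun w => F w * f (F w)).
  rewrite -[X in _ - X](Ex_cst P Nh) -(ExB L1h (L1_cst P Nh)) -(ExB L1F' L1Ff).
  apply: ae_eq_Ex.
  - exact: L1_meas (L1B L1h (L1_cst P Nh)).
  - exact: L1_meas (L1B L1F' L1Ff).
  - by apply: filterS Fx.2 => w e; rewrite /fF' -e f'E /=; lra.
have L1FG' : L1 P (fun w => fF' w * Gam w) by exact: (L1_mul_bounded mF' bF' L1Gam).
have E2 : `|Ex P fF' - Ex P (fun w => fF' w * Gam w)| <= c * Ex P (fun w => `|Gam w - 1|).
  rewrite -(ExB L1F' L1FG') -ExZ; last exact: L1_norm.
  apply: le_trans (le_norm_Ex (L1B L1F' L1FG')) _.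
  apply: le_Ex; [exact: L1_norm (L1B L1F' L1FG')|by apply: L1Z; exact: L1_norm|move=> w].
  rewrite -[X in X - _]mulr1 -mulrBr normrM (distrC 1).
  exact: ler_wpM2r.
apply/ler_addgt0Pr => e e0; have e2 : 0 < e / 2 by rewrite divr_gt0.
have [s1 H1] := Ex_Gamma_approx aF' c0 bF' e2.
have [s2 H2] := ibp_approx Fx Gg x0 xg Hy e2.
set s := (s1 `|` s2)%fset.
have {}H1 := H1 s (fsubsetUl _ _); have {}H2 := H2 s (fsubsetUr _ _).
have {}rho_sum := rho_sum s.
have rs := ler_norm_sum (enum_fset s) (fun a => Ex P (fun w => dl a G w * rho a w)) xpredT.
have sE : \sum_(a <- enum_fset s) Ex P (fun w => dl a G w * dl a (fun w => f (F w)) w) =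
   \sum_(a <- enum_fset s) Ex P (fun w => fF' w * (dl a F w * dl a G w)) -
   \sum_(a <- enum_fset s) Ex P (fun w => dl a G w * rho a w).
  by rewrite -sumrB; apply: eq_bigr => a _; exact: split_a.
rewrite sE in H2; rewrite E1.
have := le_trans rs rho_sum; move: H1 H2 E2.
move: (Ex P fF') (Ex P (fun w => fF' w * Gam w)) (Ex P (fun w => F w * f (F w))).
move: (\sum_(a <- s) Ex P (fun w => fF' w * (dl a F w * dl a G w))).
move: (\sum_(a <- s) Ex P (fun w => dl a G w * rho a w)) (c * _) => q k p u v z.
rewrite !ler_norml => /andP[? ?] /andP[? ?] /andP[? ?] /andP[? ?]; apply/andP; split; lra.
Qed.

End stein_bound.

(** Only almost sure, because the functionals representing [F] and its opposite are chosen
    independently. *)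
Lemma Delta_opp a F x : rep F x ->
  {ae P, forall w, dl a (\- F) w = - dl a F w}.
Proof.
move=> Fx; have e1 := Delta_rep a Fx.
have e2 := Delta_rep a (repN lw Fx).
have lN := L2N (l2val x).
have xE : - x = cls (fun z => - x z) by rewrite -{1}(l2clsV x) l2clsN//; exact: l2val.
rewrite xE in e2.
have e3 := cls_pull lw lN; have e4 := cls_pull (lwr a) lN.
have e5 : {ae P, forall w, dl a (\- F) w = - x (joint w) - - x (resample a w)}.
  by apply: filterS3 e2 e3 e4 => w h1 <- <-.
by apply: filterS2 e1 e5 => w -> ->; rewrite opprK opprB addrC.
Qed.

Lemma usumN (u v : A -> R) : (forall a, u a = - v a) -> usum u = - usum v.
Proof.
move=> uv; rewrite /usum opprB; congr (fine _ - fine _); apply: eq_esum => a _; congr EFin.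
  by rewrite /funrpos /funrneg uv.
by rewrite /funrpos /funrneg uv opprK.
Qed.

(** Each coordinate has its own exceptional null set; countability of the index set lets them be
    collected into one. *)
Lemma Gamma_opp F G x g : rep F x -> rep G g ->
  {ae P, forall w, Gamma X Z X' F G w = - Gamma X Z X' F (\- G) w}.
Proof.
move=> Fx Gg; pose f a w := dl a F w * dl a G w; pose f' a w := dl a F w * dl a (\- G) w.
have L1f a : L1 P (f a) := L2_mul (Delta_L2 a Fx) (Delta_L2 a Gg).
have L1f' a : L1 P (f' a) := L2_mul (Delta_L2 a Fx) (Delta_L2 a (repN lw Gg)).
have c a : {ae P, forall w, condexp P G0 (f a) w = - condexp P G0 (f' a) w}.
  have cf := condexpP sg gm (L1f a); have cf' := condexpP sg gm (L1f' a).
  have cN : is_condexp P G0 (fun w => -1 * f' a w + cst 0 w) (fun w => -1 * condexp P G0 (f' a) w + cst 0 w).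
    apply: (is_condexp_lin sg gm) => //; first exact: L1_cst.
    apply: (is_condexp_adapted_id gm); first exact: L1_cst.
    by apply/(adaptedP sg); exact: measurable_cst.
  have L1N' : L1 P (fun w => -1 * f' a w + cst 0 w).
    by apply: L1D; [exact: L1Z|exact: L1_cst].
  have ff : {ae P, forall w, f a w = -1 * f' a w + cst 0 w}.
    by apply: filterS (Delta_opp a Gg) => w e; rewrite /f /f' e /=; ring.
  apply: filterS (condexp_ae_unique sg gm (L1f a) L1N' ff cf cN) => w ->.
  by rewrite /= addr0 mulN1r.
have cc : {ae P, forall w (n : nat), oapp (fun a => condexp P G0 (f a) w = - condexp P G0 (f' a) w)
    True (@choice.pickle_inv A n)}.
  apply: ae_foralln => n; case: (@choice.pickle_inv A n) => [a|] /=; last exact: aeW.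
  exact: c.
apply: filterS cc => w h; rewrite /Gamma -mulrN; congr (_ * _); apply: usumN => a.
by have := h (choice.pickle a); rewrite choice.pickleK_inv.
Qed.

(** A bounded function of Z has the same inner product with [F] as with the conditional expectation
    of [F] given Z, which vanishes. *)
Lemma centered_rep F x : rep F x -> {ae P, forall w, condexp P (sigmaZ Z) F w = 0} ->
  proj ip Q coD 0 x = 0.
Proof.
move=> Fx F0; apply: (centered_proj0 indepX) => k hk.
have sz := sigma_sigmaZ Z; have zm := @sigmaZ_meas _ _ _ _ _ Z.
have [ak [M kM]] := hk; have lx := l2val x.
have mk := adapted_meas (@sZ_meas A E E0) ak.
have lk : L2 mu k by exact: L2_bounded mk kM.
have lxk := L2_mul lx lk.
have lkj : L2 P (fun w => k (joint w)) by exact: (proj1 (law_L2 lw mk)).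
have akj : adapted (sigmaZ Z) (fun w => k (joint w)).
  by rewrite (sigmaZE X Z); exact: adapted_joint.
rewrite -(law_Ex lw (L1_meas lxk) lxk).
have e1 := ae_Ex_mul (pull_L2 lw x) Fx.1 lkj lkj (filterS (fun w e => esym e) Fx.2) (aeW P (fun=> erefl)).
have cF := condexpP sz zm (L2_L1 Fx.1).
have lcF := (condexp_L2 sz zm Fx.1 cF).1.
rewrite e1 -(condexp_proj sz zm Fx.1 cF lkj akj).
rewrite (ae_Ex_mul lcF (L2_cst P 0) lkj lkj F0 (aeW P (fun=> erefl))).
by rewrite -[RHS](Ex_cst P 0); congr Ex; apply/funext => w; rewrite mul0r.
Qed.

End carre_du_champ.

(** Stated in the extended reals: the second moment may be infinite, in which case the bound is
    trivial. *)
Lemma le_norm_sqrt_integral d (T : measurableType d) (R : realType) (P : probability T R) (f : T -> R) :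
  L1 P f -> ((Ex P (fun w => `|f w|))%:E <= sqrte (\int[P]_w (f w ^+ 2)%:E))%E.
Proof.
move=> lf; have mf := L1_meas lf.
have [fin|] := ltP (\int[P]_w (f w ^+ 2)%:E)%E +oo%E; last first.
  by rewrite leye_eq => /eqP ->; rewrite leey.
have l2 : L2 P f.
  split => //; apply/integrableP; split; first by apply/measurable_EFinP; exact: measurable_funX.
  by under eq_integral do rewrite /= ger0_norm ?sqr_ge0//.
rewrite -EFin_Ex; last by case: l2.
by rewrite lee_fin; exact: Ex_norm_le_sqrt.
Qed.

(* Optimization over [l] of the arithmetic-geometric bound [|u| v <= l/2 u^2 + v^2/(2l)]. *)
Lemma le_optimize (R : realType) (s t : R) : 0 <= t ->
  (forall l, 0 < l -> s <= l + t / (2 * l)) -> s <= Num.sqrt 2 * Num.sqrt t.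
Proof.
move=> t0 H; move: t0; rewrite le_eqVlt => /orP[/eqP t0|t0].
  rewrite -t0 sqrtr0 mulr0; apply/ler_addgt0Pr => e e0.
  by have := H _ e0; rewrite -t0 mul0r addr0 add0r.
set q := Num.sqrt 2 : R; set r := Num.sqrt t.
have q0 : 0 < q by rewrite sqrtr_gt0.
have r0 : 0 < r by rewrite sqrtr_gt0.
have q2 : q * q = 2 by rewrite -expr2 sqr_sqrtr.
have tE : t = r * r by rewrite -expr2 sqr_sqrtr// ltW.
(* The minimizer sqrt(t/2), at which both terms are equal. *)
have := H (r / q) (divr_gt0 r0 q0); rewrite tE.
suff -> : r / q + r * r / (2 * (r / q)) = q * r by [].
have -> : r * r / (2 * (r / q)) = r * q / 2.
  by field; rewrite !gt_eqF.
have -> : r / q = r * q / 2 by rewrite -q2; field; exact: lt0r_neq0.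
by field.
Qed.

(** * The two bounds on the Wasserstein distance *)

Section normal_approximation.
Context d (Omega : measurableType d) (R : realType) (P : probability Omega R).
Context (A : countType) (E : A -> ptopologicalType) (E0 : ptopologicalType).
Variables (X : forall a, {RV P >-> borel (E a)}) (Z : {RV P >-> borel E0}).
Variable X' : forall a, {RV P >-> borel (E a)}.
Hypotheses (indepX : cond_independent X Z) (copyX' : cond_copies X Z X').
Variable F : Omega -> R.

Local Notation mu := (joint_law X Z).
Local Notation joint := (joint X Z).
Local Notation V := (L2space mu).
Local Notation ip := (@l2ip _ _ _ mu).
Local Notation nrm := (nrm (@l2ip _ _ _ mu)).
Local Notation Q := (condexpX (X := X) (Z := Z)).
Local Notation coD := (coD (X := X) (Z := Z)).
Local Notation lw := (joint_has_law X Z).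
Local Notation rep := (rep P (mu := mu) joint).
Local Notation dl := (Delta X Z X').
Local Notation G := (\- Linv X Z F).

Variables (x g : V).
Hypotheses (Fx : rep F x) (x0 : proj ip Q coD 0 x = 0) (xg : is_linv ip Q coD x g).
Hypothesis F_Gamma : Gamma_defined X Z X' F (Linv X Z F).

Let Lg : rep (Linv X Z F) (- g) := rep_Linv indepX Fx xg.

Let Gg : rep G g.
Proof. by have := repN lw Lg; rewrite opprK. Qed.

Let DG a : {ae P, forall w, dl a G w = - dl a (Linv X Z F) w} := Delta_opp indepX copyX' a Lg.
Let L2dF a : L2 P (dl a F) := Delta_L2 indepX copyX' a Fx.
Let L2dG a : L2 P (dl a G) := Delta_L2 indepX copyX' a Gg.
Let L2dL a : L2 P (dl a (Linv X Z F)) := Delta_L2 indepX copyX' a Lg.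

(** Serves for both signs of the inverse, whose resampling differences have the same modulus almost
    surely. *)
Let Gamma_sum (H : Omega -> R) :
  (forall a, {ae P, forall w, `|dl a H w| = `|dl a (Linv X Z F) w|}) -> (forall a, L2 P (dl a H)) ->
  (\esum_(a in [set: A]) (Ex P (fun w => `|dl a F w * dl a H w|))%:E < +oo)%E.
Proof.
move=> HL L2H; apply: le_lt_trans F_Gamma; rewrite le_eqVlt; apply/orP; left; apply/eqP.
apply: eq_esum => a _; have l1 := L2_mul (L2dF a) (L2H a).
rewrite unlock EFin_Ex; last exact: L1_norm.
apply: ae_eq_integral => //.
- by apply/measurable_EFinP; apply: measurableT_comp => //; exact: L1_meas l1.
- by apply/measurable_EFinP; apply: measurableT_comp => //; exact: L1_meas (L2_mul (L2dF a) (L2dL a)).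
- by apply: filterS (HL a) => w e _; rewrite !normrM e.
Qed.

Let DGn a : {ae P, forall w, `|dl a G w| = `|dl a (Linv X Z F) w|}.
Proof. by apply: filterS (DG a) => w ->; rewrite normrN. Qed.

Let sumG := Gamma_sum DGn L2dG.
Let sumL := Gamma_sum (fun a => aeW P (fun=> erefl)) L2dL.

Let Gam := Gamma X Z X' F G.
Let L1Gam : L1 P Gam := Gamma_L1 indepX copyX' Fx Gg sumG.
Let remainder := (\esum_(a in [set: A])
  'E_P[fun w => (`|dl a (Linv X Z F) w| * dl a F w ^+ 2)%R])%E.

Let remainderE : (remainder = \esum_(a in [set: A]) \int[P]_w (`|dl a G w| * dl a F w ^+ 2)%:E)%E.
Proof.
apply: eq_esum => a _; rewrite unlock.
have m H : L2 P H -> measurable_fun setT (fun w => (`|H w| * dl a F w ^+ 2)%:E).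
  move=> lH; apply/measurable_EFinP; apply: measurable_funM.
    by apply: measurableT_comp => //; exact: L2_meas lH.
  by apply: measurable_funX; exact: L2_meas (L2dF a).
apply: ae_eq_integral => //; [exact: m|exact: m|].
by apply: filterS (DGn a) => w -> _.
Qed.

Let term_ge0 a : (0 <= \int[P]_w (`|dl a G w| * dl a F w ^+ 2)%:E)%E.
Proof. by apply: integral_ge0 => w _; rewrite lee_fin mulr_ge0// sqr_ge0. Qed.

Let remainder_ge0 : (0 <= remainder)%E.
Proof. by rewrite remainderE; apply: esum_ge0. Qed.

Let c : R := Num.sqrt (2 / pi).
Let c_ge0 : 0 <= c. Proof. exact: sqrtr_ge0. Qed.

Let E_Gam : ('E_P[fun w => `|Gam w - 1|%R] = (Ex P (fun w => `|Gam w - 1|))%:E)%E.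
Proof. by rewrite unlock EFin_Ex//; apply: L1_norm; apply: L1B => //; exact: L1_cst. Qed.

Lemma dW_normal_le :
  (dW_normal P F <= c%:E * 'E_P[fun w => `|Gam w - 1|%R] + 2^-1%:E * remainder)%E.
Proof.
rewrite E_Gam -EFinM; have Ex0 : 0 <= c * Ex P (fun w => `|Gam w - 1|) by rewrite mulr_ge0// Ex_ge0.
have := remainder_ge0; case rE : remainder => [t| |]// t0; last first.
  by rewrite gt0_muley ?lte_fin ?invr_gt0// addey// leey.
rewrite -EFinM -EFinD; apply: ge_ereal_sup => _ [h hL <-].
have {}hL y z : `|h y - h z| <= `|y - z|.
  by have := hL (y, z) (conj Logic.I Logic.I); rewrite /= mul1r.
have lh := lipschitz_L1 hL (L2_L1 Fx.1).
have mh : measurable_fun setT h.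
  by apply: continuous_measurable_fun; exact: lipschitz_continuous.
rewrite unlock -[X in (X - _)%E]/(\int[P]_w (h (F w))%:E)%E -EFin_Ex//.
rewrite integral_normal_prob//; last exact: lipschitz_integrable_ndens.
rewrite -EFinB/= lee_fin.
apply: (stein_bound indepX copyX' Fx Gg x0 xg sumG hL).
by rewrite -remainderE rE.
Qed.

Hypothesis F_unit : Ex P (fun w => F w ^+ 2) = 1.

Let Ex_Gam : Ex P Gam = 1.
Proof. by rewrite /Gam (Ex_Gamma indepX copyX' Fx Gg x0 xg sumG). Qed.

Let GamL := Gamma X Z X' F (Linv X Z F).

(** [Gam] has mean E F^2 = 1 and [GamL] is its opposite almost surely, hence has mean -1; this
    reconciles the two sign conventions in the bounds. *)
Lemma variance_Gamma : ('V_P[GamL] = \int[P]_w ((Gam w - 1) ^+ 2)%:E)%E.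
Proof.
have GL : {ae P, forall w, GamL w = - Gam w} := Gamma_opp indepX copyX' Fx Lg.
have L1L : L1 P GamL := Gamma_L1 indepX copyX' Fx Lg sumL.
have ExL : Ex P GamL = -1.
  rewrite -Ex_Gam -(ExN L1Gam); apply: ae_eq_Ex => //; [exact: L1_meas L1L|exact: L1_meas (L1N L1Gam)].
have EL : ('E_P[GamL] = (-1)%:E)%E by rewrite unlock -EFin_Ex// ExL.
rewrite /variance covariance.unlock EL unlock.
apply: ae_eq_integral => //.
- apply/measurable_EFinP; have m := L1_meas (L1B L1L (L1_cst P (-1))).
  exact: measurable_funM.
- by apply/measurable_EFinP; apply: measurable_funX; exact: L1_meas (L1B L1Gam (L1_cst P 1)).
- by apply: filterS GL => w e _; congr EFin;
    rewrite -[LHS]/((GamL w - -1) * (GamL w - -1)) e; ring.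
Qed.

(** The spectral gap inequality with the error sent to 0. It is the only reason for which the energy
    can appear as a factor in the second bound. *)
Lemma energy_ge1 : (1 <= dirichlet_energy X Z F)%E.
Proof.
rewrite (rep_energy indepX Fx); set D := (\sum_(1 <= n <oo) _)%E.
have ipP : inner_product ip := @l2ipP _ _ _ mu.
have pos n : 0 <= n%:R * ip (proj ip Q coD n x) (proj ip Q coD n x).
  by rewrite mulr_ge0// (ip_ge0 ipP).
have D0 : (0 <= D)%E by apply: nneseries_ge0 => n _ _; rewrite lee_fin.
have n1 : nrm x = 1 by rewrite -(rep_nrm lw Fx) F_unit sqrtr1.
have h e : 0 < e -> (1 <= sqrte D + e%:E)%E.
  move=> e0; have [M] := energy_geX indepX x0 e0; rewrite n1 => hM.
  apply: (@le_trans _ _ (sqrte (\sum_(1 <= n < M)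
      (n%:R * ip (proj ip Q coD n x) (proj ip Q coD n x))%:E) + e%:E)%E).
    by rewrite sumEFin /= -EFinD lee_fin.
  rewrite leeD2r// lee_sqrt//.
  by apply: nneseries_lim_ge => n _; rewrite lee_fin.
have : (1 <= sqrte D)%E by apply/lee_addgt0Pr => e e0; exact: h.
rewrite -[X in (X <= _)%E](_ : sqrte 1 = 1%E); last by rewrite /= sqrtr1.
by rewrite lee_sqrt.
Qed.

Let fourth := (\esum_(a in [set: A]) 'E_P[fun w => (`|dl a F w| ^+ 4)%R])%E.

(** A Cauchy-Schwarz inequality, jointly in the sum and the expectation, in which one parameter [l]
    serves all terms and is optimized after summation. The sum of the E(Delta_a G)^2 is at most 2,
    which gives the leading [l] and finally the factor sqrt(2). *)
Lemma remainder_le : (remainder <= (Num.sqrt 2)%:E * sqrte fourth)%E.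
Proof.
have f0 a : (0 <= 'E_P[fun w => (`|dl a F w| ^+ 4)%R])%E.
  by rewrite unlock; apply: integral_ge0 => w _; rewrite lee_fin exprn_ge0.
have fourth0 : (0 <= fourth)%E by exact: esum_ge0.
case fE : fourth fourth0 => [t| |]// t0; last first.
  by rewrite /= gt0_muley ?leey// lte_fin sqrtr_gt0.
have m4 a : measurable_fun setT (fun w => `|dl a F w| ^+ 4).
  by apply: measurable_funX; apply: measurableT_comp => //; exact: L2_meas (L2dF a).
have L1_4 a : L1 P (fun w => `|dl a F w| ^+ 4).
  apply/integrableP; split; first exact/measurable_EFinP.
  under eq_integral do rewrite /= ger0_norm ?exprn_ge0//.
  have := sum_le_esum [fset a]%fset f0; rewrite -/fourth fE big_seq_fset1 unlock => h.
  exact: le_lt_trans h (ltry _).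
have amgm l (u v : R) : 0 < l -> `|u| * v ^+ 2 <= l / 2 * u ^+ 2 + (2 * l)^-1 * `|v| ^+ 4.
  move=> l0; have := sqr_ge0 (`|u| - l^-1 * v ^+ 2).
  have -> : `|v| ^+ 4 = (v ^+ 2) ^+ 2 by rewrite -[v ^+ 2]real_normK ?num_real// -exprM.
  rewrite -[u ^+ 2]real_normK ?num_real// => h.
  rewrite -subr_ge0 (_ : _ - _ = l / 2 * (`|u| - l^-1 * v ^+ 2) ^+ 2); last by field; rewrite gt_eqF.
  by rewrite mulr_ge0// divr_ge0// ltW.
have L1r a : L1 P (fun w => `|dl a G w| * dl a F w ^+ 2).
  apply: (@L1_le _ _ _ P (fun w => 1 / 2 * dl a G w ^+ 2 + (2 * 1)^-1 * `|dl a F w| ^+ 4)).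
  - apply: measurable_funM; last by apply: measurable_funX; exact: L2_meas (L2dF a).
    by apply: measurableT_comp => //; exact: L2_meas (L2dG a).
  - move=> w; rewrite (ger0_norm (mulr_ge0 (normr_ge0 _) (sqr_ge0 _))).
    exact: (amgm 1 _ _ ltr01).
  - by apply: L1D; apply: L1Z => //; case: (L2dG a).
have H l : 0 < l -> (remainder <= (l + t / (2 * l))%:E)%E.
  move=> l0; rewrite remainderE; apply: esum_le => s.
  under eq_bigr do rewrite -EFin_Ex//.
  rewrite sumEFin lee_fin.
  have b1 := sum_Delta_linv indepX copyX' Fx Gg x0 xg s; rewrite F_unit mulr1 in b1.
  have b2 : \sum_(a <- enum_fset s) Ex P (fun w => `|dl a F w| ^+ 4) <= t.
    rewrite -lee_fin -fE -sumEFin; apply: le_trans (sum_le_esum s f0).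
    by apply: lee_sum => a _; rewrite unlock EFin_Ex.
  apply: (@le_trans _ _ (l / 2 * \sum_(a <- enum_fset s) Ex P (fun w => dl a G w ^+ 2) +
      (2 * l)^-1 * \sum_(a <- enum_fset s) Ex P (fun w => `|dl a F w| ^+ 4))).
    rewrite !mulr_sumr -big_split /=; apply: ler_sum => a _.
    have lG := (L2dG a).2.
    rewrite -(ExZ _ lG) -(ExZ _ (L1_4 a)) -(ExD (L1Z _ lG) (L1Z _ (L1_4 a))).
    by apply: le_Ex => //; [apply: L1D; exact: L1Z|move=> w; exact: (amgm _ _ _ l0)].
  have l2 : 0 <= l / 2 by rewrite divr_ge0// ltW.
  have l3 : 0 <= (2 * l)^-1 by rewrite invr_ge0 mulr_ge0// ltW.
  apply: le_trans (lerD (ler_wpM2l l2 b1) (ler_wpM2l l3 b2)) _.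
  by rewrite divfK// mulrC.
have r0 := remainder_ge0; case rE : remainder r0 H => [r| |]// r0 H; last by have := H 1 ltr01.
by rewrite /= -EFinM lee_fin; apply: le_optimize => // l /H.
Qed.

Lemma dW_normal_le_fourth :
  (dW_normal P F <= c%:E * sqrte 'V_P[GamL] +
     (Num.sqrt 2 / 2)%:E * sqrte (dirichlet_energy X Z F) * sqrte fourth)%E.
Proof.
apply: le_trans dW_normal_le _; apply: leeD.
  rewrite lee_wpmul2l ?lee_fin// E_Gam variance_Gamma.
  by apply: le_norm_sqrt_integral; apply: L1B => //; exact: L1_cst.
apply: (@le_trans _ _ (2^-1%:E * ((Num.sqrt 2)%:E * sqrte fourth))%E).
  by rewrite lee_wpmul2l ?lee_fin ?invr_ge0//; exact: remainder_le.
rewrite muleA -EFinM [(2^-1 * _)%R]mulrC lee_wpmul2r ?sqrte_ge0//.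
(* The factor 1 is enlarged to the square root of the energy. *)
rewrite -[X in (X <= _)%E]mule1 lee_wpmul2l ?lee_fin ?divr_ge0 ?sqrtr_ge0//.
rewrite -[X in (X <= _)%E](_ : sqrte 1 = 1%E); last by rewrite /= sqrtr1.
rewrite lee_sqrt; first exact: energy_ge1.
exact: le_trans energy_ge1.
Qed.

End normal_approximation.

Theorem theorem4p5 (R : realType)
    (d : measure_display) (Omega : measurableType d) (P : probability Omega R)
    (A : countType) (E : A -> ptopologicalType) (E0 : ptopologicalType)
    (polishE : forall a, polish R (E a)) (polishE0 : polish R E0)
    (X : forall a, {RV P >-> borel (E a)}) (Z : {RV P >-> borel E0})
    (X' : forall a, {RV P >-> borel (E a)})
    (indepX : cond_independent X Z) (copyX' : cond_copies X Z X')
    (F : Omega -> R)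
    (F_L3 : LpEA X Z 3 F)
    (F_centered : {ae P, forall w, condexp P (sigmaZ Z) F w = 0})
    (F_unit : ('E_P[F ^+ 2] = 1)%E)
    (F_Gamma : Gamma_defined X Z X' F (Linv X Z F)) :
  (dW_normal P F <=
     (Num.sqrt (2 / pi))%:E
       * 'E_P[fun w => `|Gamma X Z X' F (\- Linv X Z F) w - 1|%R]
     + 2^-1%:E * \esum_(a in [set: A])
         'E_P[fun w => (`|Delta X Z X' a (Linv X Z F) w|
                        * Delta X Z X' a F w ^+ 2)%R])%E
  /\
  (LpEA X Z 4 F ->
   dW_normal P F <=
     (Num.sqrt (2 / pi))%:E * sqrte 'V_P[Gamma X Z X' F (Linv X Z F)]
     + (Num.sqrt 2 / 2)%:E * sqrte (dirichlet_energy X Z F)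
       * sqrte (\esum_(a in [set: A])
                  'E_P[fun w => (`|Delta X Z X' a F w| ^+ 4)%R]))%E.
Proof.
have [F3 [f0 Ff0]] := F_L3.
have L2F : L2 P F.
  have p2 : (1 <= 2%:E :> \bar R)%E by rewrite lee_fin ler1n.
  have p3 : (1 <= 3%:E :> \bar R)%E by rewrite lee_fin ler1n.
  apply/L2P; apply: (Lfun_subset p2 p3) F3; last by rewrite lee_fin ler_nat.
  exact: fin_num_measure.
have [_ Fx] := rep_represents L2F Ff0.
have x0 := centered_rep indepX Fx F_centered.
have [g [xg _]] := linv_existsX indepX (l2cls (joint_law X Z) f0).
split=> [|_]; first exact: (dW_normal_le indepX copyX' Fx x0 xg F_Gamma).
apply: (dW_normal_le_fourth indepX copyX' Fx x0 xg F_Gamma).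
apply: EFin_inj; rewrite -F_unit EFin_Ex; last by case: L2F.
by rewrite unlock.
Qed.
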